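(* Let $\Omega_1=(-1,0)$, $\Omega_2=(0,1)$, $\Omega=(-1,1)$, $T>0$, $\mathcal Q_i=\Omega_i\times(0,T)$, and let the data $\phi_i,\pi_i,\eta_{o,i},\eta_{w,i}$ ($i=1,2$) be as in the context. Let $u_0\in L^\infty(-1,1)$ with $0\le u_0\le 1$ be such that - $\varphi_i(u_0)\in W^{1,\infty}(\Omega_i)$ for $i=1,2$, - $\tilde\pi_1(u_{0,1})\cap\tilde\pi_2(u_{0,2})\neq\emptyset$ at $x=0$, where $u_{0,i}$ is the trace at $x=0$ of $u_0|_{\Omega_i}$. Then there exists a weak solution $u$ to the problem $(\mathcal P)$ with initial datum $u_0$ such that $\partial_x\varphi_i(u_i)\in L^\infty(\mathcal Q_i)$ for $i=1,2$.
   Context: Data. For $i=1,2$: $\phi_i\in(0,1)$ is a constant; $\pi_i\in C^1([0,1],\mathbb R)$ with $\pi_i'>0$ on $(0,1)$; $\eta_{o,i}\in C^0([0,1],\mathbb R_+)$ is (strictly) increasing with $\eta_{o,i}(0)=0$; $\eta_{w,i}\in C^0([0,1],\mathbb R_+)$ is (strictly) decreasing with $\eta_{w,i}(1)=0$. Put $\alpha_i=\pi_i(0)$, $\beta_i=\pi_i(1)$, $\lambda_i=\frac{\eta_{o,i}\eta_{w,i}}{\eta_{o,i}+\eta_{w,i}}$ (so $\lambda_i>0$ on $(0,1)$, $\lambda_i(0)=\lambda_i(1)=0$), and $\varphi_i(s)=\int_0^s\lambda_i(a)\pi_i'(a)\,da$, which is $C^1$ and strictly increasing on $[0,1]$. The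 monotone graph $\tilde\pi_i$ is $\tilde\pi_i(s)=\{\pi_i(s)\}$ for $s\in(0,1)$, $\tilde\pi_i(0)=(-\infty,\alpha_i]$, $\tilde\pi_i(1)=[\beta_i,+\infty)$. Traces at $x=0$ of a function $w$ on $\Omega_i$ (or on $\Omega_i\times(0,T)$) taking values in $[0,1]$ with $\varphi_i(w)$ Sobolev in $x$ are defined as $\varphi_i^{-1}$ of the trace of $\varphi_i(w)$. Weak solution to $(\mathcal P)$ with initial datum $u_0$: a function $u\in L^\infty((-1,1)\times(0,T))$ with $0\le u\le1$ a.e. such that, $u_i$ denoting its restriction to $\Omega_i\times(0,T)$: (i) $\varphi_i(u_i)\in L^2(0,T;H^1(\Omega_i))$, $i=1,2$; (ii) the traces at $x=0$ satisfy $\tilde\pi_1(u_1(0,t))\cap\tilde\pi_2(u_2(0,t))\neq\emptyset$ for a.e. $t\in(0,T)$; (iii) for all smooth $\psi$ compactly supported in $[-1,1]\times[0,T)$, $$\int_0^T\sum_{i=1,2}\int_{\Omega_i}\phi_iu\,\partial_t\psi\,dx\,dt+\sum_{i=1,2}\int_{\Omega_i}\phi_iu_0(x)\psi(x,0)\,dx-\int_0^T\sum_{i=1,2}\int_{\Omega_i}\partial_x\varphi_i(u_i)\,\partial_x\psi\,dx\,dt=0.$$ *)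

(* Defs.v *)
From HB Require Import structures.
From mathcomp Require Import all_boot all_order all_algebra.
From mathcomp Require Import all_classical all_reals all_analysis.

Set Implicit Arguments.
Unset Strict Implicit.
Unset Printing Implicit Defensive.

Import Order.TTheory GRing.Theory Num.Theory.
Import numFieldNormedType.Exports.

Local Open Scope classical_set_scope.
Local Open Scope ring_scope.

(* The two subdomains are indexed by 'I_2, counted from 0: the index 0 stands
   for Omega_1 = (-1, 0) and the index 1 for Omega_2 = (0, 1). Points of
   space-time are pairs (x, t). Elements of Lebesgue spaces are represented by
   Borel functions; values outside the domain under consideration are
   irrelevant. *)

Notation leb R := (@lebesgue_measure R).
Notation leb2 R := (@lebesgue_measure R \x @lebesgue_measure R)%E.

Definition Omega (R : realType) (i : 'I_2) : set R := `](i%:R - 1), i%:R[.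
Arguments Omega R i : clear implicits.

Definition Qset (R : realType) (T : R) (i : 'I_2) : set (R * R) :=
  Omega R i `*` `]0, T[.

(* C^1 on a closed interval: the derivative in the open interval extends
   continuously to the end points. The extension is needed because the
   two-sided derivative derive1 f means nothing at a and b. *)
Definition C1_itv (R : realType) (a b : R) (f : R -> R) : Prop :=
  [/\ {within `[a, b], continuous f},
      {in `]a, b[, forall s, derivable f s 1} &
      exists df : R -> R, {within `[a, b], continuous df} /\
                          {in `]a, b[, derive1 f =1 df}].

Record rock (R : realType) := Rock {
  porosity : R;
  cap_pressure : R -> R;
  eta_o : R -> R;
  eta_w : R -> R;
  porosity_itv : 0 < porosity < 1;
  cap_pressure_C1 : C1_itv 0 1 cap_pressure;
  cap_pressure_deriv_gt0 : {in `]0, 1[, forall s, 0 < derive1 cap_pressure s};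
  eta_o_continuous : {within `[0, 1], continuous eta_o};
  eta_o_ge0 : {in `[0, 1], forall s, 0 <= eta_o s};
  eta_o_incr : {in `[0, 1] &, {homo eta_o : s t / s < t}};
  eta_o0 : eta_o 0 = 0;
  eta_w_continuous : {within `[0, 1], continuous eta_w};
  eta_w_ge0 : {in `[0, 1], forall s, 0 <= eta_w s};
  eta_w_decr : {in `[0, 1] &, {homo eta_w : s t / s < t >-> t < s}};
  eta_w1 : eta_w 1 = 0
}.

Section Rock.
Context (R : realType) (rk : rock R).

Definition lambda (s : R) : R :=
  eta_o rk s * eta_w rk s / (eta_o rk s + eta_w rk s).

(* The primitive, from 0, of lambda * cap_pressure'. It matters on [0, 1]
   only; the minimum extends it by constants (for s < 0 the interval is empty),
   so that it may be composed with functions that lie in [0, 1] only almost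
   everywhere without losing measurability. *)
Definition kirchhoff (s : R) : R :=
  \int[leb R]_(a in `[0, Num.min s 1]) (lambda a * derive1 (cap_pressure rk) a).

Definition pi_tilde (s : R) : set R :=
  if s == 0 then `]-oo, cap_pressure rk 0]%classic
  else if s == 1 then `[cap_pressure rk 1, +oo[%classic
  else if 0 < s < 1 then [set cap_pressure rk s]
  else set0.

End Rock.

(* C^oo on the whole space, all iterated directional derivatives existing and
   being continuous; meant for V finite dimensional. *)
Definition smooth (R : realType) (V : normedModType R) (f : V -> R) : Prop :=
  forall vs : seq V,
    let g := foldr (fun v h => 'D_v h) f vs in
    continuous g /\ forall x v, derivable g x v.

(* The restriction of f to A is smooth (up to the boundary points that belong
   to A) and has compact support in A. *)
Definition test_function (R : realType) (V : normedModType R) (A : set V)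
    (f : V -> R) : Prop :=
  smooth f /\
  exists K : set V, [/\ compact K, K `<=` A & forall x, (A `\` K) x -> f x = 0].

Definition weak_derivative (R : realType) (I : set R) (v dv : R -> R) : Prop :=
  forall zeta : R -> R, test_function I zeta ->
    \int[leb R]_(x in I) (v x * derive1 zeta x) =
    - \int[leb R]_(x in I) (dv x * zeta x).

(* v is in W^{1,p}(I), with weak derivative dv *)
Definition sobolev (R : realType) (p : \bar R) (I : set R) (v dv : R -> R)
    : Prop :=
  [/\ v \_ I \in Lfun (leb R) p,
      dv \_ I \in Lfun (leb R) p &
      weak_derivative I v dv].

(* v is in L^2(0, T; H^1(Omega_i)), with weak space derivative dv *)
Definition L2H1 (R : realType) (T : R) (i : 'I_2) (v dv : R * R -> R) : Prop :=
  [/\ v \_ (Qset T i) \in Lfun (leb2 R) 2%:E,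
      dv \_ (Qset T i) \in Lfun (leb2 R) 2%:E &
      {ae leb R, forall t, t \in `]0, T[ ->
        sobolev 2%:E (Omega R i) (fun x => v (x, t)) (fun x => dv (x, t))}].

(* The trace at x = 0 of a function on Omega_i that is Sobolev: the value at 0
   of its representative that is continuous on the closure of Omega_i. *)
Definition trace0 (R : realType) (i : 'I_2) (v : R -> R) (l : R) : Prop :=
  exists g : R -> R,
    [/\ {within `[(i%:R - 1), i%:R], continuous g},
        {ae leb R, forall x, Omega R i x -> v x = g x} &
        g 0 = l].

(* s is the inverse image under kirchhoff of the trace of kirchhoff \o w *)
Definition saturation_trace0 (R : realType) (rk : rock R) (i : 'I_2)
    (w : R -> R) (s : R) : Prop :=
  s \in `[0, 1] /\ trace0 i (kirchhoff rk \o w) (kirchhoff rk s).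

Definition traces_connected (R : realType) (rk : 'I_2 -> rock R) (w : R -> R)
    : Prop :=
  exists s : 'I_2 -> R,
    (forall i, saturation_trace0 (rk i) i w (s i)) /\
    pi_tilde (rk 0) (s 0) `&` pi_tilde (rk 1) (s 1) !=set0.

Definition weak_solution (R : realType) (rk : 'I_2 -> rock R) (T : R)
    (u0 : R -> R) (u : R * R -> R) : Prop :=
  [/\ u \_ (`]-1, 1[ `*` `]0, T[) \in Lfun (leb2 R) +oo%E,
      {ae leb2 R, forall p,
        p.1 \in `]-1, 1[ -> p.2 \in `]0, T[ -> 0 <= u p <= 1},
      {ae leb R, forall t, t \in `]0, T[ ->
        traces_connected rk (fun x => u (x, t))} &
      exists dphiu : 'I_2 -> R * R -> R,
        (forall i, L2H1 T i (kirchhoff (rk i) \o u) (dphiu i)) /\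
        forall psi : R * R -> R,
          test_function ([set` `[-1, 1 : R]] `*` [set` `[0, T[]) psi ->
          \int[leb R]_(t in `]0, T[) (\sum_(i < 2) \int[leb R]_(x in Omega R i)
              (porosity (rk i) * u (x, t) * 'D_(0 : R, 1 : R) psi (x, t)))
          + \sum_(i < 2) \int[leb R]_(x in Omega R i)
              (porosity (rk i) * u0 x * psi (x, 0))
          - \int[leb R]_(t in `]0, T[) (\sum_(i < 2) \int[leb R]_(x in Omega R i)
              (dphiu i (x, t) * 'D_(1 : R, 0 : R) psi (x, t)))
          = 0].

(* Main.v *)
Require Import Defs.
From HB Require Import structures.
From mathcomp Require Import all_boot all_order all_algebra.
From mathcomp Require Import all_classical all_reals all_analysis.
From mathcomp Require Import measurable_realfun ring lra.
From mathcomp Require Import ess_sup_inf zify.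

(** The two media are unfolded to y = |x| in [0, 1], with the interface at
y = 0. Write v_i = varphi_i(u_i) (kirchhoff) and q_i for the flux d v_i / d y.
The equation phi_i d u_i / d t = d q_i / d y comes with q_i = 0 at y = 1 and, at
y = 0, with q_1 + q_2 = 0 and the existence of a pressure p such that
v_i = Phi i p, where Phi i is the Kirchhoff value as a nondecreasing function of
the pressure.

The key fact is that the flux obeys a maximum principle. Formally
q_t = (a q_y)_y with a = varphi_i'(u) / phi_i >= 0, and the interface creates no
new maximum, because the fluxes are opposite there while the two boundary values
v_i vary in the same direction. An explicit finite volume scheme, in which the
interface pressure is the one that makes the two fluxes opposite, has this
property exactly (step_flux): under the CFL condition each new flux is a convex
combination of old ones. The hypotheses on the initial data say that the first
fluxes are bounded, at the interface too thanks to the compatibility of the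
traces. Hence the discrete v_i are Lipschitz in space uniformly in the grid, and
conservation of mass on blocks of cells makes the discrete u_i equicontinuous in
time (sol_time_modulus), as varphi_i has a uniformly continuous inverse.

Limits are taken pointwise along an ultrafilter on the grid sizes, so no
subsequence is extracted. The limit u is continuous on each side, v_i is
Lipschitz in space, and the transmission condition holds at all times since it
passes to the limit as an equality of continuous functions of the pressure.
Convergence being pointwise, the nonlinear terms converge too. The only product
of a weak and a strong limit is the flux times the derivative of a test
function. It is treated as a Stieltjes sum of the latter with respect to v_i,
whose limit G is Lipschitz and satisfies dG = C dV at the points of
differentiability of V (stieltjes_lim_approx, stieltjes_side). So the
fundamental theorem of calculus for Lipschitz functions (lipschitz_FTC), which
follows from the Radon-Nikodym theorem and Lebesgue differentiation, identifies
it with an integral.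

The weak formulation comes from the same theorem applied in time. For a test
function psi, the mass of phi_i u psi is Lipschitz in t, and its derivative is
the storage term minus the flux term (paired_mass_derive). Finally, in
initial_profile, a function with bounded weak derivative is shown to be
Lipschitz by testing with mollified indicator functions (weak_lipschitz). *)

Set Implicit Arguments.
Unset Strict Implicit.
Unset Printing Implicit Defensive.

Import Order.TTheory GRing.Theory Num.Theory.
Import numFieldNormedType.Exports.

Local Open Scope classical_set_scope.
Local Open Scope ring_scope.

(** * Lipschitz functions and the fundamental theorem of calculus *)

Section AlmostEverywhere.
Context d (T : measurableType d) (R : realType) (mu : {measure set T -> \bar R}).

Lemma ae_mono (P Q : T -> Prop) : {ae mu, forall x, P x} ->
  (forall x, P x -> Q x) -> {ae mu, forall x, Q x}.
Proof.
by move=> aP PQ; apply: filterS aP.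
Qed.

Lemma ae_mono2 (P Q S : T -> Prop) : {ae mu, forall x, P x} ->
  {ae mu, forall x, Q x} -> (forall x, P x -> Q x -> S x) ->
  {ae mu, forall x, S x}.
Proof.
by move=> aP aQ PQS; apply: filterS2 aP aQ.
Qed.

Lemma ae_eq_integrable (D : set T) (f g : T -> \bar R) : measurable D ->
  measurable_fun D g -> ae_eq mu D f g -> mu.-integrable D f ->
  mu.-integrable D g.
Proof.
move=> mD mg fg /integrableP[mf fi]; apply/integrableP; split=> //.
rewrite -(@ae_eq_integral _ _ _ _ _ (fun x => `|g x|%E) (fun x => `|f x|%E))//.
- exact: measurableT_comp.
- exact: measurableT_comp.
- by apply: ae_mono fg _ => x h /h ->.
Qed.

Lemma ae_eq_Rintegral (D : set T) (f g : T -> R) : measurable D ->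
  measurable_fun D f -> measurable_fun D g ->
  {ae mu, forall x, D x -> f x = g x} ->
  \int[mu]_(x in D) f x = \int[mu]_(x in D) g x.
Proof.
move=> mD mf mg fg; rewrite /Rintegral; congr fine; apply: ae_eq_integral => //.
- exact/measurable_EFinP.
- exact/measurable_EFinP.
- by apply: ae_mono fg _ => x h /h ->.
Qed.

Lemma ae_dominated_Rintegral (D : set T) (f b : T -> R) : measurable D ->
  measurable_fun D f -> mu.-integrable D (EFin \o b) ->
  (forall x, D x -> 0 <= b x) ->
  {ae mu, forall x, D x -> `|f x| <= b x} ->
  mu.-integrable D (EFin \o f) /\
  `|\int[mu]_(x in D) f x| <= \int[mu]_(x in D) b x.
Proof.
move=> mD mf ib b0 fb.
have mb : measurable_fun D b by have /integrableP[/measurable_EFinP] := ib.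
have le_fb : (\int[mu]_(x in D) `|f x|%:E <= \int[mu]_(x in D) (b x)%:E)%E.
  apply: ae_ge0_le_integral => //.
  - by apply/measurable_EFinP; exact: measurableT_comp.
  - exact/measurable_EFinP.
have ifin : mu.-integrable D (EFin \o f).
  apply/integrableP; split; first exact/measurable_EFinP.
  by apply: le_lt_trans le_fb _; exact: integrable_lty.
split => //; apply: le_trans (le_normr_Rintegral mD ifin) _.
rewrite /Rintegral; apply: fine_le => //.
- by apply: integrable_fin_num => //; have := integrable_abse ifin.
- exact: integrable_fin_num.
Qed.

End AlmostEverywhere.

Section Clamp.
Context (R : realType).

(** Composition with the projection onto [a, b] turns functions that are
known on a segment only into functions on the line with the same modulus of
continuity. *)
Definition clamp (a b x : R) : R := Num.max a (Num.min b x).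

Lemma clamp_itv a b x : a <= b -> a <= clamp a b x <= b.
Proof.
by move=> ab; rewrite /clamp le_max lexx/= ge_max ge_min lexx ab.
Qed.

Lemma clamp_id a b x : a <= x <= b -> clamp a b x = x.
Proof.
by move=> /andP[ax xb]; rewrite /clamp (min_idPr xb) (max_idPr ax).
Qed.

Lemma clamp_incr a b x y : a <= b -> x <= y ->
  0 <= clamp a b y - clamp a b x <= y - x.
Proof.
move=> ab xy; rewrite /clamp !maxEle !minEle.
have [bx|bx] := leP b x; have [By|By] := leP b y;
  have [|?] := leP a x; have [|?] := leP a y; rewrite ?ab; move=> *; apply/andP; split; lra.
Qed.

Lemma clamp_lip a b x y : a <= b -> `|clamp a b x - clamp a b y| <= `|x - y|.
Proof.
move=> ab; wlog xy : x y / y <= x => [h|].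
  by case: (leP y x) => [/h//|/ltW /h]; rewrite distrC (distrC y).
have /andP[h1 h2] := clamp_incr ab xy.
by rewrite (ger0_norm h1) ger0_norm ?subr_ge0.
Qed.

Lemma clamp_continuous a b : a <= b -> continuous (clamp a b).
Proof.
move=> ab x; apply/cvgrPdist_lt => e e0; near=> y.
apply: le_lt_trans (clamp_lip _ _ ab) _.
by near: y; exact: (@cvgr_dist_lt _ _ _ _ _ id x).
Unshelve. all: by end_near. Qed.

End Clamp.

Section LipschitzFTC.
Context (R : realType).
Notation mu := (@lebesgue_measure R).

(** Outer measures compare because the half-open intervals covering a set
do: the Stieltjes length of each of them is at most C times its length. *)
Lemma stieltjes_dominated (f : cumulative R R) (C : R) : 0 < C ->
  (forall x y, x <= y -> f y - f x <= C * (y - x)) ->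
  forall A, measurable A -> mu A = 0 -> lebesgue_stieltjes_measure f A = 0.
Proof.
move=> C0 fC A mA muA0.
have : ((C^-1)%:E * lebesgue_stieltjes_measure f A <= mu A)%E.
  apply: le_ereal_inf_tmp => _ [B [mB AB] <-].
  have fB : (lebesgue_stieltjes_measure f A <=
             \sum_(0 <= k <oo) wlength f (B k))%E.
    by apply: ereal_inf_lbound; exists B.
  have w0 (g : cumulative R R) k : (0 <= wlength g (B k))%E by exact: wlength_ge0.
  have step : (\sum_(0 <= k <oo) wlength f (B k) <=
             \sum_(0 <= k <oo) (C%:E * wlength idfun (B k)))%E.
    apply: lee_nneseries => [k _ _|k _]; first exact: w0.
    have [->|[[a b]/= ab ->]] := (ocitvP (B k)).1 (mB k).
      by rewrite !wlength0 mule0.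
    by rewrite !wlength_itv_bnd ?(ltW ab)// -EFinM lee_fin fC ?(ltW ab).
  rewrite nneseriesZl in step; last by move=> k _; exact: (w0 idfun).
  rewrite lee_pdivrMl//; exact: le_trans step.
rewrite muA0 => h; apply/eqP; rewrite eq_le measure_ge0 andbT.
by rewrite lee_pdivrMl// mule0 in h.
Qed.

(** The function G x + K x is nondecreasing and Lipschitz, so that its
Stieltjes measure is absolutely continuous and the Radon-Nikodym theorem gives
it a density; K is then subtracted. *)
Lemma lipschitz_density (a b K : R) (G : R -> R) : a < b ->
  (forall x y, a <= x <= b -> a <= y <= b -> `|G x - G y| <= K * `|x - y|) ->
  exists f : R -> R, mu.-integrable setT (EFin \o f) /\
    forall x, a <= x <= b -> G x - G a = \int[mu]_(t in `]a, x]) f t.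
Proof.
move=> ab Glip.
have K0 : 0 <= K.
  have := Glip a b; rewrite !lexx (ltW ab) => /(_ isT isT) h.
  have := le_trans (normr_ge0 _) h.
  by rewrite pmulr_lge0// distrC gtr0_norm subr_gt0.
pose c := clamp a b.
have c_itv x : a <= c x <= b by apply: clamp_itv; exact: ltW.
have cid x : a <= x <= b -> c x = x by exact: clamp_id.
have c_mon x y : x <= y -> 0 <= c y - c x <= y - x.
  by apply: clamp_incr; exact: ltW.
(* nondecreasing and right-continuous, hence a cumulative function *)
pose g x := G (c x) + K * c x.
have g_mon x y : x <= y -> 0 <= g y - g x <= (K + K + 1) * (y - x).
  move=> xy; have cc := c_mon _ _ xy.
  have := Glip _ _ (c_itv y) (c_itv x).
  rewrite ler_norml (ger0_norm (_ : 0 <= c y - c x)); last by case/andP: cc.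
  rewrite /g; nra.
have gnd : nondecreasing g by move=> x y /g_mon; lra.
have grc : right_continuous g.
  apply: right_continuousW => x; apply/cvgrPdist_lt => e e0.
  near=> y.
  have : `|x - y| < e / (K + K + 2).
    by near: y; apply: (@cvgr_dist_lt _ _ _ _ _ id x) => //;
       rewrite divr_gt0//; lra.
  rewrite ltr_pdivlMr; last lra.
  case: (leP x y) => [xy|/ltW xy]; have /andP[] := g_mon _ _ xy.
    rewrite (ler0_norm (_ : x - y <= 0)) ?subr_le0// => h1 h2 h3.
    by rewrite ltr_norml; apply/andP; split; nra.
  rewrite (ger0_norm (_ : 0 <= x - y)) ?subr_ge0// => h1 h2 h3.
  by rewrite ltr_norml; apply/andP; split; nra.
pose m := isCumulative.Build R _ R g gnd grc.
pose gc : cumulative R R := HB.pack g m.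
have mab : measurable (`]a, b]%classic : set (measurableTypeR R)) by exact: measurable_itv.
have nuab x y : x <= y -> lebesgue_stieltjes_measure gc `]x, y]%classic = (g y - g x)%:E.
  move=> xy; rewrite /lebesgue_stieltjes_measure /measure_extension measurable_mu_extE/=.
    by rewrite wlength_itv_bnd.
  exact: is_ocitv.
have nufin : (lebesgue_stieltjes_measure gc `]a, b]%classic < +oo)%E by rewrite nuab ?(ltW ab)// ltry.
have dom : mfrestr mab nufin `<< mu.
  apply/null_content_dominatesP => A mA A0; rewrite /mfrestr/= /mrestr.
  apply: (@stieltjes_dominated gc (K + K + 1)); [lra| |exact: measurableI|].
    by move=> x y /g_mon/= /andP[].
  apply/eqP; rewrite eq_le measure_ge0 andbT -A0.
  by apply: le_measure; rewrite ?inE//; exact: measurableI.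
have [f0 [f0ge f0fin f0int nuE]] := radon_nikodym_sigma_finite dom.
have f0E : f0 = EFin \o (fine \o f0) by apply/funext => x /=; rewrite fineK.
have intf (A : set R) : measurable A -> mu.-integrable A (EFin \o (fine \o f0)).
  by move=> mA; rewrite -f0E; apply: integrableS f0int.
have intK (A : set R) : measurable A -> (mu A < +oo)%E -> mu.-integrable A (EFin \o (fun=> K)).
  by move=> mA Afin; apply: measurable_bounded_integrable => //; exact: bounded_cst.
have fin_itv x : (mu `]a, x]%classic < +oo)%E.
  by rewrite lebesgue_measure_itv/=; case: ifP => // _; rewrite -EFinD ltry.
exists ((fun x => fine (f0 x) - K) \_ `]a, b]); split.
  have -> : EFin \o ((fun x => fine (f0 x) - K) \_ `]a, b]) =
     (fun x => (EFin \o (fine \o f0)) x - (EFin \o (fun=> K)) x)%E \_ `]a, b].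
    by apply/funext => x /=; rewrite /patch; case: ifP.
  apply: (integrable_mkcond _ mab).1; apply: integrableB; [exact: mab|..].
    exact: (intf _ (measurable_itv _)).
  exact: (intK _ (measurable_itv _) (fin_itv b)).
move=> x xab.
have : mfrestr mab nufin `]a, x]%classic = (g x - g a)%:E.
  rewrite /mfrestr /mrestr/= -nuab; last by case/andP: xab.
  congr (lebesgue_stieltjes_measure gc _).
  apply/seteqP; split=> y /=; rewrite !in_itv/=; first by case.
  by move=> /andP[-> yx]; rewrite yx (le_trans yx)//; case/andP: xab.
rewrite nuE; last exact: measurable_itv.
move=> /(congr1 fine) /=.
rewrite /g !cid ?lexx ?(ltW ab)// => fE.
have -> : G x - G a = (G x + K * x - (G a + K * a)) - K * (x - a) by ring.
rewrite -fE (@eq_Rintegral _ _ _ _ _ (fun t => fine (f0 t) - K)); last first.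
  move=> y; rewrite inE/= in_itv/= => /andP[ay yx].
  rewrite patchE mem_set//= in_itv/= ay/=.
  by case/andP: xab => _; exact: le_trans.
rewrite RintegralB//; [|exact: (intf _ (measurable_itv _))|exact: (intK _ (measurable_itv _) (fin_itv x))].
congr (_ - _).
  by rewrite /Rintegral; congr fine; apply: eq_integral => y _; rewrite fineK.
rewrite Rintegral_cst//; congr (_ * _).
case/andP: xab => ax xb.
suff h : mu `]a, x]%classic = (x - a)%:E by exact: (esym (congr1 fine h)).
rewrite lebesgue_measure_itv/=; case: ltP => //.
by rewrite lee_fin => ?; congr (_%:E); apply/eqP; rewrite eq_sym subr_eq0 eq_le ax andbT.
Unshelve. all: by end_near. Qed.

(** A Lipschitz function is the primitive of a density, so by Lebesgue's
differentiation theorem it is a.e. differentiable and is the integral of its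
derivative. The derivative is presented as any measurable D that agrees with it
where it exists, because the functions to which this applies come with such a D. *)
Lemma lipschitz_FTC (a b K : R) (G : R -> R) : a < b ->
  (forall x y, a <= x <= b -> a <= y <= b -> `|G x - G y| <= K * `|x - y|) ->
  {ae mu, forall x, a < x < b -> derivable G x 1} /\
  forall D : R -> R, measurable_fun `]a, b[ D ->
   {ae mu, forall x, a < x < b -> derivable G x 1 -> D x = derive1 G x} ->
   mu.-integrable `]a, b[ (EFin \o D) /\
   \int[mu]_(x in `]a, b[) D x = G b - G a.
Proof.
move=> ab Glip.
have [f [fint fE]] := lipschitz_density ab Glip.
have intf (A : set R) : measurable A -> mu.-integrable A (EFin \o f).
  by move=> mA; apply: integrableS fint.
have locf : locally_integrable [set: R] f.
  by have := integrable_locally_restrict measurableT fint; rewrite patch_setT.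
have dG : {ae mu, forall x, a < x < b -> derivable G x 1 /\ derive1 G x = f x}.
  have := @FTC1 _ f (BRight a) (fun y => intf _ (measurable_itv _)) locf.
  move=> /ae_mono; apply => x /= h /andP[ax xb].
  have /h[dF F'] : (BRight a < BRight x)%O by rewrite bnd_simp.
  have eqG : {near x, (fun y => G a + \int[mu]_(t in `]a, y]) f t) =1 G}.
    near=> y; suff : G y - G a = \int[mu]_(t in `]a, y]) f t.
      by move=> <-; rewrite addrC subrK.
    apply: fE.
    apply/andP; split; apply: ltW; near: y.
      exact: lt_nbhsr.
    exact: lt_nbhsl.
  have dcF : is_derive x 1 (fun y => G a + \int[mu]_(t in `]a, y]) f t) (f x).
    rewrite -[f x]add0r; apply: is_deriveD.
    by rewrite -F' derive1E; exact: DeriveDef.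
  have dGx := near_eq_is_derive eqG dcF.
  split; first exact: ex_derive.
  by rewrite derive1E derive_val.
split; first by apply: ae_mono dG _ => x h /h[].
move=> D mD DG.
have DE : ae_eq mu (`]a, b[%classic : set R) (EFin \o f) (EFin \o D).
  apply: ae_mono2 dG DG _ => x h1 h2; rewrite /= in_itv/= => xab.
  by have [d <-] := h1 xab; rewrite h2.
have mDE := (measurable_EFinP _ _).2 mD.
have intD : mu.-integrable `]a, b[ (EFin \o D).
  by apply: (ae_eq_integrable _ _ DE) => //; exact: (intf _ (measurable_itv _)).
split => //.
have -> : \int[mu]_(x in `]a, b[) D x = \int[mu]_(x in `]a, b[) f x.
  apply: (@ae_eq_Rintegral _ (measurableTypeR R)) => //.
    apply/measurable_EFinP; apply: (@measurable_int _ _ _ mu).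
    exact: (intf _ (measurable_itv _)).
  by apply: ae_mono DE _ => x h /h/= [].
rewrite fE ?lexx ?(ltW ab)// Rintegral_itv_bndo_bndc//.
exact: (intf _ (measurable_itv _)).
Unshelve. all: by end_near. Qed.

End LipschitzFTC.

(** * Limits along an ultrafilter *)

Section UltraLimit.

(** Along a fixed free ultrafilter every bounded real sequence converges.
All the limits below are taken along it, pointwise, in place of the extraction
of subsequences: a limit object is then given by a formula, and it inherits
bounds and moduli of continuity. *)
Definition Unat : set_system nat :=
  sval (cid (@ultraFilterLemma nat \oo _)).

Lemma Unat_ultra : UltraFilter Unat.
Proof. by have [] := svalP (cid (@ultraFilterLemma nat \oo _)). Qed.

#[global] Instance Unat_proper : ProperFilter Unat.
Proof. exact: (@ultra_proper _ _ Unat_ultra). Qed.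

Lemma Unat_eventually (P : nat -> Prop) :
  (\forall n \near \oo, P n) -> \forall n \near Unat, P n.
Proof. by have [_] := svalP (cid (@ultraFilterLemma nat \oo _)); apply. Qed.

Lemma Unat_ge (P : nat -> Prop) N :
  (forall n, (N <= n)%N -> P n) -> \forall n \near Unat, P n.
Proof. by move=> NP; apply: Unat_eventually; exists N. Qed.

Lemma Unat_cvg {T : topologicalType} (a : nat -> T) (l : T) :
  a n @[n --> \oo] --> l -> a n @[n --> Unat] --> l.
Proof. by move=> al A /al; exact: Unat_eventually. Qed.

Lemma image_ultra {T : Type} (a : nat -> T) : UltraFilter (a @ Unat).
Proof.
split; first exact: fmap_proper_filter.
move=> G PG UG; apply/seteqP; split=> [A GA|A]; last exact: UG.
have [//|UC] := in_ultra_setVsetC (a @^-1` A) Unat_ultra.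
have GC : G (~` A) by apply: UG; exact: UC.
by have := filter_ex (filterI GA GC) => -[x []].
Qed.

Context (R : realType).
Implicit Types a b : nat -> R.

Definition ulim a : R := lim (a @ Unat).

Lemma ulim_cvg a (B : R) : (forall n, `|a n| <= B) -> a n @[n --> Unat] --> ulim a.
Proof.
move=> aB; have := @segment_compact R (- B) B; rewrite compact_ultra.
move=> /(_ _ (image_ultra a)) [|l [_ al]].
  by apply: (@filterE _ Unat) => n; rewrite /= in_itv/= -ler_norml.
by apply/cvg_ex; exists l.
Qed.

Lemma ulimE a l : a n @[n --> Unat] --> l -> ulim a = l.
Proof. by move=> al; apply: cvg_lim => //; exact: Rhausdorff. Qed.

Lemma Unat_le a b (l m : R) : a n @[n --> Unat] --> l -> b n @[n --> Unat] --> m ->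
  (\forall n \near Unat, a n <= b n) -> l <= m.
Proof. by move=> al bm ab; apply: (ler_cvg_to al bm ab). Qed.

Lemma Unat_norm_le a (l B : R) : a n @[n --> Unat] --> l ->
  (\forall n \near Unat, `|a n| <= B) -> `|l| <= B.
Proof.
move=> al aB; apply: (@Unat_le (fun n => `|a n|) (fun=> B)) => //.
- exact: cvg_norm.
- exact: cvg_cst.
Qed.

End UltraLimit.

(** * An explicit scheme on two segments glued at the interface *)

Lemma sum_I2 (R : nmodType) (f : 'I_2 -> R) i :
  \sum_(k < 2) f k = f i + f (rev_ord i).
Proof.
rewrite big_ord_recl big_ord1.
have e0 : rev_ord (ord0 : 'I_2) = lift ord0 ord0 by apply/val_inj.
have e1 : rev_ord (lift ord0 ord0 : 'I_2) = ord0 by apply/val_inj.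
case: (eqVneq i ord0) => [->|i0]; first by rewrite e0.
have -> : i = lift ord0 ord0.
  by apply/val_inj; case: i i0 => -[|[|]].
by rewrite e1 addrC.
Qed.

Lemma block_exists N j r : (0 < r)%N -> (r <= N)%N -> (j <= N)%N ->
  exists a, [/\ (a <= j)%N, (j < a + r)%N & (a + r <= N.+1)%N].
Proof.
move=> r0 rN jN; exists (minn j (N.+1 - r)); split; first exact: geq_minl.
- by rewrite /minn; case: ifP => ?; lia.
- by rewrite /minn; case: ifP => ?; lia.
Qed.

Section Scheme.
Context (R : realType) (por : 'I_2 -> R) (kf : 'I_2 -> R -> R)
  (tr : 'I_2 -> R -> R) (L pm : R).

(** The side i of the interface carries unknowns u i 0, u i 1, ... at the
points j / N of [0, 1], where 0 is the interface. The two Kirchhoff values next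
to the interface enter the transmission condition through their sum only. *)
Definition total (u : 'I_2 -> nat -> R) : R := \sum_(k < 2) kf k (u k 0%N).

(** The left neighbour of the first cell is the interface itself, where the
Kirchhoff value tr i (total u) is shared out from the total in such a way that
the two fluxes cancel. *)
Definition vprev (u : 'I_2 -> nat -> R) (i : 'I_2) (j : nat) : R :=
  if j is j'.+1 then kf i (u i j') else tr i (total u).

(** No flux leaves through the outer boundary, whence the value 0 beyond
the last cell. *)
Definition flux (N : nat) (u : 'I_2 -> nat -> R) (i : 'I_2) (j : nat) : R :=
  if (j <= N)%N then N%:R * (kf i (u i j) - vprev u i j) else 0.

Definition step (N : nat) (tau : R) (u : 'I_2 -> nat -> R) :=
  fun (i : 'I_2) (j : nat) =>
  u i j + tau * N%:R / por i * (flux N u i j.+1 - flux N u i j).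

Definition sol N tau u n := iter n (step N tau) u.

Definition in_range (u : 'I_2 -> nat -> R) := forall i j, 0 <= u i j <= 1.

Definition flux_le (K : R) N u := forall i j, `|flux N u i j| <= K.

Hypothesis pm0 : 0 < pm.
Hypothesis por_pm : forall i, pm <= por i.
Hypothesis L0 : 0 <= L.
Hypothesis kf0 : forall i, kf i 0 = 0.
Hypothesis kf_incr : forall i s t, 0 <= s -> s <= t -> t <= 1 ->
  0 <= kf i t - kf i s <= L * (t - s).
Let V := \sum_(i < 2) kf i 1.
Hypothesis tr_sum : forall c, 0 <= c <= V -> \sum_(i < 2) tr i c = c.
Hypothesis tr_incr : forall i c c', 0 <= c -> c <= c' -> c' <= V ->
  tr i c <= tr i c'.
Hypothesis tr_itv : forall i c, 0 <= c <= V -> 0 <= tr i c <= kf i 1.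

(** The factor 2 bounds each coefficient A of kf_step by 1/2, so that the
two of them that act on one flux have a sum at most 1. *)
Definition cfl (N : nat) (tau : R) :=
  0 <= tau /\ tau * N%:R * N%:R * L * 2 <= pm.

Let por0 i : 0 < por i.
Proof. exact: lt_le_trans (por_pm i). Qed.

Lemma kf_slope i s t : 0 <= s <= 1 -> 0 <= t <= 1 ->
  exists2 th, 0 <= th <= L & kf i t - kf i s = th * (t - s).
Proof.
wlog st : s t / s <= t => [h|].
  have [st|/ltW ts] := leP s t; first exact: h.
  move=> s1 t1; have [th thL E] := h _ _ ts t1 s1.
  by exists th => //; rewrite -opprB E -mulrN opprB.
move=> /andP[s0 _] /andP[_ t1]; have /andP[k0 kL] := kf_incr i s0 st t1.
have [E|ne] := eqVneq s t; first by exists 0; rewrite ?lexx// E !subrr mulr0.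
have st' : 0 < t - s by rewrite subr_gt0 lt_neqAle ne.
exists ((kf i t - kf i s) / (t - s)); last by rewrite divfK// gt_eqF.
by rewrite divr_ge0 ?(ltW st')//= ler_pdivrMr.
Qed.

Lemma kf_itv i s : 0 <= s <= 1 -> 0 <= kf i s <= kf i 1.
Proof.
move=> /andP[s0 s1]; have := kf_incr i s0 s1 (lexx 1).
have := kf_incr i (lexx 0) s0 s1; rewrite kf0 subr0.
by move=> /andP[-> _]; rewrite subr_ge0 => /andP[-> _].
Qed.

Lemma total_itv u : in_range u -> 0 <= total u <= V.
Proof.
move=> ru; rewrite sumr_ge0/= => [|i _].
  by apply: ler_sum => i _; have /andP[] := kf_itv i (ru i 0%N).
by have /andP[] := kf_itv i (ru i 0%N).
Qed.

Lemma vprev_itv u i j : in_range u -> 0 <= vprev u i j <= kf i 1.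
Proof. by move=> ru; case: j => [|j] /=; [exact/tr_itv/total_itv|exact/kf_itv]. Qed.

Lemma flux_out u N i j : in_range u ->
  - (N%:R * kf i (u i j)) <= flux N u i j.+1 <= N%:R * (kf i 1 - kf i (u i j)).
Proof.
move=> ru; have /andP[v0 v1] := kf_itv i (ru i j).
have /andP[w0 w1] := kf_itv i (ru i j.+1); have N0 : 0 <= N%:R :> R by [].
by rewrite /flux/=; case: ifP => _; apply/andP; split; nra.
Qed.

Lemma flux_in u N i j : in_range u ->
  - (N%:R * (kf i 1 - kf i (u i j))) <= flux N u i j <= N%:R * kf i (u i j).
Proof.
move=> ru; have /andP[v0 v1] := kf_itv i (ru i j).
have /andP[w0 w1] := vprev_itv i j ru; have N0 : 0 <= N%:R :> R by [].
by rewrite /flux/=; case: ifP => _; apply/andP; split; nra.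
Qed.

(** Each flux that leaves a cell is bounded by a multiple of u, and each one
that enters it by a multiple of 1 - u; under the CFL condition one step cannot
overshoot. *)
Lemma step_range u N tau : cfl N tau -> in_range u -> in_range (step N tau u).
Proof.
move=> [t0 tL] ru i j; rewrite /step.
have /andP[u0 u1] := ru i j.
have /andP[a1 a2] := flux_out N i j ru; have /andP[b1 b2] := flux_in N i j ru.
have N0 : 0 <= N%:R :> R by [].
have /andP[k0 k1] := kf_incr i (lexx 0) u0 u1; rewrite kf0 !subr0 in k0 k1.
have /andP[l0 l1] := kf_incr i u0 u1 (lexx 1).
set F := flux N u i j.+1 - flux N u i j.
set mu := tau * N%:R / por i.
have mu0 : 0 <= mu by rewrite /mu divr_ge0 ?mulr_ge0// ltW.
have muL : mu * N%:R * L * 2 <= 1.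
  rewrite /mu -!mulrA [(por i)^-1 * _]mulrC !mulrA ler_pdivrMr// mul1r.
  exact: le_trans (por_pm i).
have Flb : - (2 * N%:R * (L * u i j)) <= F.
  have : N%:R * kf i (u i j) <= N%:R * (L * u i j) by rewrite ler_wpM2l.
  rewrite /F; lra.
have Fub : F <= 2 * N%:R * (L * (1 - u i j)).
  have : N%:R * (kf i 1 - kf i (u i j)) <= N%:R * (L * (1 - u i j)) by rewrite ler_wpM2l.
  rewrite /F; lra.
have := ler_wpM2l mu0 Flb; have := ler_wpM2l mu0 Fub.
have := ler_wpM2r u0 muL.
have u1' : 0 <= 1 - u i j by lra.
have := ler_wpM2r u1' muL.
move: (mu * F) (u i j) => X x; rewrite !mul1r => *.
apply/andP; split; lra.
Qed.

Lemma convex3 (K A B f g h : R) : 0 <= A -> 0 <= B -> A + B <= 1 ->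
  `|f| <= K -> `|g| <= K -> `|h| <= K ->
  `|(1 - A - B) * f + A * g + B * h| <= K.
Proof.
move=> A0 B0 AB; rewrite !ler_norml => /andP[f1 f2] /andP[g1 g2] /andP[h1 h2].
have C0 : 0 <= 1 - A - B by lra.
have := ler_wpM2l A0 g1; have := ler_wpM2l A0 g2.
have := ler_wpM2l B0 h1; have := ler_wpM2l B0 h2.
have := ler_wpM2l C0 f1; have := ler_wpM2l C0 f2.
move: ((1 - A - B) * f) (A * g) (B * h) => x y z *.
apply/andP; split; lra.
Qed.

(** In terms of Kirchhoff values the step is linear in the fluxes, with a
coefficient (the slope of kf between the old and the new value) that is
nonnegative and small. *)
Lemma kf_step u N tau i j : cfl N tau -> in_range u ->
  exists2 A, 0 <= A <= 1 / 2 &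
   N%:R * (kf i (step N tau u i j) - kf i (u i j)) =
   A * (flux N u i j.+1 - flux N u i j).
Proof.
move=> ct ru; have ru' := step_range ct ru; case: (ct) => t0 tL.
have [th /andP[th0 thL] ->] := kf_slope i (ru i j) (ru' i j).
have N0 : 0 <= N%:R :> R by [].
exists (th * (tau * N%:R / por i) * N%:R); last by rewrite /step; ring.
rewrite !mulr_ge0 ?invr_ge0 ?mulr_ge0 ?(ltW (por0 _))//=.
rewrite -!mulrA [(por i)^-1 * _]mulrC !mulrA ler_pdivrMr//.
apply: (@le_trans _ _ (tau * N%:R * N%:R * L)).
  have : 0 <= tau * N%:R * N%:R by rewrite !mulr_ge0.
  nra.
have := por_pm i; lra.
Qed.

Lemma same_sign_split (x y : R) : 0 <= x * y -> exists2 th, 0 <= th <= 1 &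
  x = th * (x + y).
Proof.
move=> xy; have [E|ne] := eqVneq (x + y) 0.
  have x0 : x = 0.
    have yE : y = - x by lra.
    have : x ^+ 2 <= 0 by rewrite yE in xy; nra.
    by move=> h; apply/eqP; rewrite -sqrf_eq0 eq_le h sqr_ge0.
  by exists 0; rewrite ?lexx ?ler01// x0 mul0r.
exists (x / (x + y)); last by rewrite divfK.
have s2 : 0 < (x + y) ^+ 2 by rewrite exprn_even_gt0.
have -> : x / (x + y) = (x * (x + y)) / (x + y) ^+ 2.
  by rewrite expr2 invfM mulrA mulfK.
rewrite ler_pdivrMr// divr_ge0 ?(ltW s2)//=; nra.
Qed.

Lemma tr_total u i : in_range u ->
  kf i (u i 0%N) + kf (rev_ord i) (u (rev_ord i) 0%N) =
  tr i (total u) + tr (rev_ord i) (total u).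
Proof.
move=> ru; have := tr_sum (total_itv ru).
by rewrite (sum_I2 _ i) => ->; rewrite /total (sum_I2 _ i).
Qed.

(** Both interface values increase with the total, and they add up to it;
so each of them moves by a fraction of the variation of the total. *)
Lemma tr_step u u' i : in_range u -> in_range u' ->
  exists2 th, 0 <= th <= 1 &
  tr i (total u') - tr i (total u) = th * (total u' - total u).
Proof.
move=> ru ru'; have hu := total_itv ru; have hu' := total_itv ru'.
have -> : total u' - total u = (tr i (total u') - tr i (total u)) +
   (tr (rev_ord i) (total u') - tr (rev_ord i) (total u)).
  have := tr_sum hu; have := tr_sum hu'; rewrite !(sum_I2 _ i); lra.
apply: same_sign_split.
case/andP: hu => a0 a1; case/andP: hu' => b0 b1.
have [cc|/ltW cc] := leP (total u) (total u').
  by rewrite mulr_ge0// subr_ge0 tr_incr.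
by rewrite mulr_le0// subr_le0 tr_incr.
Qed.

Lemma flux0_opp u N i : in_range u -> flux N u (rev_ord i) 0 = - flux N u i 0.
Proof.
move=> ru; rewrite /flux/= -mulrN; congr (_ * _).
by have := tr_total i ru; lra.
Qed.

(** The fluxes obey a maximum principle: each new flux is a convex
combination of old ones. Away from the interface this is the discretization of
q_t = (a q_x)_x with a >= 0. At the interface it also uses that the two fluxes
are opposite (flux0_opp) and that both interface values move in the same
direction (tr_step): each side then contributes with a nonnegative weight. This
uniform bound is the only a priori estimate that the existence proof needs. *)
Lemma step_flux u N tau K : cfl N tau -> in_range u -> flux_le K N u ->
  flux_le K N (step N tau u).
Proof.
move=> ct ru fK i j; have ru' := step_range ct ru.
have K0 : 0 <= K := le_trans (normr_ge0 _) (fK i 0%N).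
rewrite {1}/flux; case: ifP => jN; last by rewrite normr0.
case: j jN => [_|j jN].
- have [A /andP[A0 A1] AE] := kf_step i 0 ct ru.
  have [B /andP[B0 B1] BE] := kf_step (rev_ord i) 0 ct ru.
  have [th /andP[th0 th1] thE] := tr_step i ru ru'.
  (* the flux 0 of the other side is - flux N u i 0, hence the weight - th * B *)
  have E : N%:R * (kf i (step N tau u i 0%N) - vprev (step N tau u) i 0) =
     (1 - (1 - th) * A - th * B) * flux N u i 0 + ((1 - th) * A) * flux N u i 1
     + (th * B) * - flux N u (rev_ord i) 1.
    have tE : total (step N tau u) - total u =
       (kf i (step N tau u i 0%N) - kf i (u i 0%N)) +
       (kf (rev_ord i) (step N tau u (rev_ord i) 0%N)
          - kf (rev_ord i) (u (rev_ord i) 0%N)).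
      by rewrite /total !(sum_I2 _ i); ring.
    rewrite tE in thE.
    have f0E : flux N u i 0 = N%:R * (kf i (u i 0%N) - tr i (total u)) by [].
    rewrite (flux0_opp N i ru) in BE.
    rewrite /= -[tr i (total (step N tau u))](subrK (tr i (total u))) thE.
    have -> : N%:R * (kf i (step N tau u i 0%N) -
      (th * (kf i (step N tau u i 0%N) - kf i (u i 0%N) +
       (kf (rev_ord i) (step N tau u (rev_ord i) 0%N) -
        kf (rev_ord i) (u (rev_ord i) 0%N))) + tr i (total u))) =
      (1 - th) * (N%:R * (kf i (step N tau u i 0%N) - kf i (u i 0%N)))
      - th * (N%:R * (kf (rev_ord i) (step N tau u (rev_ord i) 0%N) -
        kf (rev_ord i) (u (rev_ord i) 0%N))) + N%:R * (kf i (u i 0%N) - tr i (total u)) by ring.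
    by rewrite -f0E AE BE; ring.
  rewrite E; apply: convex3; rewrite ?normrN// ?mulr_ge0 ?subr_ge0//.
  nra.
- have [A /andP[A0 A1] AE] := kf_step i j.+1 ct ru.
  have [B /andP[B0 B1] BE] := kf_step i j ct ru.
  have -> : N%:R * (kf i (step N tau u i j.+1) - vprev (step N tau u) i j.+1) =
     (1 - A - B) * flux N u i j.+1 + A * flux N u i j.+2 + B * flux N u i j.
    have f0E : flux N u i j.+1 = N%:R * (kf i (u i j.+1) - kf i (u i j)).
      by rewrite /flux jN.
    have -> : N%:R * (kf i (step N tau u i j.+1) - vprev (step N tau u) i j.+1) =
      N%:R * (kf i (step N tau u i j.+1) - kf i (u i j.+1))
      - N%:R * (kf i (step N tau u i j) - kf i (u i j))
      + N%:R * (kf i (u i j.+1) - kf i (u i j)) by rewrite /=; ring.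
    by rewrite AE BE -f0E; ring.
  by apply: convex3 => //; lra.
Qed.

Lemma sol_range u N tau n : cfl N tau -> in_range u -> in_range (sol N tau u n).
Proof. by move=> ct ru; elim: n => //= n; exact: step_range. Qed.

Lemma sol_flux u N tau K n : cfl N tau -> in_range u -> flux_le K N u ->
  flux_le K N (sol N tau u n).
Proof.
move=> ct ru fu; elim: n => //= n; apply: step_flux => //.
exact: sol_range.
Qed.

Section Estimates.
Context (K : R) (N : nat) (tau : R) (u : 'I_2 -> nat -> R).
Hypothesis ct : cfl N tau.
Hypothesis N0 : (0 < N)%N.
Hypothesis ru : in_range u.
Hypothesis fu : flux_le K N u.

Let NR0 : 0 < N%:R :> R.
Proof. by rewrite ltr0n. Qed.

Let K0 : 0 <= K.
Proof. exact: le_trans (normr_ge0 _) (fu ord0 0). Qed.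

Let fsol n : flux_le K N (sol N tau u n).
Proof. exact: sol_flux. Qed.

Lemma sol_space n i j k : (j <= k)%N -> (k <= N)%N ->
  `|kf i (sol N tau u n i k) - kf i (sol N tau u n i j)| <= K * (k - j)%:R / N%:R.
Proof.
move=> jk; rewrite -(subnK jk) addnK; move: (k - j)%N => d.
elim: d => [|d IH] dN; first by rewrite add0n subrr normr0 mulr0 mul0r.
rewrite addSn in dN *.
have dN' : (d + j <= N)%N by exact: ltnW.
have := fsol n i (d + j).+1.
rewrite /flux dN /= normrM (ger0_norm (ltW NR0)) -ler_pdivlMl// => h.
rewrite -natr1 mulrDr mulrDl mulr1 [leRHS]addrC.
have -> : kf i (sol N tau u n i (d + j).+1) - kf i (sol N tau u n i j) =
  (kf i (sol N tau u n i (d + j).+1) - kf i (sol N tau u n i (d + j))) +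
  (kf i (sol N tau u n i (d + j)) - kf i (sol N tau u n i j)) by ring.
apply: le_trans (ler_normD _ _) _; apply: lerD; last exact: IH.
by rewrite mulrC.
Qed.

(** Telescoping over a block of cells leaves the two end fluxes: the mass
of a block varies at a bounded rate. *)
Lemma sol_block n d i a r :
  \sum_(a <= k < a + r) (sol N tau u (d + n) i k - sol N tau u n i k) =
  tau * N%:R / por i * \sum_(n <= m < d + n)
     (flux N (sol N tau u m) i (a + r) - flux N (sol N tau u m) i a).
Proof.
elim: d => [|d IH].
  by rewrite [in RHS]big_geq// mulr0 big1// => k _; rewrite subrr.
rewrite addSn big_nat_recr ?leq_addl//= mulrDr -IH.
rewrite -(telescope_sumr _ (leq_addr r a)) mulr_sumr -big_split/=.
apply: eq_bigr => k _; rewrite {1}/step; ring.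
Qed.

Lemma sol_block_le n d i a r :
  `|\sum_(a <= k < a + r) (sol N tau u (d + n) i k - sol N tau u n i k)| <=
  N%:R / pm * 2 * K * (tau * d%:R).
Proof.
have [t0 _] := ct.
rewrite sol_block normrM ger0_norm; last first.
  by rewrite divr_ge0 ?mulr_ge0// ltW.
have : `|\sum_(n <= m < d + n)
     (flux N (sol N tau u m) i (a + r) - flux N (sol N tau u m) i a)| <= 2 * K * d%:R.
  apply: le_trans (ler_norm_sum _ _ _) _.
  apply: (@le_trans _ _ (\sum_(n <= m < d + n) (2 * K))).
    apply: ler_sum => m _; apply: le_trans (ler_normB _ _) _.
    have := fsol m i (a + r); have := fsol m i a; lra.
  by rewrite sumr_const_nat addnK mulr_natr.
set S := `| _ | => hS.
have S0 : 0 <= S by rewrite /S.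
have : (por i)^-1 <= pm^-1 by rewrite lef_pV2 ?posrE//.
have : 0 <= pm^-1 by rewrite invr_ge0 ltW.
have : 0 <= (por i)^-1 by rewrite invr_ge0 ltW.
move=> p1 p2 p3.
apply: (@le_trans _ _ (tau * N%:R / pm * (2 * K * d%:R))).
  by apply: ler_pM => //; rewrite ?mulr_ge0// ler_wpM2l ?mulr_ge0.
by rewrite le_eqVlt; apply/orP; left; apply/eqP; ring.
Qed.

End Estimates.

Hypothesis kf_inv : forall e, 0 < e -> exists2 d, 0 < d & forall i s t,
  0 <= s <= 1 -> 0 <= t <= 1 -> `|kf i s - kf i t| <= d -> `|s - t| <= e.

(** If u changed by e at one cell, then, u being equicontinuous in space, it
would change by e / 2 on a whole block of rho N cells around it; but the mass of
this block varies at a bounded rate (sol_block_le), so that takes a time that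
does not depend on the grid. *)
Lemma sol_time_modulus (K e : R) : 0 <= K -> 0 < e -> exists2 d, 0 < d &
  exists N0 : nat, forall N tau u, (N0 <= N)%N -> (0 < N)%N -> cfl N tau ->
  in_range u -> flux_le K N u -> forall i j n m, (j <= N)%N ->
  tau * `|n%:R - m%:R| <= d -> `|sol N tau u n i j - sol N tau u m i j| <= e.
Proof.
move=> K0 e0; have e4 : 0 < e / 4 by rewrite divr_gt0.
have [eta eta0 etaP] := kf_inv e4.
have K1 : 0 < K + 1 by lra.
(* fraction of the grid over which u varies by at most e / 4 *)
pose rho := Num.min (1 / 2) (eta / (K + 1)).
have rho0 : 0 < rho by rewrite /rho lt_min divr_gt0// divr_gt0.
have rho1 : rho <= 1 / 2 by rewrite /rho ge_min lexx.
have rhoK : rho * K <= eta.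
  apply: (@le_trans _ _ (rho * (K + 1))); first by rewrite ler_wpM2l ?(ltW rho0)//; lra.
  by rewrite -ler_pdivlMr// /rho ge_min lexx orbT.
exists (rho * e * pm / (16 * (K + 1))).
  by rewrite divr_gt0 ?mulr_gt0.
exists (Num.truncn (2 / rho)).+1 => N tau u NN0 N0 ct ru fu i j n m jN.
wlog nm : n m / (m <= n)%N => [h|].
  have [mn|/ltnW nm] := leqP m n; first exact: h.
  by rewrite distrC => hd; rewrite distrC; apply: h.
rewrite -(subnK nm); set d := (n - m)%N.
rewrite natrD addrK ger0_norm// => hd.
have NR0 : 0 < N%:R :> R by rewrite ltr0n.
have rN : 2 <= rho * N%:R.
  rewrite mulrC -ler_pdivrMr//.
  apply: (@le_trans _ _ (Num.truncn (2 / rho)).+1%:R); last by rewrite ler_nat.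
  by apply: ltW; apply: truncnS_gt.
pose r := Num.truncn (rho * N%:R).
have /andP[r1 r2] : r%:R <= rho * N%:R < r.+1%:R.
  by apply: truncn_itv; rewrite mulr_ge0// ltW.
rewrite -natr1 in r2.
have rpos : (0 < r)%N by rewrite -(ltr0n R); lra.
have rN2 : (r <= N)%N by rewrite -(ler_nat R); nra.
have [a [aj jar arN]] := block_exists rpos rN2 jN.
have ru' k : in_range (sol N tau u k) by exact: sol_range.
have near_j k l : (a <= k < a + r)%N ->
  `|sol N tau u l i k - sol N tau u l i j| <= e / 4.
  move=> /andP[ak kar]; apply: (etaP i); [exact: ru'|exact: ru'|].
  have E p q : (a <= p)%N -> (p <= q)%N -> (q < a + r)%N ->
    `|kf i (sol N tau u l i q) - kf i (sol N tau u l i p)| <= eta.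
    move=> ap pq qar; have qN : (q <= N)%N by rewrite -ltnS; exact: leq_trans arN.
    apply: le_trans (sol_space ct N0 ru fu l i pq qN) _.
    apply: le_trans rhoK; rewrite ler_pdivrMr//.
    have qpr : (q - p)%:R <= r%:R :> R.
      rewrite ler_nat leq_subLR; apply: leq_trans (ltnW qar) _.
      by rewrite leq_add2r.
    rewrite [rho * K]mulrC -mulrA ler_wpM2l//.
    exact: le_trans qpr r1.
  have [jk|/ltnW kj] := leqP j k; first exact: E.
  by rewrite distrC; exact: E.
rewrite leNgt; apply/negP => big.
(* s is the sign of the variation *)
have key (s : R) : `|s| = 1 ->
  e < s * (sol N tau u (d + m) i j - sol N tau u m i j) -> False.
  move=> s1 hs.
  have Hk k : (a <= k < a + r)%N ->
     e / 2 <= s * (sol N tau u (d + m) i k - sol N tau u m i k).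
    move=> ak; have h1 := near_j _ (d + m)%N ak; have h2 := near_j _ m ak.
    have : `|s * (sol N tau u (d + m) i k - sol N tau u (d + m) i j)| <= e / 4.
      by rewrite normrM s1 mul1r.
    have : `|s * (sol N tau u m i k - sol N tau u m i j)| <= e / 4.
      by rewrite normrM s1 mul1r.
    rewrite !ler_norml => /andP[_ b2] /andP[b3 _].
    have := hs; rewrite !mulrBr in b2 b3 *; lra.
  have S1 : r%:R * (e / 2) <=
     s * \sum_(a <= k < a + r) (sol N tau u (d + m) i k - sol N tau u m i k).
    rewrite mulr_sumr.
    have -> : r%:R * (e / 2) = \sum_(a <= k < a + r) (e / 2).
      by rewrite sumr_const_nat addKn mulr_natl.
    by rewrite !big_nat; apply: ler_sum => k ak; exact: Hk.
  have S2 := sol_block_le ct ru fu m d i a r.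
  have S3 : s * \sum_(a <= k < a + r) (sol N tau u (d + m) i k - sol N tau u m i k)
     <= N%:R / pm * 2 * K * (tau * d%:R).
    by apply: le_trans S2; apply: le_trans (ler_norm _) _; rewrite normrM s1 mul1r.
  have S4 : N%:R / pm * 2 * K * (tau * d%:R) <= N%:R * rho * e / 8.
    have : N%:R / pm * 2 * K * (tau * d%:R) <=
       N%:R / pm * 2 * K * (rho * e * pm / (16 * (K + 1))).
      by rewrite ler_wpM2l// !mulr_ge0 ?invr_ge0 ?(ltW pm0)// ltW.
    move=> /le_trans; apply.
    have -> : N%:R / pm * 2 * K * (rho * e * pm / (16 * (K + 1))) =
       N%:R * rho * e / 8 * (K / (K + 1)).
      by field; rewrite !gt_eqF.
    have : K / (K + 1) <= 1 by rewrite ler_pdivrMr//; lra.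
    have : 0 <= N%:R * rho * e / 8 by rewrite !mulr_ge0// ltW.
    nra.
  have : 0 < rho * N%:R * e by rewrite !mulr_gt0.
  have : (rho * N%:R - 1) * (e / 2) < r%:R * (e / 2).
    by rewrite ltr_pM2r ?divr_gt0//; lra.
  have : 2 * e <= rho * N%:R * e by rewrite ler_wpM2r ?(ltW e0).
  lra.
move: big; rewrite real_ltr_normr ?num_real// => /orP[h|h].
  by apply: (key 1); rewrite ?normr1// mul1r.
by apply: (key (-1)); rewrite ?normrN1// mulN1r.
Qed.

End Scheme.

(** * The discrete weak formulation *)

Section SummationByParts.
Context (R : realType).

Lemma abel_sum (f g : nat -> R) N :
  \sum_(j < N.+1) (f j.+1 - f j) * g j =
  f N.+1 * g N - f 0%N * g 0%N - \sum_(j < N) f j.+1 * (g j.+1 - g j).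
Proof.
elim: N => [|N IH]; first by rewrite big_ord_recr !big_ord0/=; ring.
by rewrite big_ord_recr/= IH [in RHS]big_ord_recr/=; ring.
Qed.

(** Summation by parts moves the differences from w to d: closeness of w to
0 is enough, whatever its slope. *)
Lemma abel_sum_le (w d : nat -> R) N (W C1 C2 : R) : (0 < N)%N ->
  (forall j, (j <= N)%N -> `|w j| <= W) ->
  (forall j, (j <= N)%N -> `|d j| <= C1) ->
  (forall j, (j < N)%N -> `|d j.+1 - d j| <= C2 / N%:R) ->
  `|\sum_(j < N) (w j.+1 - w j) * d j| <= (2 * C1 + C2) * W.
Proof.
move=> N0 wW dC1 dC2.
have W0 : 0 <= W := le_trans (normr_ge0 _) (wW 0%N (leq0n _)).
have C10 : 0 <= C1 := le_trans (normr_ge0 _) (dC1 0%N (leq0n _)).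
have E : \sum_(j < N) (w j.+1 - w j) * d j =
    w N * d N - w 0%N * d 0%N - \sum_(j < N) w j.+1 * (d j.+1 - d j).
  clear; elim: N => [|N IH]; first by rewrite !big_ord0; ring.
  by rewrite big_ord_recr/= IH [in RHS]big_ord_recr/=; ring.
rewrite E; apply: le_trans (ler_normB _ _) _.
have h1 : `|w N * d N - w 0%N * d 0%N| <= 2 * C1 * W.
  apply: le_trans (ler_normB _ _) _; rewrite !normrM.
  have : `|w N| * `|d N| <= W * C1 by apply: ler_pM => //; [exact: wW|exact: dC1].
  have : `|w 0%N| * `|d 0%N| <= W * C1 by apply: ler_pM => //; [exact: wW|exact: dC1].
  lra.
have h2 : `|\sum_(j < N) w j.+1 * (d j.+1 - d j)| <= C2 * W.
  apply: le_trans (ler_norm_sum _ _ _) _.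
  apply: (@le_trans _ _ (\sum_(j < N) (W * (C2 / N%:R)))).
    by apply: ler_sum => j _; rewrite normrM; apply: ler_pM => //; [exact: wW|exact: dC2].
  have -> : \sum_(j < N) (W * (C2 / N%:R)) = W * (C2 / N%:R) * N%:R.
    by rewrite sumr_const card_ord mulr_natr.
  by rewrite mulrA divfK ?pnatr_eq0 -?lt0n// mulrC.
lra.
Qed.

End SummationByParts.

Section DiscreteWeak.
Context (R : realType) (por : 'I_2 -> R) (kf tr : 'I_2 -> R -> R).
Context (N : nat) (g : 'I_2 -> nat -> R).
Hypothesis N0 : (0 < N)%N.
Hypothesis por0 : forall i, 0 < por i.
Hypothesis g0 : forall i, g i 0%N = g ord0 0%N.

Let NR0 : N%:R != 0 :> R.
Proof. by rewrite pnatr_eq0 -lt0n. Qed.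

Definition mass (u : 'I_2 -> nat -> R) : R :=
  \sum_(i < 2) \sum_(j < N.+1) por i * u i j * g i j / N%:R.

Definition dualflux (u : 'I_2 -> nat -> R) : R :=
  \sum_(i < 2) \sum_(j < N)
    (kf i (u i j.+1) - kf i (u i j)) * (N%:R * (g i j.+1 - g i j)).

(** One step of the scheme tested against g. The boundary term at the
interface is g ord0 0 times the sum of the two fluxes, because g is continuous
across the interface. *)
Lemma mass_step tau u : \sum_(i < 2) flux kf tr N u i 0 = 0 ->
  mass (step por kf tr N tau u) - mass u = - tau * dualflux u.
Proof.
move=> f0; rewrite /mass -sumrB.
transitivity (\sum_(i < 2) (- tau * \sum_(j < N)
    (kf i (u i j.+1) - kf i (u i j)) * (N%:R * (g i j.+1 - g i j)) -
    tau * g ord0 0%N * flux kf tr N u i 0)); last first.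
  have E2 : \sum_(i < 2) (tau * g ord0 0%N * flux kf tr N u i 0) = 0.
    by rewrite -mulr_sumr f0 mulr0.
  by rewrite sumrB E2 subr0 -mulr_sumr.
apply: eq_bigr => i _; rewrite -sumrB.
transitivity (tau * \sum_(j < N.+1) (flux kf tr N u i j.+1 - flux kf tr N u i j) * g i j).
  rewrite mulr_sumr; apply: eq_bigr => j _; rewrite /step.
  by field; rewrite NR0 gt_eqF.
rewrite abel_sum.
have -> : flux kf tr N u i N.+1 = 0 by rewrite /flux ltnn.
rewrite g0; have -> : \sum_(j < N) flux kf tr N u i j.+1 * (g i j.+1 - g i j) =
   \sum_(j < N) (kf i (u i j.+1) - kf i (u i j)) * (N%:R * (g i j.+1 - g i j)).
  by apply: eq_bigr => j _; rewrite /flux ltn_ord/=; ring.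
ring.
Qed.

(** The steps are added up with an error proportional to the elapsed time;
this proportionality is what makes the limit an identity between derivatives
in time. *)
Lemma mass_increment tau u n d (q B : R) : 0 <= tau ->
  (forall m, \sum_(i < 2) flux kf tr N (sol por kf tr N tau u m) i 0 = 0) ->
  (forall m, (n <= m < d + n)%N -> `|dualflux (sol por kf tr N tau u m) - q| <= B) ->
  `|mass (sol por kf tr N tau u (d + n)) - mass (sol por kf tr N tau u n)
     + tau * d%:R * q| <= tau * d%:R * B.
Proof.
move=> t0 f0; elim: d => [|d IH] qB.
  by rewrite add0n subrr mulr0 !mul0r addr0 normr0.
have {}IH := IH (fun m Hm => qB m (introT andP (conj (proj1 (andP Hm))
  (leqW (proj2 (andP Hm)))))).
have := mass_step tau (f0 (d + n)%N).
have := qB (d + n)%N; rewrite leq_addl addSn ltnSn => /(_ isT) Hd.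
rewrite /= -/(sol por kf tr N tau u (d + n)) => E.
set S' := mass (step _ _ _ _ _ _) in E *.
have -> : S' - mass (sol por kf tr N tau u n) + tau * d.+1%:R * q =
  (mass (sol por kf tr N tau u (d + n)) - mass (sol por kf tr N tau u n)
    + tau * d%:R * q) - tau * (dualflux (sol por kf tr N tau u (d + n)) - q).
  rewrite -natr1; have -> : S' = mass (sol por kf tr N tau u (d + n)) +
     - tau * dualflux (sol por kf tr N tau u (d + n)) by rewrite -E addrC subrK.
  ring.
apply: le_trans (ler_normB _ _) _.
rewrite [X in _ + X]normrM (ger0_norm t0).
have := ler_wpM2l t0 Hd; rewrite -natr1 mulrDr mulr1 mulrDl => h.
exact: lerD IH h.
Qed.

(** The dual flux depends on the Kirchhoff values, not on their slopes, once
a difference is moved onto the test function; hence it is continuous in time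
uniformly in the grid. *)
Lemma dualflux_diff u u' (W C1 C2 : R) :
  (forall i j, (j <= N)%N -> `|kf i (u i j) - kf i (u' i j)| <= W) ->
  (forall i j, (j <= N)%N -> `|N%:R * (g i j.+1 - g i j)| <= C1) ->
  (forall i j, (j < N)%N ->
     `|N%:R * (g i j.+2 - g i j.+1) - N%:R * (g i j.+1 - g i j)| <= C2 / N%:R) ->
  `|dualflux u - dualflux u'| <= 2 * (2 * C1 + C2) * W.
Proof.
move=> hW hC1 hC2; rewrite /dualflux -sumrB.
apply: le_trans (ler_norm_sum _ _ _) _.
apply: (@le_trans _ _ (\sum_(i < 2) ((2 * C1 + C2) * W))); last first.
  by rewrite !big_ord_recl big_ord0; lra.
apply: ler_sum => i _; rewrite -sumrB.
rewrite (eq_bigr (fun j : 'I_N =>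
  ((kf i (u i j.+1) - kf i (u' i j.+1)) - (kf i (u i j) - kf i (u' i j))) *
  (N%:R * (g i j.+1 - g i j)))); last by move=> j _; ring.
apply: (@abel_sum_le _ (fun j => kf i (u i j) - kf i (u' i j))
  (fun j => N%:R * (g i j.+1 - g i j))) => // j jN; [exact: hW|exact: hC1|exact: hC2].
Qed.

Lemma dualflux_le u (K C1 : R) :
  (forall i j, (j < N)%N -> `|kf i (u i j.+1) - kf i (u i j)| <= K / N%:R) ->
  (forall i j, (j < N)%N -> `|N%:R * (g i j.+1 - g i j)| <= C1) ->
  `|dualflux u| <= 2 * K * C1.
Proof.
move=> hK hC1; apply: le_trans (ler_norm_sum _ _ _) _.
apply: (@le_trans _ _ (\sum_(i < 2) (K * C1))); last first.
  by rewrite !big_ord_recl big_ord0; lra.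
apply: ler_sum => i _; apply: le_trans (ler_norm_sum _ _ _) _.
apply: (@le_trans _ _ (\sum_(j < N) (K / N%:R * C1))).
  by apply: ler_sum => j _; rewrite normrM; apply: ler_pM => //; [exact: hK|exact: hC1].
have -> : \sum_(j < N) (K / N%:R * C1) = K / N%:R * C1 * N%:R.
  by rewrite sumr_const card_ord mulr_natr.
by rewrite (_ : _ * N%:R = K * C1)//; field.
Qed.

End DiscreteWeak.

(** * Kirchhoff transform and transmission condition *)

Section Interval01.
Context (R : realType) (k : R -> R).
Notation mu := (@lebesgue_measure R).
Hypothesis kc : {within `[0, 1], continuous k}.

Lemma primitive_bounds (s t c C : R) : 0 <= s -> s <= t -> t <= 1 ->
  (forall x, s <= x <= t -> c <= k x <= C) ->
  c * (t - s) <= \int[mu]_(x in `[0, t]) k x - \int[mu]_(x in `[0, s]) k x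
    <= C * (t - s).
Proof.
move=> s0 st t1 cC.
have int01 : mu.-integrable `[0, 1] (EFin \o k).
  exact: (continuous_compact_integrable (@segment_compact R 0 1) kc).
have intk (A : interval R) : [set` A] `<=` `[0, 1] -> mu.-integrable [set` A] (EFin \o k).
  by move=> A1; apply: integrableS int01.
have k0t : mu.-integrable `[0, t] (EFin \o k).
  by apply: intk => x /=; rewrite !in_itv/= => /andP[-> /le_trans]; apply.
have kst : mu.-integrable `]s, t] (EFin \o k).
  apply: intk => x /=; rewrite !in_itv/= => /andP[sx /le_trans ->//].
  by rewrite (le_trans s0 (ltW sx)).
have -> := Rintegral_itvB k0t (s0 : (BLeft 0 <= BRight s)%O) (st : (BRight s <= BRight t)%O).
have mst : mu `]s, t]%classic = (t - s)%:E.
  rewrite lebesgue_measure_itv/= lte_fin; case: ltP => // ts.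
  by congr (_%:E); lra.
have cint (c' : R) : mu.-integrable `]s, t] (EFin \o (fun=> c')).
  apply: measurable_bounded_integrable => //; last exact: bounded_cst.
  by apply: le_lt_trans (ltry (t - s)); rewrite -mst.
have cE (c' : R) : c' * (t - s) = \int[mu]_(x in `]s, t]) c'.
  by rewrite Rintegral_cst//; congr (_ * _); exact: (esym (congr1 fine mst)).
rewrite !cE; apply/andP; split; apply: le_Rintegral => // x /=;
  by rewrite in_itv/= => /andP[sx xt]; have /andP[] := cC x (introT andP (conj (ltW sx) xt)).
Qed.

End Interval01.

Section RockFacts.
Context (R : realType) (rk : rock R).
Notation mu := (@lebesgue_measure R).
Let p := cap_pressure rk.
Let kf := kirchhoff rk.

Lemma itv01 (s : R) : (s \in `[0, 1]) = (0 <= s <= 1).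
Proof. by rewrite in_itv. Qed.

Lemma eta_sum_gt0 (s : R) : 0 <= s <= 1 -> 0 < eta_o rk s + eta_w rk s.
Proof.
move=> /andP[s0 s1]; have [->|sn] := eqVneq s 1.
  have := @eta_o_incr _ rk 0 1; rewrite !itv01 !lexx ler01 ltr01.
  by rewrite eta_o0 => /(_ isT isT isT); rewrite eta_w1 addr0.
have sl : s < 1 by rewrite lt_neqAle sn.
have := @eta_w_decr _ rk s 1; rewrite !itv01 s0 s1 !lexx ler01.
rewrite eta_w1 => /(_ isT isT sl) w0.
by apply: ltr_wpDl => //; apply: eta_o_ge0; rewrite itv01 s0.
Qed.

Lemma lambda_continuous : {within `[0, 1], continuous (lambda rk)}.
Proof.
apply/subspace_continuousP => x x01; rewrite /lambda.
have xo := (subspace_continuousP _ _).1 (@eta_o_continuous _ rk) _ x01.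
have xw := (subspace_continuousP _ _).1 (@eta_w_continuous _ rk) _ x01.
apply: cvgM; first exact: cvgM.
apply: cvgV; last exact: cvgD.
by rewrite gt_eqF// eta_sum_gt0//; move: x01; rewrite /= in_itv.
Qed.

Lemma lambda_gt0 (s : R) : 0 < s < 1 -> 0 < lambda rk s.
Proof.
move=> /andP[s0 s1]; have s01 : 0 <= s <= 1 by rewrite !ltW.
rewrite /lambda divr_gt0 ?eta_sum_gt0//.
have := @eta_w_decr _ rk s 1; rewrite !itv01 !lexx ler01 s01 eta_w1.
have := @eta_o_incr _ rk 0 s; rewrite !itv01 !lexx ler01 s01 eta_o0.
by move=> /(_ isT isT s0) ? /(_ isT isT s1) ?; exact: mulr_gt0.
Qed.

Lemma lambda0 : lambda rk 0 = 0.
Proof. by rewrite /lambda eta_o0 !mul0r. Qed.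

Lemma lambda1 : lambda rk 1 = 0.
Proof. by rewrite /lambda eta_w1 mulr0 mul0r. Qed.

(** The derivative of the capillary pressure means nothing at 0 and 1; the
continuous extension supplied by C1_itv has the same integrals. *)
Lemma kirchhoff_density : exists k : R -> R, [/\ {within `[0, 1], continuous k},
  forall s, 0 <= s <= 1 -> 0 <= k s, forall s, 0 < s < 1 -> 0 < k s &
  forall s, 0 <= s <= 1 -> kf s = \int[mu]_(x in `[0, s]) k x].
Proof.
have [pc pd [dp [dpc dpE]]] := cap_pressure_C1 rk.
have kc : {within `[0, 1], continuous (fun s => lambda rk s * dp s)}.
  apply/subspace_continuousP => x x01.
  have xl := (subspace_continuousP _ _).1 lambda_continuous _ x01.
  have xd := (subspace_continuousP _ _).1 dpc _ x01.
  exact: cvgM.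
have kpos s : 0 < s < 1 -> 0 < lambda rk s * dp s.
  move=> s01; rewrite mulr_gt0 ?lambda_gt0// -dpE ?in_itv//.
  by apply: cap_pressure_deriv_gt0; rewrite in_itv.
exists (fun s => lambda rk s * dp s); split => //.
- move=> s /andP[s0 s1].
  have [->|n0] := eqVneq s 0; first by rewrite lambda0 mul0r.
  have [->|n1] := eqVneq s 1; first by rewrite lambda1 mul0r.
  by apply/ltW/kpos; rewrite !lt_neqAle eq_sym n0 s0 n1.
- move=> s /andP[s0 s1]; rewrite /kf /kirchhoff (min_idPl s1).
  have mk : measurable_fun `]0, s[ (fun x => lambda rk x * dp x).
    apply: (@measurable_funS _ _ _ _ (`[0, 1]%classic : set R)); [exact: measurable_itv| |].
      move=> x /=; rewrite !in_itv/= => /andP[x0 xs].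
      by rewrite (ltW x0) (le_trans (ltW xs)).
    by apply: subspace_continuous_measurable_fun; [exact: measurable_itv|].
  have E x : x \in `]0, s[%classic ->
      lambda rk x * derive1 (cap_pressure rk) x = lambda rk x * dp x.
    rewrite inE/= in_itv/= => /andP[x0 xs]; rewrite dpE// in_itv/= x0.
    exact: lt_le_trans s1.
  rewrite /Rintegral; congr fine.
  rewrite integral_itv_bndoo; last first.
    apply/measurable_EFinP; apply: eq_measurable_fun mk => x xs.
    by rewrite E.
  rewrite [RHS]integral_itv_bndoo; last exact/measurable_EFinP.
  by apply: eq_integral => x xs; rewrite E.
Qed.

Lemma kirchhoff_incr_lip : exists2 L, 0 <= L & forall s t, 0 <= s -> s <= t -> t <= 1 ->
  0 <= kf t - kf s <= L * (t - s).
Proof.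
have [k [kc k0 _ kE]] := kirchhoff_density.
have [c c01 cM] := EVT_max ler01 kc.
rewrite in_itv/= in c01.
exists (k c); first exact: k0.
move=> s t s0 st t1.
have := @primitive_bounds _ _ kc s t 0 (k c) s0 st t1.
rewrite mul0r -!kE ?s0 ?t1 ?(le_trans s0 st) ?(le_trans st t1)//; apply.
move=> x /andP[sx xt]; have x01 : 0 <= x <= 1 by rewrite (le_trans s0) ?(le_trans xt).
by rewrite k0// cM// in_itv.
Qed.

Lemma kirchhoff_lt s t : 0 <= s -> s < t -> t <= 1 -> kf s < kf t.
Proof.
move=> s0 st t1; have [k [kc k0 kp kE]] := kirchhoff_density.
have [L L0 kL] := kirchhoff_incr_lip.
(* the density may vanish at 0 and 1, but not on the middle third of [s, t] *)
pose a := s + (t - s) / 3; pose b := s + 2 * (t - s) / 3.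
have [sa ab bt] : [/\ s < a, a < b & b < t] by rewrite /a /b; split; lra.
have a0 : 0 < a by exact: le_lt_trans sa.
have b1 : b < 1 by exact: lt_le_trans t1.
have kab : {within `[a, b], continuous k}.
  apply: continuous_subspaceW kc => x /=; rewrite !in_itv/= => /andP[ax xb].
  by rewrite (le_trans (ltW a0) ax) (le_trans xb (ltW b1)).
have [c cab cm] := EVT_min (ltW ab) kab; rewrite in_itv/= in cab.
have kc0 : 0 < k c by apply: kp; case/andP: cab => ac cb; rewrite (lt_le_trans a0) ?(le_lt_trans cb).
have [d dab dM] := EVT_max (ltW ab) kab.
have := @primitive_bounds _ _ kc a b (k c) (k d) (ltW a0) (ltW ab) (ltW b1) _.
rewrite -!kE; last 2 first.
- by rewrite (ltW a0) (ltW (lt_trans ab b1)).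
- by rewrite (ltW (lt_trans a0 ab)) (ltW b1).
move=> /(_ _)/andP[|h _].
  by move=> x xab; rewrite cm ?dM ?in_itv.
have : 0 < k c * (b - a) by rewrite mulr_gt0// subr_gt0.
have /andP[h1 _] := kL s a s0 (ltW sa) (ltW (lt_trans ab b1)).
have /andP[h2 _] := kL b t (ltW (lt_trans a0 ab)) (ltW bt) t1.
lra.
Qed.

Lemma kirchhoff0 : kf 0 = 0.
Proof.
have [k [kc _ _ kE]] := kirchhoff_density.
by rewrite kE ?lexx ?ler01// set_itv1 Rintegral_set1.
Qed.

Lemma kirchhoff_itv s : 0 <= s <= 1 -> 0 <= kf s <= kf 1.
Proof.
move=> /andP[h0 h1]; have [L _ HL] := kirchhoff_incr_lip.
have := HL 0 _ (lexx 0) h0 h1; rewrite kirchhoff0 subr0 => /andP[-> _].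
by have := HL _ 1 h0 h1 (lexx 1); rewrite subr_ge0 => /andP[].
Qed.

Lemma kirchhoff_clamp s : kf s = kf (clamp 0 1 s).
Proof.
have [s0|s0] := leP 0 s; last first.
  have -> : clamp 0 1 s = 0 by rewrite /clamp (min_idPr _) ?(max_idPl _)// ltW// (lt_trans s0).
  rewrite kirchhoff0 /kf /kirchhoff (min_idPl _) ?(ltW (lt_trans s0 ltr01))//.
  by rewrite set_itv_ge ?Rintegral_set0// bnd_simp -ltNge.
have [s1|s1] := leP s 1; first by rewrite clamp_id// s0.
have -> : clamp 0 1 s = 1 by rewrite /clamp (min_idPl (ltW s1)) (max_idPr ler01).
by rewrite /kf /kirchhoff minxx (min_idPr (ltW s1)).
Qed.

Lemma kirchhoff_lip : exists2 L, 0 <= L & forall s t, `|kf s - kf t| <= L * `|s - t|.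
Proof.
have [L L0 kL] := kirchhoff_incr_lip; exists L => // s t.
rewrite (kirchhoff_clamp s) (kirchhoff_clamp t).
apply: (@le_trans _ _ (L * `|clamp 0 1 s - clamp 0 1 t|)); last first.
  by rewrite ler_wpM2l// clamp_lip// ler01.
have /andP[] := clamp_itv s (@ler01 R); have /andP[] := clamp_itv t (@ler01 R).
move: (clamp 0 1 s) (clamp 0 1 t) => {}s {}t t0 t1 s0 s1.
wlog st : s t t0 t1 s0 s1 / s <= t => [h|].
  by have [|/ltW] := leP s t => /h; [exact|rewrite distrC (distrC s); exact].
have /andP[h1 h2] := kL s t s0 st t1.
by rewrite distrC (distrC s) !ger0_norm ?subr_ge0// -subr_ge0.
Qed.

Lemma kirchhoff_continuous : continuous kf.
Proof.
have [L L0 kL] := kirchhoff_lip => x.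
apply/cvgrPdist_lt => e e0; near=> y; apply: le_lt_trans (kL _ _) _.
apply: (@le_lt_trans _ _ ((L + 1) * `|x - y|)); first by rewrite ler_wpM2r//; lra.
rewrite -ltr_pdivlMl; last lra.
near: y; apply: (@cvgr_dist_lt _ _ _ _ _ id x) => //.
by rewrite mulr_gt0// invr_gt0; lra.
Unshelve. all: by end_near. Qed.

(** Uniform continuity of the inverse of kf: the increment over an interval
of length e is positive, and continuous in the position of the interval, so it
has a positive minimum. *)
Lemma kirchhoff_inv e : 0 < e -> exists2 d, 0 < d & forall s t,
  0 <= s <= 1 -> 0 <= t <= 1 -> `|kf s - kf t| <= d -> `|s - t| <= e.
Proof.
move=> e0; have [e1|e1] := leP 1 e.
  exists 1 => // s t /andP[s0 s1] /andP[t0 t1] _; apply: le_trans e1.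
  by rewrite ler_norml; apply/andP; split; lra.
have hc : continuous (fun s => kf (s + e) - kf s).
  move=> x; apply: cvgB; last exact: kirchhoff_continuous.
  apply: (@cvg_comp _ _ _ (fun s => s + e) kf); last exact: kirchhoff_continuous.
  by apply: cvgD; [exact: cvg_id|exact: cvg_cst].
have [c c01 cm] := @EVT_min R _ 0 (1 - e) (ltac:(lra)) (continuous_subspaceT hc).
rewrite in_itv/= in c01; case/andP: c01 => c0 ce.
have d0 : 0 < kf (c + e) - kf c by rewrite subr_gt0; apply: kirchhoff_lt => //; lra.
exists ((kf (c + e) - kf c) / 2); first by rewrite divr_gt0.
move=> s t s01 t01 kst; rewrite leNgt; apply/negP => est.
wlog st : s t s01 t01 kst est / s <= t => [h|].
  have [st|/ltW ts] := leP s t; first exact: (h s t).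
  by apply: (h t s) => //; rewrite distrC.
have se : s + e < t by move: est; rewrite distrC ger0_norm ?subr_ge0//; lra.
case/andP: s01 => s0 s1; case/andP: t01 => t0 t1.
have h1 := @kirchhoff_lt (s + e) t (ltac:(lra)) se t1.
have h2 : kf (c + e) - kf c <= kf (s + e) - kf s.
  by apply: cm; rewrite in_itv/= s0/=; lra.
rewrite distrC ger0_norm in kst; last by rewrite subr_ge0 (le_trans _ (ltW h1))// -subr_ge0 (le_trans (ltW d0)).
clear -h1 h2 d0 kst; move: (kf t) (kf s) (kf (s + e)) (kf c) (kf (c + e)) h1 h2 d0 kst => *; lra.
Qed.

Lemma kirchhoff_inj s t : 0 <= s <= 1 -> 0 <= t <= 1 -> kf s = kf t -> s = t.
Proof.
move=> /andP[s0 s1] /andP[t0 t1] E; apply/eqP; rewrite eq_le !leNgt.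
apply/andP; split; apply/negP => st.
  by have := kirchhoff_lt t0 st s1; rewrite E ltxx.
by have := kirchhoff_lt s0 st t1; rewrite E ltxx.
Qed.

Lemma pressure_lt s t : 0 <= s -> s < t -> t <= 1 -> p s < p t.
Proof.
move=> s0 st t1; have [pc pd _] := cap_pressure_C1 rk.
have [||c cst] := @MVT R p (derive1 p) s t st.
- move=> x; rewrite in_itv/= => /andP[sx xt]; rewrite derive1E; apply: derivableP.
  by apply: pd; rewrite in_itv/= (le_lt_trans s0 sx) (lt_le_trans xt t1).
- apply: continuous_subspaceW pc => x /=; rewrite !in_itv/= => /andP[sx xt].
  by rewrite (le_trans s0 sx) (le_trans xt t1).
move=> E; rewrite -subr_gt0 E mulr_gt0 ?subr_gt0//.
move: cst; rewrite in_itv/= => /andP[sc ct]; apply: cap_pressure_deriv_gt0.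
by rewrite in_itv/= (le_lt_trans s0 sc) (lt_le_trans ct t1).
Qed.

(** The three cases of the graph in one formula. *)
Lemma pi_tildeP s q : 0 <= s <= 1 ->
  pi_tilde rk s q <-> (0 < s -> p s <= q) /\ (s < 1 -> q <= p s).
Proof.
move=> /andP[s0 s1]; rewrite /pi_tilde.
have [->|n0] := eqVneq s 0.
  rewrite /= in_itv/= ltxx; split; first by move=> h; split => // _.
  by case=> _; apply; exact: ltr01.
have [->|n1] := eqVneq s 1.
  rewrite /= in_itv/= andbT ltxx; split; first by move=> h; split.
  by case=> + _; apply; exact: ltr01.
have s0' : 0 < s by rewrite lt_neqAle eq_sym n0.
have s1' : s < 1 by rewrite lt_neqAle n1.
rewrite s0' s1' /=; split; first by move=> ->; rewrite lexx.
by case=> /(_ isT) h1 /(_ isT) h2; apply/eqP; rewrite eq_le h1 h2.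
Qed.

Lemma sat_ex q : exists s, 0 <= s <= 1 /\ pi_tilde rk s q.
Proof.
have [pc pd _] := cap_pressure_C1 rk.
have [q0|q0] := leP q (p 0).
  exists 0; rewrite lexx ler01; split=> //; apply/pi_tildeP; first by rewrite lexx ler01.
  by rewrite ltxx.
have [q1|q1] := leP (p 1) q.
  exists 1; rewrite lexx ler01; split=> //; apply/pi_tildeP; first by rewrite lexx ler01.
  by rewrite ltxx.
have [|c] := @IVT R p 0 1 q ler01 pc.
  by rewrite ge_min le_max (ltW q0) (ltW q1) orbT.
rewrite in_itv/= => c01 cq; exists c; split=> //; apply/pi_tildeP => //.
by rewrite cq lexx.
Qed.

(** The inverse of the monotone graph pi_tilde is a function on the whole
line: it is constant beyond the end pressures. *)
Definition sat q : R := sval (cid (sat_ex q)).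

Lemma sat_itv q : 0 <= sat q <= 1.
Proof. by have [] := svalP (cid (sat_ex q)). Qed.

Lemma sat_pi q : pi_tilde rk (sat q) q.
Proof. by have [] := svalP (cid (sat_ex q)). Qed.

Lemma pi_tilde_mono s t q r : 0 <= s <= 1 -> 0 <= t <= 1 ->
  pi_tilde rk s q -> pi_tilde rk t r -> q < r -> s <= t.
Proof.
move=> s01 t01 /(pi_tildeP _ s01)[s1 s2] /(pi_tildeP _ t01)[t1 t2] qr.
rewrite leNgt; apply/negP => ts; case/andP: s01 => s0 sl; case/andP: t01 => t0 tl.
have h1 := s1 (le_lt_trans t0 ts); have h2 := t2 (lt_le_trans ts sl).
have h3 := pressure_lt t0 ts sl; lra.
Qed.

Lemma sat_uniq s q : 0 <= s <= 1 -> pi_tilde rk s q -> s = sat q.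
Proof.
move=> s01 /(pi_tildeP _ s01)[s1 s2].
have t01 := sat_itv q; have /(pi_tildeP _ t01)[t1 t2] := sat_pi q.
move: (sat q) t01 t1 t2 => t t01 t1 t2.
case/andP: s01 => s0 sl; case/andP: t01 => t0 tl.
apply/eqP; rewrite eq_le !leNgt; apply/andP; split; apply/negP => st.
  have h1 := s1 (le_lt_trans t0 st); have h2 := t2 (lt_le_trans st sl).
  have h3 := pressure_lt t0 st sl; lra.
have h1 := t1 (le_lt_trans s0 st); have h2 := s2 (lt_le_trans st tl).
have h3 := pressure_lt s0 st tl; lra.
Qed.

Lemma sat_mono q r : q <= r -> sat q <= sat r.
Proof.
rewrite le_eqVlt => /orP[/eqP->//|qr].
exact: pi_tilde_mono (sat_itv q) (sat_itv r) (sat_pi q) (sat_pi r) qr.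
Qed.

Lemma sat_pressure s : 0 <= s <= 1 -> sat (p s) = s.
Proof.
move=> s01; by apply/esym/sat_uniq => //; apply/pi_tildeP => //; rewrite lexx.
Qed.

(** A monotone function whose range is an interval has no jump; the points
p (sat q + e) and p (sat q - e) are barriers around q. *)
Lemma sat_continuous : continuous sat.
Proof.
move=> q; apply/cvgrPdist_le => e e0.
have t01 := sat_itv q; have /(pi_tildeP _ t01)[t1 t2] := sat_pi q.
case/andP: (t01) => t0 tl.
have up : \forall r \near q, sat r <= sat q + e.
  have [t1e|t1e] := leP 1 (sat q + e).
    by near=> r; apply: le_trans t1e; case/andP: (sat_itv r).
  have qs : q < p (sat q + e).
    apply: le_lt_trans (pressure_lt t0 _ (ltW t1e)); last by rewrite ltrDl.
    by apply: t2; lra.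
  near=> r.
  have rs : r < p (sat q + e) by near: r; exact: lt_nbhsl.
  rewrite -[leRHS]sat_pressure ?sat_mono ?(ltW rs)//.
  by rewrite (ltW t1e) andbT addr_ge0// ltW.
have down : \forall r \near q, sat q - e <= sat r.
  have [t1e|t1e] := leP (sat q - e) 0.
    by near=> r; apply: le_trans t1e _; case/andP: (sat_itv r).
  have qs : p (sat q - e) < q.
    apply: lt_le_trans (pressure_lt (ltW t1e) _ tl) _; first by rewrite gtrBl.
    by apply: t1; lra.
  near=> r.
  have rs : p (sat q - e) < r by near: r; exact: lt_nbhsr.
  rewrite -[leLHS]sat_pressure ?sat_mono ?(ltW rs)//.
  by rewrite (ltW t1e)/=; lra.
near=> r; rewrite ler_norml.
have h1 : sat r <= sat q + e by near: r.
have h2 : sat q - e <= sat r by near: r.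
by apply/andP; split; lra.
Unshelve. all: by end_near. Qed.

Lemma sat_low q : q <= p 0 -> sat q = 0.
Proof.
move=> q0; apply/esym/sat_uniq; first by rewrite lexx ler01.
by apply/pi_tildeP; rewrite ?lexx ?ler01// ltxx.
Qed.

Lemma sat_high q : p 1 <= q -> sat q = 1.
Proof.
move=> q0; apply/esym/sat_uniq; first by rewrite lexx ler01.
by apply/pi_tildeP; rewrite ?lexx ?ler01// ltxx.
Qed.

End RockFacts.

Section Interface.
Context (R : realType) (rk : 'I_2 -> rock R).

(** The Kirchhoff value of the medium i under the pressure q. The graphs of
the two media meet exactly when both saturations come from one pressure, so the
transmission condition is the existence of q such that v_i = Phi i q. *)
Definition Phi (i : 'I_2) (q : R) : R := kirchhoff (rk i) (sat (rk i) q).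

Lemma Phi_mono i q r : q <= r -> Phi i q <= Phi i r.
Proof.
move=> qr; have [L L0 kL] := kirchhoff_incr_lip (rk i).
have /andP[s0 _] := sat_itv (rk i) q; have /andP[_ s1] := sat_itv (rk i) r.
by have /andP[] := kL _ _ s0 (sat_mono (rk i) qr) s1; rewrite subr_ge0.
Qed.

Lemma Phi_continuous i : continuous (Phi i).
Proof.
move=> q; apply: (@cvg_comp _ _ _ (sat (rk i)) (kirchhoff (rk i))).
  exact: sat_continuous.
exact: kirchhoff_continuous.
Qed.

(** The pressure is not determined by the sum (both Phi may be constant on a
common interval), but the values are, since both are nondecreasing. *)
Lemma Phi_sum_inj q r : \sum_(i < 2) Phi i q = \sum_(i < 2) Phi i r ->
  forall i, Phi i q = Phi i r.
Proof.
wlog qr : q r / q <= r => [h|].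
  by have [/h//|/ltW/h] := leP q r => h' /esym/h' h'' i; rewrite h''.
move=> + i; rewrite !(sum_I2 _ i).
move: (Phi_mono i qr) (Phi_mono (rev_ord i) qr).
by move: (Phi i q) (Phi _ q) (Phi i r) (Phi _ r) => *; lra.
Qed.

Definition pmin := \big[Num.min/0]_(i < 2) cap_pressure (rk i) 0.
Definition pmax := \big[Num.max/0]_(i < 2) cap_pressure (rk i) 1.

(** The sum of the Phi is continuous and runs from 0 to its maximal value
between a lower and an upper bound of the pressures of both media. *)
Lemma interface_ex (c : R) : 0 <= c <= \sum_(i < 2) kirchhoff (rk i) 1 ->
  exists q, pmin <= q <= pmax /\ \sum_(i < 2) Phi i q = c.
Proof.
move=> /andP[c0 c1].
have lo i : Phi i pmin = 0.
  rewrite /Phi sat_low ?kirchhoff0//; rewrite /pmin (bigD1 i)//= ge_min lexx.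
  by [].
have hi i : Phi i pmax = kirchhoff (rk i) 1.
  by rewrite /Phi sat_high//; rewrite /pmax (bigD1 i)//= le_max lexx.
have le : pmin <= pmax.
  rewrite /pmin /pmax !big_ord_recl !big_ord0 !(ge_min, le_max).
  by rewrite (ltW (pressure_lt (rk ord0) (lexx 0) ltr01 (lexx 1))).
have sc : continuous (fun q => \sum_(i < 2) Phi i q).
  move=> q; rewrite (_ : (fun q => _) = fun q => Phi ord0 q + Phi (rev_ord ord0) q).
    by apply: cvgD; exact: Phi_continuous.
  by apply/funext => r; rewrite (sum_I2 _ ord0).
have [|q] := @IVT R _ pmin pmax c le (continuous_subspaceT sc).
  rewrite ge_min le_max; apply/andP; split.
    by apply/orP; left; rewrite big1.
  by apply/orP; right; rewrite (eq_bigr (fun i => kirchhoff (rk i) 1)).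
by rewrite in_itv/= => q01 qc; exists q.
Qed.

Definition interface_pressure (c : R) : R :=
  if pselect (0 <= c <= \sum_(i < 2) kirchhoff (rk i) 1) is left c01
  then sval (cid (interface_ex c01)) else 0.

Lemma interface_pressureP (c : R) : 0 <= c <= \sum_(i < 2) kirchhoff (rk i) 1 ->
  pmin <= interface_pressure c <= pmax /\
  \sum_(i < 2) Phi i (interface_pressure c) = c.
Proof.
by rewrite /interface_pressure => c01; case: pselect => // ?; case: cid.
Qed.

(** The interface values attached to a total: the instance of the argument
tr of the scheme that expresses the transmission condition. *)
Definition ktrace (i : 'I_2) (c : R) := Phi i (interface_pressure c).

Lemma ktrace_sum c : 0 <= c <= \sum_(i < 2) kirchhoff (rk i) 1 ->
  \sum_(i < 2) ktrace i c = c.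
Proof. by move=> /interface_pressureP[]. Qed.

Lemma ktrace_incr i c c' : 0 <= c -> c <= c' -> c' <= \sum_(i < 2) kirchhoff (rk i) 1 ->
  ktrace i c <= ktrace i c'.
Proof.
move=> c0; rewrite le_eqVlt => /orP[/eqP->//|cc'] c1.
apply: Phi_mono; rewrite leNgt; apply/negP => qq.
have := @ktrace_sum c; have := @ktrace_sum c'.
rewrite c0 c1 (ltW (le_lt_trans c0 cc')) (le_trans (ltW cc') c1).
move=> /(_ isT) E1 /(_ isT) E2.
have : \sum_(i < 2) ktrace i c' <= \sum_(i < 2) ktrace i c.
  by apply: ler_sum => j _; apply/Phi_mono/ltW.
by rewrite E1 E2 leNgt cc'.
Qed.

Lemma Phi_itv i q : 0 <= Phi i q <= kirchhoff (rk i) 1.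
Proof. exact/kirchhoff_itv/sat_itv. Qed.

End Interface.

(** * Limits of grid functions and of Stieltjes sums *)

Section GridLimit.
Context (R : realType).

Definition idx (n : nat) (x : R) : nat := Num.truncn (x * n.+1%:R).

Lemma idx_itv n (x : R) : 0 <= x -> (idx n x)%:R / n.+1%:R <= x < (idx n x)%:R / n.+1%:R + n.+1%:R^-1.
Proof.
move=> x0; have N0 : 0 < n.+1%:R :> R by rewrite ltr0n.
have /andP[h1 h2] := truncn_itv (mulr_ge0 x0 (ltW N0)).
rewrite ler_pdivrMr// h1/=.
by rewrite -[X in _ + X]mul1r -mulrDl ltr_pdivlMr// natr1.
Qed.

Lemma idx_le n (x : R) : 0 <= x -> x <= 1 -> (idx n x <= n.+1)%N.
Proof.
move=> x0 x1; rewrite -(ler_nat R).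
have N0 : 0 < n.+1%:R :> R by rewrite ltr0n.
have /andP[h1 _] := truncn_itv (mulr_ge0 x0 (ltW N0)).
by apply: le_trans h1 _; rewrite -[leRHS]mul1r ler_wpM2r// ltW.
Qed.

Lemma idx_mono n (x y : R) : 0 <= x -> x <= y -> (idx n x <= idx n y)%N.
Proof.
move=> x0 xy; have N0 : 0 < n.+1%:R :> R by rewrite ltr0n.
rewrite -ltnS -(ltr_nat R).
have /andP[h1 _] := truncn_itv (mulr_ge0 x0 (ltW N0)).
have /andP[_ h2] := truncn_itv (mulr_ge0 (le_trans x0 xy) (ltW N0)).
apply: le_lt_trans h1 _; apply: le_lt_trans h2.
by rewrite ler_wpM2r// ltW.
Qed.

Lemma idx0 n : idx n 0 = 0%N.
Proof. by rewrite /idx mul0r truncn0. Qed.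

Lemma idx1 n : idx n 1 = n.+1.
Proof. by rewrite /idx mul1r natrK. Qed.

Lemma idx_dist n (x y : R) : 0 <= x -> x <= y ->
  (idx n y - idx n x)%:R / n.+1%:R <= y - x + n.+1%:R^-1.
Proof.
move=> x0 xy; rewrite natrB ?idx_mono// mulrBl.
have /andP[a1 a2] := idx_itv n x0; have /andP[b1 b2] := idx_itv n (le_trans x0 xy).
move: a1 a2 b1 b2; set h := n.+1%:R^-1; move: (_ / _) => a; move: (_ / _) => b.
by clearbody h => *; lra.
Qed.

Lemma inv_cvg0 : (fun n => n.+1%:R^-1 : R) @ Unat --> 0.
Proof.
apply: Unat_cvg; apply/cvgrPdist_lt => e e0.
have := @near_infty_natSinv_lt R (PosNum e0); apply: filterS => n.
by rewrite sub0r normrN ger0_norm.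
Qed.

Lemma idx_cvg (x : R) : 0 <= x -> (fun n => (idx n x)%:R / n.+1%:R : R) @ Unat --> x.
Proof.
move=> x0; apply: (@squeeze_cvgr _ _ _ _ (fun n => x - n.+1%:R^-1) (fun=> x)).
- apply: (@filterE _ Unat) => n; have /andP[h1 h2] := idx_itv n x0.
  by rewrite h1 andbT lerBlDr ltW.
- rewrite -[X in _ --> X]subr0; apply: cvgB; [exact: cvg_cst|exact: inv_cvg0].
- exact: cvg_cst.
Qed.

Context (v c : nat -> nat -> R) (K B : R).
Hypothesis vK : forall n j, (j < n.+1)%N -> `|v n j.+1 - v n j| <= K / n.+1%:R.
Hypothesis vB : forall n j, (j <= n.+1)%N -> `|v n j| <= B.
Hypothesis cB : forall n j, (j <= n.+1)%N -> `|c n j| <= B.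
Hypothesis c_equi : forall e : R, 0 < e -> exists2 d : R, 0 < d & exists N0 : nat,
  forall n j k, (N0 <= n)%N -> (j <= k)%N -> (k <= n.+1)%N ->
  (k - j)%:R / n.+1%:R <= d -> `|c n k - c n j| <= e.

Let K0 : 0 <= K.
Proof.
by have := le_trans (normr_ge0 _) (vK (ltn0Sn 0)); rewrite divr1.
Qed.

Let B0 : 0 <= B.
Proof. exact: le_trans (normr_ge0 _) (vB (leq0n 1)). Qed.

Let V x := ulim (fun n => v n (idx n x)).
Let C x := ulim (fun n => c n (idx n x)).
Let S n x := \sum_(j < idx n x) (v n j.+1 - v n j) * c n j.
(** The limit of sums of c dv over [0, x], where the differences of v may
converge weakly only, while c converges uniformly. *)
Definition stieltjes_lim x := ulim (fun n => S n x).
Let G := stieltjes_lim.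

Lemma grid_cvg (a : nat -> nat -> R) x : (forall n j, (j <= n.+1)%N -> `|a n j| <= B) ->
  0 <= x <= 1 ->
  (fun n => a n (idx n x)) @ Unat --> ulim (fun n => a n (idx n x)).
Proof.
move=> aB /andP[x0 x1]; apply: (@ulim_cvg _ _ B) => n.
by apply: aB; exact: idx_le.
Qed.

Let Vcvg x : 0 <= x <= 1 -> (fun n => v n (idx n x)) @ Unat --> V x.
Proof. exact: grid_cvg. Qed.

Let Ccvg x : 0 <= x <= 1 -> (fun n => c n (idx n x)) @ Unat --> C x.
Proof. exact: grid_cvg. Qed.

Let S_diff n x y : 0 <= x -> x <= y ->
  S n y - S n x = \sum_(idx n x <= j < idx n y) (v n j.+1 - v n j) * c n j.
Proof.
move=> x0 xy; rewrite /S -!(big_mkord xpredT (fun j => (v n j.+1 - v n j) * c n j)).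
by rewrite (big_cat_nat (leq0n _) (idx_mono n x0 xy))/= addrAC subrr add0r.
Qed.

Let S_diff_le n x y (a e : R) : 0 <= x -> x <= y -> y <= 1 -> 0 <= e ->
  (forall j, (idx n x <= j < idx n y)%N -> `|c n j - a| <= e) ->
  `|S n y - S n x - a * (v n (idx n y) - v n (idx n x))| <=
  K * e * (y - x + n.+1%:R^-1).
Proof.
move=> x0 xy y1 e0 ca; rewrite S_diff//.
rewrite -(telescope_sumr _ (idx_mono n x0 xy)) mulr_sumr -sumrB.
rewrite (eq_big_nat _ _ (F2 := fun j => (v n j.+1 - v n j) * (c n j - a))); last first.
  by move=> j _; ring.
apply: le_trans (ler_norm_sum _ _ _) _.
apply: (@le_trans _ _ (\sum_(idx n x <= j < idx n y) (K / n.+1%:R * e))).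
  rewrite !big_nat; apply: ler_sum => j jxy; rewrite normrM; apply: ler_pM => //.
    apply: vK; case/andP: jxy => _ /leq_trans; apply.
    exact: idx_le (le_trans x0 xy) y1.
  exact: ca.
have -> : \sum_(idx n x <= j < idx n y) (K / n.+1%:R * e) =
    K * e * ((idx n y - idx n x)%:R / n.+1%:R).
  rewrite sumr_const_nat -[LHS]mulr_natr.
  by move: (_ - _)%N => m; rewrite (mulrAC K) -!mulrA [_^-1 * _]mulrC.
by rewrite ler_wpM2l ?mulr_ge0// idx_dist.
Qed.

Let S_le n x : 0 <= x -> x <= 1 -> `|S n x| <= K * B * 2.
Proof.
move=> x0 x1; have := @S_diff_le n 0 x 0 B (lexx 0) x0 x1 B0 _.
rewrite mul0r subr0 {2}/S idx0 big_ord0 subr0 => h; apply: le_trans (h _) _.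
  by move=> j /andP[_ jx]; rewrite subr0; apply/cB/(leq_trans (ltnW jx))/idx_le.
rewrite ler_wpM2l ?mulr_ge0// subr0.
have : n.+1%:R^-1 <= 1 :> R by rewrite invf_le1 ?ler1n ?ltr0n.
move: (_^-1) => z; lra.
Qed.

Let Gcvg x : 0 <= x <= 1 -> (fun n => S n x) @ Unat --> G x.
Proof. by move=> /andP[x0 x1]; apply: (@ulim_cvg _ _ (K * B * 2)) => n; exact: S_le. Qed.

Let in01 (x y z : R) : 0 <= x -> x <= z -> z <= y -> y <= 1 ->
  [/\ 0 <= x <= 1, 0 <= y <= 1 & 0 <= z <= 1].
Proof. by move=> *; split; apply/andP; split; lra. Qed.

Let rhs_cvg (M a : R) : (fun n => M * (a + n.+1%:R^-1)) @ Unat --> M * a.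
Proof.
rewrite -[X in _ --> M * X]addr0; apply: cvgM; first exact: cvg_cst.
by apply: cvgD; [exact: cvg_cst|exact: inv_cvg0].
Qed.

(** On a short interval c is almost constant, so the increment of the sum is
almost c times the increment of v, and this passes to the limit. It gives
dG = C dV wherever V is differentiable, although nothing is known about the
convergence of the difference quotients of v. *)
Lemma stieltjes_lim_approx e : 0 < e -> exists2 d, 0 < d & forall x y z,
  0 <= x -> x <= z -> z <= y -> y <= 1 -> y - x <= d ->
  `|G y - G x - C z * (V y - V x)| <= K * e * (y - x).
Proof.
move=> e0; have [d d0 [N0 H]] := c_equi e0.
exists (d / 2); first by rewrite divr_gt0.
move=> x y z x0 xz zy y1 xyd.
have [x01 y01 z01] := in01 x0 xz zy y1.
have L : (fun n => `|S n y - S n x - c n (idx n z) * (v n (idx n y) - v n (idx n x))|)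
   @ Unat --> `|G y - G x - C z * (V y - V x)|.
  apply: cvg_norm; apply: cvgB; first by apply: cvgB; exact: Gcvg.
  by apply: cvgM; [exact: Ccvg|apply: cvgB; exact: Vcvg].
apply: (Unat_le L (@rhs_cvg (K * e) (y - x))).
have [N1 N1P] : exists N1 : nat, forall n, (N1 <= n)%N -> n.+1%:R^-1 <= d / 2.
  have d20 : 0 < d / 2 by rewrite divr_gt0.
  have [N1 _ N1P] := @near_infty_natSinv_lt R (PosNum d20).
  by exists N1 => n /N1P /ltW.
apply: (@Unat_ge _ (maxn N0 N1)) => n; rewrite geq_max => /andP[n0 n1].
apply: S_diff_le => //; [exact: le_trans zy|exact: ltW|].
have n1' := N1P _ n1.
have dist : (idx n y - idx n x)%:R / n.+1%:R <= d.
  by apply: le_trans (idx_dist n x0 (le_trans xz zy)) _; move: n1'; move: (_^-1) => *; lra.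
have sub a b : (idx n x <= a)%N -> (a <= b)%N -> (b <= idx n y)%N ->
    `|c n b - c n a| <= e.
  move=> xa ab by_; apply: H => //.
    by apply: leq_trans by_ _; apply: idx_le => //; case/andP: y01.
  by apply: le_trans dist; rewrite ler_wpM2r ?invr_ge0 ?ler0n// ler_nat leq_sub.
move=> j /andP[xj jy].
have xz' := idx_mono n x0 xz; have zy' := idx_mono n (le_trans x0 xz) zy.
have [jz|/ltnW zj] := leqP j (idx n z); first by rewrite distrC; exact: sub.
by apply: sub => //; exact: ltnW.
Qed.

Lemma stieltjes_lim_lip x y : 0 <= x <= 1 -> 0 <= y <= 1 ->
  `|G x - G y| <= K * B * `|x - y|.
Proof.
wlog xy : x y / x <= y => [h|].
  have [/h//|/ltW xy] := leP x y; move=> x01 y01.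
  by rewrite distrC (distrC x); exact: h.
move=> x01 y01; rewrite distrC (distrC x) (ger0_norm (_ : 0 <= y - x)) ?subr_ge0//.
have L : (fun n => `|S n y - S n x|) @ Unat --> `|G y - G x|.
  by apply: cvg_norm; apply: cvgB; exact: Gcvg.
apply: (Unat_le L (@rhs_cvg (K * B) (y - x))).
case/andP: (x01) => x0 _; case/andP: (y01) => _ y1.
apply: (@filterE _ Unat) => n; have := @S_diff_le n x y 0 B x0 xy y1 B0 _.
rewrite mul0r subr0; apply => j /andP[_ jy]; rewrite subr0.
by apply/cB/(leq_trans (ltnW jy))/idx_le => //; exact: le_trans xy.
Qed.

Lemma grid_lim_lip x y : 0 <= x <= 1 -> 0 <= y <= 1 -> `|V x - V y| <= K * `|x - y|.
Proof.
wlog xy : x y / x <= y => [h|].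
  have [/h//|/ltW xy] := leP x y; move=> x01 y01.
  by rewrite distrC (distrC x); exact: h.
move=> x01 y01; rewrite distrC (distrC x) (ger0_norm (_ : 0 <= y - x)) ?subr_ge0//.
have L : (fun n => `|v n (idx n y) - v n (idx n x)|) @ Unat --> `|V y - V x|.
  by apply: cvg_norm; apply: cvgB; exact: Vcvg.
apply: (Unat_le L (@rhs_cvg K (y - x))).
case/andP: (x01) => x0 _; case/andP: (y01) => _ y1.
apply: (@filterE _ Unat) => n; rewrite -(telescope_sumr _ (idx_mono n x0 xy)).
apply: le_trans (ler_norm_sum _ _ _) _.
apply: (@le_trans _ _ (\sum_(idx n x <= j < idx n y) (K / n.+1%:R))).
  rewrite !big_nat; apply: ler_sum => j /andP[_ jy].
  by apply/vK/(leq_trans jy)/idx_le => //; exact: le_trans xy.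
have -> : \sum_(idx n x <= j < idx n y) (K / n.+1%:R) =
    K * ((idx n y - idx n x)%:R / n.+1%:R).
  by rewrite sumr_const_nat -[LHS]mulr_natr mulrAC mulrA.
by rewrite ler_wpM2l// idx_dist.
Qed.

Lemma stieltjes_lim0 : G 0 = 0.
Proof.
apply: ulimE; rewrite (_ : (fun n => _) = fun=> 0); first exact: cvg_cst.
by apply/funext => n; rewrite /S idx0 big_ord0.
Qed.

Lemma stieltjes_lim1 :
  (fun n => \sum_(j < n.+1) (v n j.+1 - v n j) * c n j) @ Unat --> G 1.
Proof.
have := @Gcvg 1; rewrite ler01 lexx => /(_ isT).
rewrite (_ : (fun n => S n 1) = fun n => \sum_(j < n.+1) (v n j.+1 - v n j) * c n j)//.
by apply/funext => n; rewrite /S idx1.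
Qed.

End GridLimit.

Section DeriveApprox.
Context (R : realType).

Lemma near0_le (d : R) : 0 < d -> \forall h \near (0 : R), `|h| <= d.
Proof.
by move=> d0; apply/nbhs_ballP; exists d => // z; rewrite /ball/= sub0r normrN => /ltW.
Qed.

(** Differentiation of f with respect to g. *)
Lemma is_derive_approx (f g : R -> R) (x c D : R) : is_derive x 1 g D ->
  (forall e, 0 < e -> \forall h \near 0,
     `|f (h + x) - f x - c * (g (h + x) - g x)| <= e * `|h|) ->
  is_derive x 1 f (c * D).
Proof.
move=> gD H.
have gc : h^-1 *: ((g \o shift x) (h *: 1) - g x) @[h --> 0^'] --> D.
  have dg : derivable g x 1 by exact: ex_derive.
  by rewrite -(@derive_val _ _ _ _ _ _ _ gD); exact: dg.
have fc : h^-1 *: ((f \o shift x) (h *: 1) - f x) @[h --> 0^'] --> c * D.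
  have cgc : c * (h^-1 *: ((g \o shift x) (h *: 1) - g x)) @[h --> 0^'] --> c * D.
    by apply: cvgM; [exact: cvg_cst|exact: gc].
  apply/cvgrPdist_le => e e0.
  have e2 : 0 < e / 2 by rewrite divr_gt0.
  have H1 : \forall h \near 0^',
      `|c * D - c * (h^-1 *: ((g \o shift x) (h *: 1) - g x))| <= e / 2.
    by move: cgc => /cvgrPdist_le; apply.
  have H2 : \forall h \near 0^',
     `|f (h + x) - f x - c * (g (h + x) - g x)| <= e / 2 * `|h|.
    by apply: cvg_within; exact: H.
  have H3 : \forall h \near (0 : R)^', h != 0 by exact: nbhs_dnbhs_neq.
  near=> h.
  have h1 : `|c * D - c * (h^-1 *: ((g \o shift x) (h *: 1) - g x))| <= e / 2 by near: h.
  have h2 : `|f (h + x) - f x - c * (g (h + x) - g x)| <= e / 2 * `|h| by near: h.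
  have h0 : h != 0 by near: h.
  rewrite /= /shift/= /GRing.scale/= mulr1 in h1 *.
  have -> : c * D - h^-1 * (f (h + x) - f x) =
    (c * D - c * (h^-1 * (g (h + x) - g x))) -
    h^-1 * (f (h + x) - f x - c * (g (h + x) - g x)) by ring.
  apply: le_trans (ler_normB _ _) _.
  have : `|h^-1 * (f (h + x) - f x - c * (g (h + x) - g x))| <= e / 2.
    by rewrite normrM normfV ler_pdivrMl ?normr_gt0// [leRHS]mulrC.
  lra.
apply: DeriveDef; first by apply/cvg_ex; exists (c * D).
exact: cvg_lim fc.
Unshelve. all: by end_near. Qed.

End DeriveApprox.

Section SideIntegral.
Context (R : realType).
Notation mu := (@lebesgue_measure R).

(** x is sgn i * y, where y in [0, 1] is the distance to the interface. *)
Definition sgn (i : 'I_2) : R := if i == ord0 then -1 else 1.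

Lemma sgn_sqr i : sgn i * sgn i = 1.
Proof. by rewrite /sgn; case: ifP; rewrite ?mulN1r ?opprK ?mulr1. Qed.

Lemma sgn_norm i : `|sgn i| = 1.
Proof. by rewrite /sgn; case: ifP; rewrite ?normrN normr1. Qed.

Lemma I2_cases (P : 'I_2 -> Prop) : P ord0 -> P ord_max -> forall i, P i.
Proof.
by move=> P0 P1 [[|[|//]] Hi]; [move: P0|move: P1]; congr P; exact/val_inj.
Qed.

Lemma sgn_omega (i : 'I_2) (x : R) : (i%:R - 1 < x < i%:R) = (0 < sgn i * x < 1).
Proof.
elim/I2_cases: i; rewrite /sgn/=.
  by rewrite mulN1r oppr_gt0 ltrNl sub0r andbC.
by rewrite mul1r subrr.
Qed.

Lemma sgn_closed (i : 'I_2) (x : R) : (i%:R - 1 <= x <= i%:R) = (0 <= sgn i * x <= 1).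
Proof.
elim/I2_cases: i; rewrite /sgn/=.
  by rewrite mulN1r oppr_ge0 lerNl sub0r andbC.
by rewrite mul1r subrr.
Qed.

Lemma is_derive_sgn (i : 'I_2) (f : R -> R) (x d : R) : is_derive (sgn i * x) 1 f d ->
  is_derive x 1 (fun z => f (sgn i * z)) (sgn i * d).
Proof.
move=> fd; have sd : is_derive x 1 (fun z => sgn i * z) (sgn i).
  by rewrite -[X in is_derive _ _ _ X]mulr1; exact: is_deriveZ.
by have := @is_derive1_comp _ f (fun z => sgn i * z) x _ _ fd sd; rewrite mulrC.
Qed.

(** G is Lipschitz with derivative C V' wherever V is differentiable, that
is a.e., and lipschitz_FTC applies to it. *)
Lemma side_integral (i : 'I_2) (V G C D : R -> R) (K M : R) :
  (forall x y, 0 <= x <= 1 -> 0 <= y <= 1 -> `|V x - V y| <= K * `|x - y|) ->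
  (forall x y, 0 <= x <= 1 -> 0 <= y <= 1 -> `|G x - G y| <= M * `|x - y|) ->
  (forall x d : R, 0 < x < 1 -> is_derive x 1 V d -> is_derive x 1 G (C x * d)) ->
  measurable_fun (Omega R i) D ->
  {ae mu, forall x : R, Omega R i x -> forall d : R, is_derive (sgn i * x) 1 V d ->
     D x = C (sgn i * x) * d} ->
  mu.-integrable (Omega R i) (EFin \o D) /\
  \int[mu]_(x in Omega R i) D x = G 1 - G 0.
Proof.
move=> VK GM GV mD DE.
have ab : i%:R - 1 < i%:R :> R by rewrite gtrBl.
have slip (f : R -> R) (L : R) :
    (forall x y, 0 <= x <= 1 -> 0 <= y <= 1 -> `|f x - f y| <= L * `|x - y|) ->
    forall x y, i%:R - 1 <= x <= i%:R -> i%:R - 1 <= y <= i%:R ->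
    `|f (sgn i * x) - f (sgn i * y)| <= L * `|x - y|.
  move=> fL x y; rewrite !sgn_closed => x1 y1; apply: le_trans (fL _ _ x1 y1) _.
  by rewrite -mulrBr normrM sgn_norm mul1r.
have [dV _] := lipschitz_FTC ab (slip _ _ VK).
have GM' x y : i%:R - 1 <= x <= i%:R -> i%:R - 1 <= y <= i%:R ->
   `|sgn i * G (sgn i * x) - sgn i * G (sgn i * y)| <= M * `|x - y|.
  by move=> x1 y1; rewrite -mulrBr normrM sgn_norm mul1r; exact: slip.
have [_ FTC] := lipschitz_FTC ab GM'.
have [|] := FTC D mD.
  apply: ae_mono2 dV DE _ => x dVx DEx xab _.
  have xO : Omega R i x by rewrite /Omega/= in_itv.
  have dW : is_derive (sgn i * x) 1 V (sgn i * derive1 (fun z => V (sgn i * z)) x).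
    have dWx : is_derive x 1 (fun z => V (sgn i * z)) (derive1 (fun z => V (sgn i * z)) x).
      by rewrite derive1E; exact: DeriveDef (dVx xab) _.
    have := @is_derive_sgn i (fun z => V (sgn i * z)) (sgn i * x)
      (derive1 (fun z => V (sgn i * z)) x).
    rewrite mulrA sgn_sqr mul1r => /(_ dWx).
    rewrite (_ : (fun z => V (sgn i * (sgn i * z))) = V)//.
    by apply/funext => y; rewrite mulrA sgn_sqr mul1r.
  rewrite (DEx xO _ dW).
  have x01 : 0 < sgn i * x < 1 by rewrite -sgn_omega.
  have dG := is_derive_sgn (GV _ _ x01 dW).
  have dG2 : is_derive x 1 (fun z => sgn i * G (sgn i * z))
     (sgn i *: (sgn i * (C (sgn i * x) * (sgn i * derive1 (fun z => V (sgn i * z)) x)))).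
    exact: is_deriveZ.
  by rewrite [RHS]derive1E (@derive_val _ _ _ _ _ _ _ dG2) /GRing.scale/= [RHS]mulrA sgn_sqr mul1r.
move=> iD ->; split=> //.
elim/I2_cases: i {VK GM GV mD DE ab slip dV GM' FTC iD}; rewrite /sgn/=.
  by rewrite !(mulN1r, mulr0, sub0r, opprK, oppr0) addrC.
by rewrite !mul1r subrr.
Qed.

End SideIntegral.

(** * A smooth ramp *)

Section SmoothFamilies.
Context (R : realType).

Lemma is_derive_dir (f : R -> R) (x v d : R) : is_derive x 1 f d -> is_derive x v f (v * d).
Proof.
move=> fd; have df : differentiable f x by apply/derivable1_diffP; exact: ex_derive.
apply: DeriveDef; first exact: diff_derivable.
rewrite deriveE// -[X in 'd f x X]mulr1 -[v * 1]/(v *: (1 : R)) linearZ/=.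
by rewrite -deriveE// derive_val.
Qed.

(** A family closed under differentiation consists of smooth functions, as
the directional derivatives in dimension one are multiples of the derivative. *)
Lemma smooth_family (S : set (R -> R)) :
  (forall f, S f -> exists g, S g /\ forall x : R, is_derive x 1 f (g x)) ->
  forall f, S f -> smooth f.
Proof.
move=> SD f Sf vs; have [c [g [Sg gE]]] : exists c g, S g /\
    foldr (fun v h => 'D_v h) f vs = (fun x => c * g x).
  elim: vs => [|v vs [c [g [Sg IH]]]] /=.
    by exists 1, f; split=> //; apply/funext => x; rewrite mul1r.
  have [g' [Sg' gD]] := SD _ Sg; exists (v * c), g'; split=> //.
  rewrite IH; apply/funext => x.
  have D1 : is_derive x 1 (fun x => c * g x) (c * g' x) by exact: is_deriveZ.
  by have D2 := is_derive_dir v D1; rewrite derive_val mulrA.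
have [g' [_ gD]] := SD _ Sg.
have D1 (x : R) : is_derive x 1 (fun x => c * g x) (c * g' x) by exact: is_deriveZ.
rewrite gE; split=> [x|x v].
  apply: differentiable_continuous; apply/derivable1_diffP.
  by apply: ex_derive.
by have D2 := is_derive_dir v (D1 x); exact: ex_derive.
Qed.

(** The algebra generated by B. If the derivatives of the generators lie in
it, then it is closed under differentiation; so only the generators below need
to be differentiated. *)
Inductive algebra_gen (B : set (R -> R)) : (R -> R) -> Prop :=
| gen_base f : B f -> algebra_gen B f
| gen_cst c : algebra_gen B (fun=> c)
| gen_add f g : algebra_gen B f -> algebra_gen B g -> algebra_gen B (fun x => f x + g x)
| gen_mul f g : algebra_gen B f -> algebra_gen B g -> algebra_gen B (fun x => f x * g x).

Lemma algebra_gen_derive (B : set (R -> R)) :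
  (forall f, B f -> exists g, algebra_gen B g /\ forall x : R, is_derive x 1 f (g x)) ->
  forall f, algebra_gen B f -> exists g, algebra_gen B g /\ forall x : R, is_derive x 1 f (g x).
Proof.
move=> BD f; elim=> {f}[f /BD//|c|f g Bf [f' [Bf' fD]] Bg [g' [Bg' gD]]|
  f g Bf [f' [Bf' fD]] Bg [g' [Bg' gD]]].
- exists (fun=> 0); split; first exact: gen_cst.
  by move=> x; exact: is_derive_cst.
- exists (fun x => f' x + g' x); split; first exact: gen_add.
  by move=> x; exact: is_deriveD.
- exists (fun x => f x * g' x + g x * f' x); split.
    by apply: gen_add; exact: gen_mul.
  by move=> x; exact: is_deriveM.
Qed.

End SmoothFamilies.

Section Bump.
Context (R : realType).
Notation mu := (@lebesgue_measure R).

(** The functions x^(-n) exp(-1/x), extended by 0; each derivative is a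
combination of such functions. *)
Definition flat (n : nat) (x : R) : R := if 0 < x then x^-1 ^+ n * expR (- x^-1) else 0.

Lemma flat_ge0 n x : 0 <= flat n x.
Proof.
by rewrite /flat; case: ifP => // x0; rewrite mulr_ge0 ?expR_ge0// exprn_ge0// invr_ge0 ltW.
Qed.

Lemma flat_le0 n x : x <= 0 -> flat n x = 0.
Proof. by move=> x0; rewrite /flat ltNge x0. Qed.

Lemma flat_gt0 n x : 0 < x -> 0 < flat n x.
Proof. by move=> x0; rewrite /flat x0 mulr_gt0 ?expR_gt0// exprn_gt0// invr_gt0. Qed.

(** From exp(1/x) >= (1/x)^(n+2) / (n+2)!; the square makes flat n
differentiable at 0 with derivative 0. *)
Lemma flat_small n x : `|flat n x| <= (n.+2)`!%:R * `|x| * `|x|.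
Proof.
rewrite ger0_norm ?flat_ge0// /flat; case: ifP => [x0|_]; last by rewrite !mulr_ge0.
have y0 : 0 < x^-1 by rewrite invr_gt0.
have := @expR_ge1Dxn R x^-1 n.+1 (ltW y0).
have f0 : 0 < (n.+2)`!%:R :> R by rewrite ltr0n fact_gt0.
have e0 := expR_gt0 x^-1.
move=> h; have {}h : x^-1 ^+ n.+2 <= (n.+2)`!%:R * expR x^-1.
  rewrite -ler_pdivrMl// mulrC; apply: le_trans h; lra.
rewrite expRN ler_pdivrMr// (gtr0_norm x0).
have -> : x^-1 ^+ n = x^-1 ^+ n.+2 * x * x.
  by rewrite !exprS; field; rewrite gt_eqF.
rewrite -[leRHS]mulrA [leRHS]mulrC.
have : 0 <= x * x by rewrite mulr_ge0// ltW.
nra.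
Qed.

Lemma flat_derive n (x : R) : is_derive x 1 (flat n) (- n%:R * flat n.+1 x + flat n.+2 x).
Proof.
have [x0|x0|<-] := ltgtP 0 x.
- have E : \forall y \near x, y^-1 ^+ n * expR (- y^-1) = flat n y.
    by near=> y; rewrite /flat ifT//; near: y; exact: lt_nbhsr.
  apply: near_eq_is_derive E _.
  have xn : x != 0 by rewrite gt_eqF.
  have dV : is_derive x 1 (fun y : R => y^-1) (- x ^- 2 *: 1).
    exact: (@is_deriveV _ id).
  have dX : is_derive x 1 (fun y : R => y^-1 ^+ n) ((n%:R * x^-1 ^+ n.-1) *: (- x ^- 2 *: 1)).
    have -> : (fun y : R => y^-1 ^+ n) = (fun y : R => y^-1) ^+ n.
      by apply/funext => y; rewrite exprfctE.
    exact: is_deriveX.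
  have dN : is_derive x 1 (fun y : R => - y^-1) (- (- x ^- 2 *: 1)) by exact: is_deriveN.
  have dE : is_derive x 1 (fun y : R => expR (- y^-1)) (expR (- x^-1) * - (- x ^- 2 *: 1)).
    exact: (@is_derive1_comp _ expR (fun y => - y^-1)).
  have cong (f : R -> R) (d d' : R) : d = d' -> is_derive x 1 f d -> is_derive x 1 f d'.
    by move=> ->.
  apply: (cong _ _ _ _ (is_deriveM dX dE)).
  rewrite /flat x0 /GRing.scale/=; case: n {dX} => [|n].
    by rewrite !expr0; field.
  by rewrite /= !exprS; field.
- rewrite !flat_le0 ?ltW// mulr0 addr0.
  have E : \forall y \near x, 0 = flat n y.
    by near=> y; rewrite flat_le0//; apply: ltW; near: y; exact: lt_nbhsl.
  by apply: near_eq_is_derive E _; exact: is_derive_cst.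
- rewrite !flat_le0// mulr0 addr0 -[X in is_derive _ _ _ X](mul0r (1 : R)).
  apply: (@is_derive_approx _ (flat n) id) => e e0.
  have f0 : 0 < (n.+2)`!%:R :> R by rewrite ltr0n fact_gt0.
  have M0 : 0 < (n.+2)`!%:R^-1 * e by rewrite mulr_gt0// invr_gt0.
  near=> h; rewrite mul0r subr0 addr0 (flat_le0 n (lexx 0)) subr0.
  apply: le_trans (flat_small n h) _.
  have hM : `|h| <= (n.+2)`!%:R^-1 * e.
    near: h; apply/nbhs_ballP; exists ((n.+2)`!%:R^-1 * e); first exact: M0.
    by move=> y; rewrite /ball/= sub0r normrN => /ltW.
  by rewrite ler_wpM2r// -ler_pdivlMl.
Unshelve. all: by end_near. Qed.

Lemma flat_continuous n : continuous (flat n).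
Proof.
move=> x; apply: differentiable_continuous; apply/derivable1_diffP.
by have := flat_derive n x => ?; exact: ex_derive.
Qed.

Definition bump x := flat 0 (1 + x) * flat 0 (1 - x).

Lemma bump_ge0 x : 0 <= bump x.
Proof. by rewrite mulr_ge0 ?flat_ge0. Qed.

Lemma bump_out x : 1 <= `|x| -> bump x = 0.
Proof.
rewrite /bump ler_normr => /orP[x1|x1].
  by rewrite [X in _ * X]flat_le0 ?mulr0//; lra.
by rewrite [X in X * _]flat_le0 ?mul0r//; lra.
Qed.

Lemma bump_continuous : continuous bump.
Proof.
move=> x; apply: cvgM.
  apply: (@cvg_comp _ _ _ (fun x => 1 + x) (flat 0)); last exact: flat_continuous.
  by apply: cvgD; [exact: cvg_cst|exact: cvg_id].
apply: (@cvg_comp _ _ _ (fun x => 1 - x) (flat 0)); last exact: flat_continuous.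
by apply: cvgB; [exact: cvg_cst|exact: cvg_id].
Qed.

(** The bump vanishes outside [-1, 1]; integrating from -2 leaves room to
differentiate at -1. *)
Definition ramp x := \int[mu]_(t in `[-2, x]) bump t.

Lemma ramp_low x : x <= -1 -> ramp x = 0.
Proof.
move=> x1; rewrite /ramp (@eq_Rintegral _ _ _ _ _ (fun=> 0)); first by rewrite /Rintegral integral0.
move=> t; rewrite inE/= in_itv/= => /andP[_ tx]; rewrite bump_out// ler_normr.
by apply/orP; right; lra.
Qed.

Lemma ramp_derive (x : R) : is_derive x 1 ramp (bump x).
Proof.
have [x2|x2] := ltP x (-1).
  rewrite bump_out; last by rewrite ler_normr; apply/orP; right; lra.
  have E : \forall y \near x, 0 = ramp y.
    by near=> y; rewrite ramp_low//; apply: ltW; near: y; exact: lt_nbhsl.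
  by apply: near_eq_is_derive E _; exact: is_derive_cst.
have ibump : mu.-integrable `[-2, x + 1] (EFin \o bump).
  apply: (continuous_compact_integrable (@segment_compact R _ _)).
  exact: (continuous_subspaceT bump_continuous).
have xx : x < x + 1 by rewrite ltrDl.
have x20 : -2 < x by lra.
have [dF F'] := continuous_FTC1_closed xx ibump x20 (@bump_continuous x).
by rewrite -F' derive1E; exact: DeriveDef.
Unshelve. all: by end_near. Qed.

Lemma ramp_mono x y : x <= y -> ramp x <= ramp y.
Proof.
rewrite le_eqVlt => /orP[/eqP->//|xy].
have [|c _ E] := @MVT R ramp bump x y xy (fun z _ => ramp_derive z).
  apply: derivable_within_continuous => z _; have ? := ramp_derive z.
  exact: ex_derive.
by rewrite -subr_ge0 E mulr_ge0 ?bump_ge0// subr_ge0 ltW.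
Qed.

Lemma ramp_ge0 x : 0 <= ramp x.
Proof.
have [x1|/ltW x1] := leP x (-1); first by rewrite ramp_low.
by rewrite -(ramp_low (lexx (-1))) ramp_mono.
Qed.

Lemma ramp_high x : 1 <= x -> ramp x = ramp 1.
Proof.
rewrite le_eqVlt => /orP[/eqP->//|xy].
have [|c] := @MVT R ramp bump 1 x xy (fun z _ => ramp_derive z).
  apply: derivable_within_continuous => z _; have ? := ramp_derive z.
  exact: ex_derive.
rewrite in_itv/= => /andP[c1 _]; rewrite bump_out; last by rewrite ler_normr ltW.
by rewrite mul0r => /eqP; rewrite subr_eq0 => /eqP.
Qed.

Lemma ramp1_gt0 : 0 < ramp 1.
Proof.
have m11 : (-1 : R) < 1 by lra.
have [|c] := @MVT R ramp bump (-1) 1 m11 (fun z _ => ramp_derive z).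
  apply: derivable_within_continuous => z _; have ? := ramp_derive z.
  exact: ex_derive.
rewrite in_itv/= => /andP[c1 c2]; rewrite (ramp_low (lexx _)) subr0 => ->.
by rewrite mulr_gt0 ?mulr_gt0 ?flat_gt0//; lra.
Qed.

Lemma ramp_le x : ramp x <= ramp 1.
Proof.
have [x1|/ltW x1] := leP x 1; first exact: ramp_mono.
by rewrite ramp_high.
Qed.

Definition bump_base : set (R -> R) := [set f | exists a b : R,
  (exists n, f = fun x => flat n (a + b * x)) \/ f = fun x => ramp (a + b * x)].

Lemma affine_derive (f : R -> R) (a b x d : R) : is_derive (a + b * x) 1 f d ->
  is_derive x 1 (fun x => f (a + b * x)) (d * b).
Proof.
move=> fd; apply: (@is_derive1_comp _ f (fun x => a + b * x)) => //.
rewrite -[X in is_derive _ _ _ X]add0r; apply: is_deriveD.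
by rewrite -[X in is_derive _ _ _ X]mulr1; exact: is_deriveZ.
Qed.

Lemma bump_base_derive f : bump_base f ->
  exists g, algebra_gen bump_base g /\ forall x : R, is_derive x 1 f (g x).
Proof.
have flatG n a b : algebra_gen bump_base (fun x => flat n (a + b * x)).
  by apply: gen_base; exists a, b; left; exists n.
case=> a [b] [[n ->]|->].
  exists (fun x => (- n%:R * flat n.+1 (a + b * x) + flat n.+2 (a + b * x)) * b).
  split; last by move=> x; apply: affine_derive; exact: flat_derive.
  apply: gen_mul; last exact: gen_cst.
  apply: gen_add => //; apply: gen_mul => //; exact: gen_cst.
exists (fun x => bump (a + b * x) * b); split.
  apply: gen_mul; last exact: gen_cst.
  apply: gen_mul.
    have -> : (fun x => flat 0 (1 + (a + b * x))) = (fun x => flat 0 ((1 + a) + b * x)).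
      by apply/funext => x; rewrite addrA.
    exact: flatG.
  have -> : (fun x => flat 0 (1 - (a + b * x))) = (fun x => flat 0 ((1 - a) + (- b) * x)).
    by apply/funext => x; congr flat; ring.
  exact: flatG.
by move=> x; apply: affine_derive; exact: ramp_derive.
Qed.

Lemma ramp_diff_smooth (a b k : R) :
  smooth (fun x => ramp (k * (x - a)) - ramp (k * (x - b))).
Proof.
apply: (smooth_family (@algebra_gen_derive _ _ bump_base_derive)).
have H c : algebra_gen bump_base (fun x => ramp (k * (x - c))).
  have -> : (fun x => ramp (k * (x - c))) = (fun x => ramp (- (k * c) + k * x)).
    by apply/funext => x; congr ramp; ring.
  by apply: gen_base; exists (- (k * c)), k; right.
have -> : (fun x => ramp (k * (x - a)) - ramp (k * (x - b))) =
  (fun x => ramp (k * (x - a)) + (fun x => (fun=> -1) x * (fun x => ramp (k * (x - b))) x) x).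
  by apply/funext => x; rewrite mulN1r.
apply: gen_add => //; apply: gen_mul => //; exact: gen_cst.
Qed.

End Bump.

(** * Lipschitz representatives of functions with bounded weak derivative *)

Section WeakLipschitz.
Context (R : realType).
Notation mu := (@lebesgue_measure R).

Lemma within_continuousP (A B : R) (g : R -> R) a e :
  {within `[A, B], continuous g} -> A <= a <= B -> 0 < e ->
  exists2 d, 0 < d & forall x, A <= x <= B -> `|x - a| <= d -> `|g x - g a| <= e.
Proof.
move=> gc aAB e0.
have aI : [set` `[A, B]] a by rewrite /= in_itv.
have /cvgrPdist_le/(_ _ e0) := (subspace_continuousP _ _).1 gc _ aI.
rewrite near_withinE => /nbhs_ballP[d /= d0 H].
exists (d / 2); first by rewrite divr_gt0.
move=> x xAB xa; rewrite distrC; apply: H; last by rewrite /= in_itv.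
by rewrite /ball/= distrC (le_lt_trans xa)// ltr_pdivrMr// ltr_pMr// ltr1n.
Qed.

Lemma FTC_open (A B : R) (f F : R -> R) : A < B -> continuous f ->
  (forall x, is_derive x (1 : R) F (f x)) ->
  \int[mu]_(x in `]A, B[) f x = F B - F A.
Proof.
move=> AB fc Ff.
have mf (I : set R) : measurable I -> measurable_fun I f.
  by move=> mI; apply: measurable_funTS; exact: continuous_measurable_fun.
have Fc : continuous F.
  move=> x; apply: differentiable_continuous; apply/derivable1_diffP.
  by have ? := Ff x; exact: ex_derive.
have := @continuous_FTC2 R f F A B AB (continuous_subspaceT fc) _ _.
rewrite integral_itv_bndoo; last first.
  by apply/measurable_EFinP; apply: measurable_funTS; exact: continuous_measurable_fun.
move=> H; rewrite /Rintegral H//.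
- split.
  + by move=> x _; have ? := Ff x; exact: ex_derive.
  + exact/cvg_at_right_filter/Fc.
  + exact/cvg_at_left_filter/Fc.
- by move=> x _; rewrite derive1E; have ? := Ff x; rewrite derive_val.
Qed.

Context (A B K : R) (v w g : R -> R).
Hypothesis AB : A < B.
Hypothesis mv : measurable_fun `]A, B[ v.
Hypothesis mw : measurable_fun `]A, B[ w.
Hypothesis wK : {ae mu, forall x, A < x < B -> `|w x| <= K}.
Hypothesis vw : weak_derivative [set` `]A, B[] v w.
Hypothesis gc : {within `[A, B], continuous g}.
Hypothesis vg : {ae mu, forall x, A < x < B -> v x = g x}.

Let c : R := ramp 1.
(** An approximation of c times the Dirac mass at a, supported within k^-1
of a; it is the derivative of a ramp. *)
Let theta (k a x : R) : R := bump (k * (x - a)) * k.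

Let theta_continuous k a : continuous (theta k a).
Proof.
move=> x; apply: cvgM; last exact: cvg_cst.
apply: (@cvg_comp _ _ _ (fun x => k * (x - a)) (@bump R)); last exact: bump_continuous.
by apply: cvgM; [exact: cvg_cst|apply: cvgB; [exact: cvg_id|exact: cvg_cst]].
Qed.

Let theta_derive k a (x : R) : is_derive x 1 (fun x => ramp (k * (x - a))) (theta k a x).
Proof.
have E : (fun x => ramp (k * (x - a))) = (fun x => ramp (- (k * a) + k * x)).
  by apply/funext => y; congr ramp; ring.
rewrite E /theta (_ : k * (x - a) = - (k * a) + k * x); last by ring.
by apply: affine_derive; exact: ramp_derive.
Qed.

Let itv_integrable (f : R -> R) : {within `[A, B], continuous f} ->
  mu.-integrable `]A, B[ (EFin \o f).
Proof.
move=> fc; have H := continuous_compact_integrable (@segment_compact R A B) fc.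
apply: integrableS H => //.
by apply: subset_itv; rewrite bnd_simp.
Qed.

Let within_mul (f h : R -> R) : {within `[A, B], continuous f} -> continuous h ->
  {within `[A, B], continuous (fun x => f x * h x)}.
Proof.
move=> fc hc; apply/subspace_continuousP => x xAB; apply: cvgM.
  exact: (subspace_continuousP _ _).1 fc _ xAB.
exact: cvg_within_filter (hc x).
Qed.

Let gtheta_int k a : mu.-integrable `]A, B[ (EFin \o (fun x => g x * theta k a x)).
Proof. by apply: itv_integrable; apply: within_mul. Qed.

Lemma mollified_value (k a e : R) : 0 < k -> A <= a - k^-1 -> a + k^-1 <= B ->
  (forall x, A <= x <= B -> `|x - a| <= k^-1 -> `|g x - g a| <= e) ->
  `|\int[mu]_(x in `]A, B[) (g x * theta k a x) - c * g a| <= e * c.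
Proof.
move=> k0 Aa aB ge.
have th0 x : 0 <= theta k a x by rewrite mulr_ge0 ?bump_ge0// ltW.
have thI : \int[mu]_(x in `]A, B[) theta k a x = c.
  rewrite (FTC_open AB (@theta_continuous k a) (@theta_derive k a)).
  rewrite (@ramp_low _ (k * (A - a))); last by rewrite -ler_pdivlMl// mulrN1; lra.
  rewrite (@ramp_high _ (k * (B - a))) ?subr0//.
  by rewrite -ler_pdivrMl// mulr1; lra.
have intth : mu.-integrable `]A, B[ (EFin \o theta k a).
  by apply: itv_integrable; exact: (continuous_subspaceT (@theta_continuous k a)).
have intZ (r : R) : mu.-integrable `]A, B[ (EFin \o (fun x => r * theta k a x)).
  apply: itv_integrable; apply: continuous_subspaceT => x.
  by apply: cvgM; [exact: cvg_cst|exact: theta_continuous].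
have E r : r * c = \int[mu]_(x in `]A, B[) (r * theta k a x).
  by rewrite RintegralZl// thI.
have bd x : `]A, B[%classic x ->
    (g a - e) * theta k a x <= g x * theta k a x <= (g a + e) * theta k a x.
  rewrite /= in_itv/= => /andP[Ax xB].
  have [xa|xa] := leP `|x - a| k^-1.
    have := ge x; rewrite (ltW Ax) (ltW xB) => /(_ isT xa).
    rewrite ler_norml => /andP[h1 h2].
    by apply/andP; split; apply: ler_wpM2r => //; lra.
  rewrite /theta bump_out; first by rewrite !mul0r !mulr0 lexx.
  by rewrite normrM (gtr0_norm k0) -ler_pdivrMl// mulr1 ltW.
rewrite ler_norml; apply/andP; split.
  rewrite lerBrDr (_ : - (e * c) + c * g a = (g a - e) * c); last by ring.
  by rewrite E; apply: le_Rintegral => // x /bd/andP[].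
rewrite lerBlDr (_ : e * c + c * g a = (g a + e) * c); last by ring.
by rewrite E; apply: le_Rintegral => // x /bd/andP[].
Qed.

Let K0 : 0 <= K.
Proof.
apply: contrapT => /negP; rewrite -ltNge => Kn.
have : mu.-negligible `]A, B[%classic.
  case: wK => N [mN N0 sub]; exists N; split=> // x; rewrite /= in_itv/= => xAB.
  apply: sub => /= /(_ xAB) wx; have := le_trans (normr_ge0 _) wx.
  by rewrite leNgt Kn.
move=> [N [mN N0 sub]].
have : (mu `]A, B[%classic <= mu N)%E by apply: le_measure; rewrite ?inE.
rewrite N0 lebesgue_measure_itv/= lte_fin AB -EFinD lee_fin subr_le0.
by rewrite leNgt AB.
Qed.

Let c0 : 0 < c. Proof. exact: ramp1_gt0. Qed.

(** The difference of two ramps is a test function with values in [0, c]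
that vanishes outside [a - k^-1, b + k^-1]; its derivative compares the means of
g around a and b, and the weak derivative is bounded by K. *)
Lemma weak_test_bound (k a b : R) : 0 < k -> a < b -> A < a - k^-1 -> b + k^-1 < B ->
  `|\int[mu]_(x in `]A, B[) (g x * theta k a x) -
    \int[mu]_(x in `]A, B[) (g x * theta k b x)| <= K * c * (b - a + 2 * k^-1).
Proof.
move=> k0 ab Aa bB.
have ki : 0 < k^-1 by rewrite invr_gt0.
pose zeta x := ramp (k * (x - a)) - ramp (k * (x - b)).
have zD (x : R) : is_derive x 1 zeta (theta k a x - theta k b x).
  by apply: is_deriveB; exact: theta_derive.
have zout x : (x <= a - k^-1) || (b + k^-1 <= x) -> zeta x = 0.
  move=> /orP[h|h]; rewrite /zeta.
    by rewrite !ramp_low ?subrr//; rewrite -ler_pdivlMl// mulrN1; lra.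
  rewrite (@ramp_high _ (k * (x - a))); last first.
    by rewrite -ler_pdivrMl// mulr1; lra.
  rewrite (@ramp_high _ (k * (x - b))) ?subrr//.
  by rewrite -ler_pdivrMl// mulr1; lra.
have z01 x : 0 <= zeta x <= c.
  rewrite /zeta subr_ge0 ramp_mono/=; last by rewrite ler_wpM2l ?(ltW k0)//; lra.
  have := ramp_ge0 (k * (x - b)); have := ramp_le (k * (x - a)); rewrite /c; lra.
have tz : test_function `]A, B[%classic zeta.
  split; first exact: ramp_diff_smooth.
  exists `[a - k^-1, b + k^-1]%classic; split.
  - exact: segment_compact.
  - by move=> x /=; rewrite !in_itv/= => /andP[h1 h2]; apply/andP; split; lra.
  - move=> x [_ /=]; rewrite in_itv/= => /negP; rewrite negb_and -!ltNge => h.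
    by apply: zout; case/orP: h => h; apply/orP; [left|right]; exact: ltW.
have z'E x : derive1 zeta x = theta k a x - theta k b x.
  by rewrite derive1E; have ? := zD x; rewrite derive_val.
have zc : continuous zeta.
  move=> x; apply: differentiable_continuous; apply/derivable1_diffP.
  by have ? := zD x; exact: ex_derive.
have mc (f : R -> R) : continuous f -> measurable_fun `]A, B[ f.
  by move=> fc; apply: measurable_funTS; exact: continuous_measurable_fun.
have := vw tz.
have -> : \int[mu]_(x in `]A, B[) (v x * derive1 zeta x) =
   \int[mu]_(x in `]A, B[) (g x * theta k a x) - \int[mu]_(x in `]A, B[) (g x * theta k b x).
  rewrite -RintegralB//.
  apply: ae_eq_Rintegral => //.
  - apply: measurable_funM => //.
    rewrite (_ : derive1 zeta = (fun x => theta k a x - theta k b x)); last exact/funext.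
    by apply: measurable_funB; apply: mc; exact: theta_continuous.
  - have mg z : measurable_fun `]A, B[ (fun x => g x * theta k z x).
      by have /integrableP[/measurable_EFinP] := gtheta_int k z.
    exact: (measurable_funB (mg a) (mg b)).
  - apply: ae_mono vg _ => x vx; rewrite /= in_itv/= => xAB.
    by rewrite vx// z'E; ring.
move=> ->; rewrite normrN.
pose J := `[a - k^-1, b + k^-1]%classic : set R.
have mJ : mu J = (b - a + 2 * k^-1)%:E.
  rewrite lebesgue_measure_itv/= lte_fin ifT; last by lra.
  by rewrite -EFinD; congr (_%:E); ring.
have fAB : (mu `]A, B[%classic < +oo)%E.
  by rewrite lebesgue_measure_itv/= lte_fin AB -EFinD ltry.
have bJ : mu.-integrable `]A, B[ (EFin \o ((fun=> K * c) \_ J)).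
  apply: measurable_bounded_integrable => //.
  - apply: measurable_funTS; apply/(measurable_restrictT _ _).1 => //; exact: measurable_itv.
  - exists (K * c); split; first exact: num_real.
    move=> M KM x _ /=; rewrite patchE; case: ifP => _; last first.
      by rewrite normr0 (le_trans _ (ltW KM))// mulr_ge0// ltW.
    by rewrite ger0_norm ?(ltW KM)// mulr_ge0// ltW.
have bound : {ae mu, forall x, `]A, B[%classic x -> `|w x * zeta x| <= ((fun=> K * c) \_ J) x}.
  apply: ae_mono wK _ => x wx; rewrite /= in_itv/= => xAB; rewrite patchE.
  case: ifPn => [_|]; last first.
    rewrite notin_setE /J/= in_itv/= => /negP; rewrite negb_and -!ltNge => h.
    rewrite zout ?mulr0 ?normr0//.
    by case/orP: h => h; apply/orP; [left|right]; exact: ltW.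
  have /andP[z0 z1] := z01 x.
  by rewrite normrM (ger0_norm z0); apply: ler_pM => //; exact: wx.
have mwz : measurable_fun `]A, B[ (fun x => w x * zeta x).
  by apply: measurable_funM => //; exact: mc.
have Kc0 x : `]A, B[%classic x -> 0 <= ((fun=> K * c) \_ J) x.
  by move=> _; rewrite patchE; case: ifP => // _; rewrite mulr_ge0// ltW.
have [_] : mu.-integrable `]A, B[ (EFin \o (fun x => w x * zeta x)) /\
    `|\int[mu]_(x in `]A, B[) (w x * zeta x)| <=
    \int[mu]_(x in `]A, B[) ((fun=> K * c) \_ J) x.
  apply: ae_dominated_Rintegral.
  - exact: measurable_itv.
  - exact: mwz.
  - exact: bJ.
  - exact: Kc0.
  - exact: bound.
move=> /le_trans; apply; rewrite -Rintegral_mkcondr.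
have -> : `]A, B[%classic `&` J = J.
  by apply/setIidPr => x; rewrite /J/= !in_itv/= => /andP[h1 h2]; apply/andP; split; lra.
rewrite Rintegral_cst; last exact: measurable_itv.
rewrite le_eqVlt; apply/orP; left; apply/eqP; congr (_ * _).
exact: (congr1 fine mJ).
Qed.

(** The previous estimate, with k tending to infinity. *)
Lemma weak_lipschitz_interior (a b : R) : A < a -> a < b -> b < B ->
  `|g a - g b| <= K * (b - a).
Proof.
move=> Aa ab bB; apply/ler_addgt0Pr => e e0.
have e4 : 0 < e / 4 by rewrite divr_gt0.
have [d1 d10 H1] := @within_continuousP A B g a _ gc (introT andP (conj (ltW Aa) (ltW (lt_trans ab bB)))) e4.
have [d2 d20 H2] := @within_continuousP A B g b _ gc (introT andP (conj (ltW (lt_trans Aa ab)) (ltW bB))) e4.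
(* half-width of the supports: small for the continuity of g and for K r *)
pose r := Num.min (Num.min (Num.min d1 d2) (Num.min ((a - A) / 2) ((B - b) / 2))) (e / (4 * (K + 1))).
have r0 : 0 < r.
  rewrite /r !lt_min d10 d20 !divr_gt0 ?subr_gt0// mulr_gt0//; have := K0; lra.
have [rd1 rd2 ra rb re] : [/\ r <= d1, r <= d2, r <= (a - A) / 2, r <= (B - b) / 2 &
    r <= e / (4 * (K + 1))].
  by split; rewrite /r !ge_min lexx ?orbT.
pose k := r^-1.
have k0 : 0 < k by rewrite invr_gt0.
have kr : k^-1 = r by rewrite invrK.
have m1 := @mollified_value k a (e / 4) k0 _ _ _.
have m2 := @mollified_value k b (e / 4) k0 _ _ _.
have m3 := @weak_test_bound k a b k0 ab _ _.
rewrite !kr in m1 m2 m3.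
have {}m1 : `|\int[mu]_(x in `]A, B[) (g x * theta k a x) - c * g a| <= e / 4 * c.
  by apply: m1; [lra|lra|move=> x xAB xr; apply: H1 => //; exact: le_trans rd1].
have {}m2 : `|\int[mu]_(x in `]A, B[) (g x * theta k b x) - c * g b| <= e / 4 * c.
  by apply: m2; [lra|lra|move=> x xAB xr; apply: H2 => //; exact: le_trans rd2].
have {}m3 := m3 (ltac:(lra)) (ltac:(lra)).
move: m1 m2 m3; move: (\int[mu]_(x in _) _) (\int[mu]_(x in _) _) => Y X m1 m2 m3.
have : c * `|g a - g b| <= c * (K * (b - a) + e).
  rewrite -{1}(gtr0_norm c0) -normrM.
  have -> : c * (g a - g b) = (X - Y) - ((X - c * g a) - (Y - c * g b)) by ring.
  apply: le_trans (ler_normB _ _) _.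
  have h1 := ler_normB (X - c * g a) (Y - c * g b).
  have h2 : K * r <= e / 4.
    apply: (@le_trans _ _ ((K + 1) * (e / (4 * (K + 1))))).
      by apply: ler_pM => //; [exact: ltW|lra].
    by rewrite le_eqVlt; apply/orP; left; apply/eqP; field; rewrite gt_eqF//; have := K0; lra.
  have h3 : K * r * c <= e / 4 * c by rewrite ler_wpM2r// ltW.
  have -> : c * (K * (b - a) + e) = K * c * (b - a + 2 * r) + (e * c - 2 * (K * r * c)) by ring.
  apply: lerD => //; apply: le_trans h1 _; lra.
by rewrite ler_pM2l.
Qed.

Lemma weak_lipschitz a b : A <= a <= B -> A <= b <= B -> `|g a - g b| <= K * `|a - b|.
Proof.
move=> aAB bAB.
have near_int z r : A <= z <= B -> 0 < r -> exists2 x, A < x < B & `|x - z| <= r.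
  move=> /andP[Az zB] r0; pose s := Num.min (1 / 2) (r / (B - A)).
  have BA : 0 < B - A by rewrite subr_gt0.
  have s0 : 0 < s by rewrite /s lt_min !divr_gt0.
  have s1 : s <= 1 / 2 by rewrite /s ge_min lexx.
  have sr : s * (B - A) <= r by rewrite -ler_pdivlMr// /s ge_min lexx orbT.
  exists (z + s * ((A + B) / 2 - z)); first by apply/andP; split; nra.
  by rewrite addrAC subrr add0r ler_norml; apply/andP; split; nra.
have int2 x y : A < x < B -> A < y < B -> `|g x - g y| <= K * `|x - y|.
  move=> /andP[Ax xB] /andP[Ay yB]; have [xy|xy|->] := ltgtP x y.
  - by rewrite (distrC x) (gtr0_norm (_ : 0 < y - x)) ?subr_gt0//; exact: weak_lipschitz_interior.
  - by rewrite distrC (gtr0_norm (_ : 0 < x - y)) ?subr_gt0//; exact: weak_lipschitz_interior.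
  - by rewrite !subrr normr0 mulr0.
apply/ler_addgt0Pr => e e0.
have e4 : 0 < e / 4 by rewrite divr_gt0.
have [d1 d10 H1] := within_continuousP gc aAB e4.
have [d2 d20 H2] := within_continuousP gc bAB e4.
have K1 : 0 < 4 * (K + 1) by have := K0; lra.
pose r := Num.min (Num.min d1 d2) (e / (4 * (K + 1))).
have r0 : 0 < r by rewrite /r !lt_min d10 d20 divr_gt0.
have [rd1 rd2 re] : [/\ r <= d1, r <= d2 & r <= e / (4 * (K + 1))].
  by split; rewrite /r !ge_min lexx ?orbT.
have [x xAB xa] := near_int a r aAB r0; have [y yAB yb] := near_int b r bAB r0.
have x' : A <= x <= B by case/andP: xAB => *; rewrite !ltW.
have y' : A <= y <= B by case/andP: yAB => *; rewrite !ltW.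
have h1 := H1 x x' (le_trans xa rd1); have h2 := H2 y y' (le_trans yb rd2).
have h3 := int2 x y xAB yAB.
have h4 : `|x - y| <= `|a - b| + 2 * r.
  have -> : x - y = (a - b) + ((x - a) - (y - b)) by ring.
  apply: le_trans (ler_normD _ _) _; apply: lerD => //.
  apply: le_trans (ler_normB _ _) _; lra.
have h5 : K * r <= e / 4.
  apply: (@le_trans _ _ ((K + 1) * (e / (4 * (K + 1))))).
    by apply: ler_pM => //; [exact: ltW|lra].
  by rewrite le_eqVlt; apply/orP; left; apply/eqP; field; rewrite gt_eqF//; have := K0; lra.
have h6 := ler_wpM2l K0 h4; rewrite mulrDr mulrCA in h6.
have -> : g a - g b = (g x - g y) - ((g x - g a) - (g y - g b)) by ring.
apply: le_trans (ler_normB _ _) _; have := ler_normB (g x - g a) (g y - g b); lra.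
Qed.

End WeakLipschitz.

(** * Passage to the limit in the scheme *)

(** The form in which weak times strong limits are used: the limit of the
sums of c dv is the integral over Omega R i of any representative D of C V',
unfolded to the side i of the interface. *)
Lemma stieltjes_side (R : realType) (i : 'I_2) (v c : nat -> nat -> R) (K B : R)
    (V C D : R -> R) :
  (forall n j, (j < n.+1)%N -> `|v n j.+1 - v n j| <= K / n.+1%:R) ->
  (forall n j, (j <= n.+1)%N -> `|v n j| <= B) ->
  (forall n j, (j <= n.+1)%N -> `|c n j| <= B) ->
  (forall e : R, 0 < e -> exists2 d : R, 0 < d & exists N0 : nat,
    forall n j k, (N0 <= n)%N -> (j <= k)%N -> (k <= n.+1)%N ->
    (k - j)%:R / n.+1%:R <= d -> `|c n k - c n j| <= e) ->
  (forall y : R, 0 < y < 1 -> (fun n => v n (idx n y)) @ Unat --> V y) ->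
  (forall y : R, 0 < y < 1 -> (fun n => c n (idx n y)) @ Unat --> C y) ->
  measurable_fun (Omega R i) D ->
  {ae leb R, forall x : R, Omega R i x -> forall d : R, is_derive (sgn R i * x) 1 V d ->
     D x = C (sgn R i * x) * d} ->
  (leb R).-integrable (Omega R i) (EFin \o D) /\
  (fun n => \sum_(j < n.+1) (v n j.+1 - v n j) * c n j) @ Unat -->
    \int[leb R]_(x in Omega R i) D x.
Proof.
move=> vK vB cB c_equi HV HC mD DE.
pose V' (x : R) := ulim (fun n => v n (idx n x)).
pose C' (x : R) := ulim (fun n => c n (idx n x)).
have VE (x : R) : 0 < x < 1 -> V' x = V x by move=> x1; apply: ulimE; exact: HV.
have CE (x : R) : 0 < x < 1 -> C' x = C x by move=> x1; apply: ulimE; exact: HC.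
have K0 : 0 <= K.
  have := le_trans (normr_ge0 _) (vK 0%N 0%N isT); by rewrite divr1.
have oV (x : R) : 0 < x < 1 -> \forall z \near x, V' z = V z.
  move=> /andP[x0 x1]; near=> z; apply: VE; apply/andP; split.
    by near: z; exact: lt_nbhsr.
  by near: z; exact: lt_nbhsl.
have [|||||iD DI] := @side_integral R i V' (stieltjes_lim v c) C D K (K * B).
- by move=> x y; exact: (grid_lim_lip vK vB).
- by move=> x y; exact: (stieltjes_lim_lip vK vB cB).
- move=> x d x01 dV; rewrite -CE//.
  apply: is_derive_approx dV _ => e e0.
  have eK : 0 < e / (K + 1) by rewrite divr_gt0// ltr_wpDl.
  have [r r0 H] := stieltjes_lim_approx vK vB cB c_equi eK.
  have Ke : K * (e / (K + 1)) <= e.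
    rewrite mulrA ler_pdivrMr ?ltr_wpDl//; nra.
  have /andP[x0 x1] := x01.
  have bound (h : R) : K * (e / (K + 1)) * `|h| <= e * `|h| by rewrite ler_wpM2r.
  near=> h.
  have hr : `|h| <= r by near: h; exact: near0_le.
  have hx : `|h| <= x by near: h; exact: near0_le.
  have hx1 : `|h| <= 1 - x.
    by near: h; apply: near0_le; rewrite subr_gt0.
  apply: le_trans _ (bound h).
  have [h0|h0] := leP 0 h.
    rewrite (ger0_norm h0) in hr hx hx1 *.
    by have := H x (h + x) x; rewrite addrK; apply => //; lra.
  rewrite (ltr0_norm h0) in hr hx hx1 *.
  have := H (h + x) x x; rewrite (_ : x - (h + x) = - h); last by ring.
  move=> Hh.
  have -> : stieltjes_lim v c (h + x) - stieltjes_lim v c x - C' x * (V' (h + x) - V' x) =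
     - (stieltjes_lim v c x - stieltjes_lim v c (h + x) - C' x * (V' x - V' (h + x))) by ring.
  rewrite normrN.
  by apply: Hh; clear -h0 hr hx hx1 x0 x1; lra.
- exact: mD.
- apply: ae_mono DE _ => x Dx Ox d dV.
  have x01 : 0 < sgn R i * x < 1 by rewrite -sgn_omega; move: Ox; rewrite /Omega/= in_itv.
  apply: (Dx Ox); apply: near_eq_is_derive dV; exact: oV.
split=> //; rewrite DI stieltjes_lim0 subr0; exact: (stieltjes_lim1 vK vB cB).
Unshelve. all: by end_near. Qed.

Lemma side_measurable (R : realType) (i : 'I_2) (f : R -> R) :
  (forall e, 0 < e -> exists2 d, 0 < d & forall x y, 0 <= x <= 1 -> 0 <= y <= 1 ->
    `|x - y| <= d -> `|f x - f y| <= e) ->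
  measurable_fun (Omega R i) (fun x => f (sgn R i * x)).
Proof.
move=> fc; apply: (@eq_measurable_fun _ _ _ _ _ (fun x => f (clamp 0 1 (sgn R i * x)))).
  move=> x; rewrite inE /Omega/= in_itv/= sgn_omega => /andP[x0 x1].
  by rewrite clamp_id// !ltW.
apply: measurable_funTS; apply: continuous_measurable_fun => x.
apply/cvgrPdist_le => e e0; have [d d0 H] := fc _ e0.
apply/nbhs_ballP; exists d => // y; rewrite /ball/= => xy.
apply: H; try exact: clamp_itv.
apply: le_trans (clamp_lip _ _ _) _ => //.
by rewrite -mulrBr normrM sgn_norm mul1r ltW.
Qed.

Lemma Unat_inv_cvg (R : realType) (a : nat -> R) (l M : R) :
  (forall n, `|a n - l| <= M / n.+1%:R) -> a @ Unat --> l.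
Proof.
move=> aM; apply/cvgrPdist_le => e e0.
have M0 : 0 <= M by have := le_trans (normr_ge0 _) (aM 0%N); rewrite divr1.
have e1 : 0 < e / (M + 1) by rewrite divr_gt0// ltr_wpDl.
have [N1 _ N1P] := @near_infty_natSinv_lt R (PosNum e1).
apply: (@Unat_ge _ N1) => n /N1P /= /ltW h.
rewrite distrC; apply: le_trans (aM n) _.
apply: (@le_trans _ _ ((M + 1) * (e / (M + 1)))).
  by apply: ler_pM => //; rewrite ?invr_ge0// lerDl.
by rewrite mulrC divfK// gt_eqF// ltr_wpDl.
Qed.

(** Test functions on the two sides, with bounds that one constant controls.
The interval [0, 2] leaves room for the differences at the last node. *)
Record test_bound (R : realType) (C : R) (g g1 : 'I_2 -> R -> R) : Prop := TestBound {
  tb_interface : forall i, g i 0 = g ord0 0;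
  tb_bound : forall i x, 0 <= x <= 2 -> `|g i x| <= C;
  tb_bound1 : forall i x, 0 <= x <= 2 -> `|g1 i x| <= C;
  tb_lip : forall i x y, 0 <= x <= 2 -> 0 <= y <= 2 -> `|g i x - g i y| <= C * `|x - y|;
  tb_lip1 : forall i x y, 0 <= x <= 2 -> 0 <= y <= 2 -> `|g1 i x - g1 i y| <= C * `|x - y|;
  tb_taylor : forall i x y, 0 <= x <= 2 -> 0 <= y <= 2 ->
    `|g i y - g i x - g1 i x * (y - x)| <= C * (y - x) ^+ 2
}.

Definition mass_of (R : realType) (rk : 'I_2 -> rock R) (g V : 'I_2 -> R -> R) : R :=
  \sum_(i < 2) \int[leb R]_(x in Omega R i)
    (porosity (rk i) * V i (sgn R i * x) * g i (sgn R i * x)).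

(** D represents the x-derivative of the Kirchhoff value of V on the side i of
the interface, in the form that side_integral asks for. *)
Definition space_derivative (R : realType) (rk : rock R) (i : 'I_2) (V D : R -> R) : Prop :=
  measurable_fun (Omega R i) D /\
  {ae leb R, forall x : R, Omega R i x -> forall d : R,
     is_derive x (1 : R) (fun z => kirchhoff rk (V (sgn R i * z))) d -> D x = d}.

Section Limit.
Context (R : realType) (rk : 'I_2 -> rock R) (L pm : R) (U0 : 'I_2 -> R -> R) (K : R).
Let por i := porosity (rk i).
Let kf i := kirchhoff (rk i).
Hypothesis pm0 : 0 < pm.
Hypothesis por_pm : forall i, pm <= por i.
Hypothesis L0 : 0 <= L.
Hypothesis kf_incr : forall i s t, 0 <= s -> s <= t -> t <= 1 ->
  0 <= kf i t - kf i s <= L * (t - s).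
Hypothesis U0_itv : forall i y, 0 <= U0 i y <= 1.
Hypothesis U0_lip : forall i x y, 0 <= x <= 1 -> 0 <= y <= 1 ->
  `|kf i (U0 i x) - kf i (U0 i y)| <= K * `|x - y|.
Hypothesis U0_interface : exists q, forall i, U0 i 0 = sat (rk i) q.

Let kf_0 i : kf i 0 = 0.
Proof. exact: kirchhoff0. Qed.

Let kf_inv e : 0 < e -> exists2 d, 0 < d & forall i s t,
  0 <= s <= 1 -> 0 <= t <= 1 -> `|kf i s - kf i t| <= d -> `|s - t| <= e.
Proof.
move=> e0; have [d0 d00 H0] := kirchhoff_inv (rk ord0) e0.
have [d1 d10 H1] := kirchhoff_inv (rk ord_max) e0.
exists (Num.min d0 d1); first by rewrite lt_min d00.
move=> i s t s1 t1; rewrite le_min => /andP[h0 h1].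
by elim/I2_cases: i h0 h1 => h0 h1; [exact: H0|exact: H1].
Qed.

Let K0 : 0 <= K.
Proof.
have := U0_lip ord0 (introT andP (conj (lexx 0) ler01)) (introT andP (conj ler01 (lexx 1))).
by move=> /(le_trans (normr_ge0 _)); rewrite sub0r normrN1 mulr1.
Qed.

Let N (n : nat) : R := n.+1%:R.
Let N_gt0 n : 0 < N n. Proof. by rewrite ltr0n. Qed.

(** The largest time step allowed by the CFL condition on the grid with
n.+1 cells, up to a constant; L + 1 avoids a division by 0. *)
Definition time_step n : R := pm / (2 * (L + 1)) / (N n * N n).
(** The scheme runs over all natural indices; the projection keeps the points
beyond the last node harmless. *)
Definition start n (i : 'I_2) (j : nat) : R := U0 i (clamp 0 1 (j%:R / N n)).
Definition approx n m := sol por kf (ktrace rk) n.+1 (time_step n) (start n) m.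
Definition approx_at n (t : R) := approx n (Num.truncn (t / time_step n)).

Let L1 : 0 < L + 1. Proof. by rewrite ltr_wpDl. Qed.

Let tau_gt0 n : 0 < time_step n.
Proof. by rewrite !divr_gt0// ?mulr_gt0. Qed.

Lemma time_step_cfl n : cfl L pm n.+1 (time_step n).
Proof.
split; first exact: ltW.
rewrite /time_step -/(N n) (_ : _ * 2 = pm * (L / (L + 1))).
  by rewrite -[leRHS]mulr1 ler_wpM2l ?(ltW pm0)// ler_pdivrMr// mul1r; lra.
by field; rewrite !gt_eqF//; have := L1; lra.
Qed.

Lemma start_range n : in_range (start n).
Proof. by move=> i j; exact: U0_itv. Qed.

Let Vtot := \sum_(i < 2) kf i 1.

Lemma trace_of_sat (u : 'I_2 -> nat -> R) q : in_range u ->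
  (forall i, u i 0%N = sat (rk i) q) ->
  forall i, ktrace rk i (total kf u) = kf i (u i 0%N).
Proof.
move=> ru uq i; rewrite uq /ktrace.
have tot := total_itv kf_0 kf_incr ru.
apply: Phi_sum_inj; have [_ ->] := interface_pressureP tot.
by apply: eq_bigr => k _; rewrite uq.
Qed.

Lemma node_itv n j : (j <= n.+1)%N -> 0 <= j%:R / N n <= 1.
Proof.
by move=> jn; rewrite divr_ge0//= ?(ltW (N_gt0 n))// ler_pdivrMr// mul1r ler_nat.
Qed.

(** At the interface the flux of the initial data vanishes: this is where
the compatibility of the initial traces enters. Without it the bound on the
fluxes would blow up as the grid is refined. *)
Lemma start_flux n : flux_le kf (ktrace rk) K n.+1 (start n).
Proof.
move=> i [|j]; rewrite /flux /=.
  have [q Hq] := U0_interface.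
  rewrite (@trace_of_sat _ q) ?subrr ?mulr0 ?normr0//; first exact: start_range.
  by move=> k; rewrite /start mul0r clamp_id// lexx ler01.
case: ifPn => [jn|_]; last by rewrite normr0.
have a1 := node_itv jn; have a0 := node_itv (ltnW jn).
rewrite normrM (gtr0_norm (N_gt0 n)) /start (clamp_id a1) (clamp_id a0).
rewrite [leLHS]mulrC -ler_pdivlMr//; apply: le_trans (U0_lip i a1 a0) _.
by rewrite -mulrBl -natrB// subSnn mul1r ger0_norm// invr_ge0 ltW.
Qed.

Let tr_itv i c : 0 <= c <= Vtot -> 0 <= ktrace rk i c <= kf i 1.
Proof. by move=> _; exact: Phi_itv. Qed.

Lemma approx_range n m : in_range (approx n m).
Proof.
apply: (sol_range pm0 por_pm kf_0 kf_incr tr_itv); first exact: time_step_cfl.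
exact: start_range.
Qed.

Lemma approx_space n m i j k : (j <= k)%N -> (k <= n.+1)%N ->
  `|kf i (approx n m i k) - kf i (approx n m i j)| <= K * (k - j)%:R / N n.
Proof.
apply: (sol_space pm0 por_pm L0 kf_0 kf_incr (@ktrace_sum _ rk) (@ktrace_incr _ rk) tr_itv) => //.
- exact: time_step_cfl.
- exact: start_range.
- exact: start_flux.
Qed.

Lemma approx_flux n m : flux_le kf (ktrace rk) K n.+1 (approx n m).
Proof.
apply: (sol_flux pm0 por_pm L0 kf_0 kf_incr (@ktrace_sum _ rk) (@ktrace_incr _ rk) tr_itv) => //.
- exact: time_step_cfl.
- exact: start_range.
- exact: start_flux.
Qed.

Lemma approx_flux0 n m : \sum_(i < 2) flux kf (ktrace rk) n.+1 (approx n m) i 0 = 0.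
Proof.
rewrite (sum_I2 _ ord0).
by rewrite (flux0_opp kf_0 kf_incr (@ktrace_sum _ rk) _ _ (@approx_range n m)) subrr.
Qed.

Lemma approx_modulus e : 0 < e -> exists2 d, 0 < d & exists N0 : nat,
  forall n i j m m', (N0 <= n)%N -> (j <= n.+1)%N ->
  time_step n * `|m%:R - m'%:R| <= d -> `|approx n m i j - approx n m' i j| <= e.
Proof.
move=> e0.
have [d d0 [N0 H]] := sol_time_modulus pm0 por_pm L0 kf_0 kf_incr (@ktrace_sum _ rk)
  (@ktrace_incr _ rk) tr_itv kf_inv K0 e0.
exists d => //; exists N0 => n i j m m' nN jn h; apply: H => //.
- exact: leq_trans nN _.
- exact: time_step_cfl.
- exact: start_range.
- exact: start_flux.
Qed.

Lemma time_step_small d : 0 < d -> exists N0 : nat, forall n, (N0 <= n)%N -> time_step n <= d.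
Proof.
move=> d0; pose c := pm / (2 * (L + 1)).
have c0 : 0 < c by rewrite divr_gt0// mulr_gt0.
have dc : 0 < d / c by rewrite divr_gt0.
have [N1 _ N1P] := @near_infty_natSinv_lt R (PosNum dc).
exists N1 => n /N1P /= /ltW h; rewrite /time_step -/c.
have i1 : (N n)^-1 <= 1 by rewrite invf_le1// ler1n.
apply: (@le_trans _ _ (c / N n)); last by rewrite mulrC -ler_pdivlMr.
rewrite invfM mulrA ler_piMr//; first by rewrite divr_ge0// ltW.
Qed.

Lemma truncn_dist (a b : R) : `|(Num.truncn a)%:R - (Num.truncn b)%:R| <= `|a - b| + 1.
Proof.
wlog ab : a b / a <= b => [h|].
  have [/h//|/ltW/h] := leP a b.
  by rewrite distrC => /le_trans; apply; rewrite distrC.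
have tab : (Num.truncn a <= Num.truncn b)%N by exact: le_truncn.
rewrite distrC ger0_norm ?subr_ge0 ?ler_nat// distrC ger0_norm ?subr_ge0//.
have [b0|b0] := leP 0 b; last first.
  have tz (z : R) : z < 0 -> Num.truncn z = 0%N.
    by move=> z0; apply/truncn0Pn; rewrite -ltNge; lra.
  by rewrite !tz//; lra.
have /andP[b1 _] := truncn_itv b0.
have [a0|a0] := leP 0 a.
  by have /andP[_] := truncn_itv a0; rewrite -natr1; lra.
have := ler0n R (Num.truncn a); lra.
Qed.

Lemma step_index_dist n s t :
  time_step n * `|(Num.truncn (s / time_step n))%:R - (Num.truncn (t / time_step n))%:R|
   <= `|s - t| + time_step n.
Proof.
have := truncn_dist (s / time_step n) (t / time_step n).
rewrite -mulrBl normrM normfV (gtr0_norm (tau_gt0 n)).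
rewrite -(ler_pM2l (tau_gt0 n)) mulrDr mulr1 mulrCA divff ?mulr1// gt_eqF//.
Qed.

Lemma time_step_cvg : time_step @ Unat --> 0.
Proof.
apply: (@Unat_inv_cvg _ _ _ (pm / (2 * (L + 1)))) => n.
rewrite subr0 gtr0_norm// /time_step.
have c0 : 0 < pm / (2 * (L + 1)) by rewrite divr_gt0// mulr_gt0.
move: (pm / _) c0 => c c0; rewrite -/(N n) invfM mulrA ler_piMr//.
  by rewrite divr_ge0// ltW.
by rewrite invf_le1// ler1n.
Qed.

Lemma step_index_cvg t : 0 <= t ->
  (fun n => time_step n * (Num.truncn (t / time_step n))%:R) @ Unat --> t.
Proof.
move=> t0; apply/cvgrPdist_le => e e0; have [N1 H1] := time_step_small e0.
apply: (@Unat_ge _ N1) => n /H1 h; apply: le_trans h.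
have /andP[] := truncn_itv (divr_ge0 t0 (ltW (tau_gt0 n))).
rewrite ler_pdivlMr// ltr_pdivrMr// -natr1 => h1 h2.
by rewrite mulrC ger0_norm ?subr_ge0// lerBlDl; apply: ltW; rewrite mulrDl mul1r in h2.
Qed.

Lemma kf_diff i a b : 0 <= a <= 1 -> 0 <= b <= 1 -> `|kf i a - kf i b| <= L * `|a - b|.
Proof.
wlog ab : a b / b <= a => [h|].
  have [/h//|/ltW/h ba] := leP b a => a1 b1.
  by rewrite distrC (distrC a); exact: ba.
move=> /andP[a0 a1] /andP[b0 b1]; have /andP[h1 h2] := kf_incr i b0 ab a1.
by rewrite !ger0_norm// subr_ge0.
Qed.

(** The saturation at distance y from the interface at time t. *)
Definition profile (i : 'I_2) (y t : R) : R := ulim (fun n => approx_at n t i (idx n y)).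

Lemma profile_cvg i y t : (fun n => approx_at n t i (idx n y)) @ Unat --> profile i y t.
Proof.
apply: (@ulim_cvg _ _ 1) => n; have /andP[h0 h1] := approx_range n (Num.truncn (t / time_step n)) i (idx n y).
by rewrite ger0_norm.
Qed.

Lemma kprofile_cvg i y t : (fun n => kf i (approx_at n t i (idx n y))) @ Unat --> kf i (profile i y t).
Proof. exact: (cvg_comp _ _ (@profile_cvg i y t) (@kirchhoff_continuous _ _ _)). Qed.

Lemma profile_itv i y t : 0 <= profile i y t <= 1.
Proof.
apply/andP; split.
  apply: (@Unat_le _ (fun=> 0) _ _ _ _ (@profile_cvg i y t)); first exact: cvg_cst.
  by apply: (@filterE _ Unat) => n; have /andP[] := approx_range n (Num.truncn (t / time_step n)) i (idx n y).
apply: (@Unat_le _ _ (fun=> 1) _ _ (@profile_cvg i y t)); first exact: cvg_cst.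
by apply: (@filterE _ Unat) => n; have /andP[] := approx_range n (Num.truncn (t / time_step n)) i (idx n y).
Qed.

Lemma kf_bound i s : 0 <= s <= 1 -> `|kf i s| <= kf i 1.
Proof. by move=> /(kf_itv kf_0 kf_incr i)/andP[h0 h1]; rewrite ger0_norm. Qed.

Lemma kprofile_lip i t x y : 0 <= x <= 1 -> 0 <= y <= 1 ->
  `|kf i (profile i x t) - kf i (profile i y t)| <= K * `|x - y|.
Proof.
move=> x01 y01; have := @grid_lim_lip R (fun n j => kf i (approx_at n t i j)) K (kf i 1).
move=> /(_ _ _ x y x01 y01) /=.
rewrite (ulimE (@kprofile_cvg i x t)) (ulimE (@kprofile_cvg i y t)); apply.
- move=> n j jn; apply: le_trans (approx_space _ _ (leqnSn j) jn) _.
  by rewrite subSnn mulr1.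
- by move=> n j jn; apply: kf_bound; exact: approx_range.
Qed.

Lemma profile_space e : 0 < e -> exists2 d, 0 < d & forall i x y t,
  0 <= x <= 1 -> 0 <= y <= 1 -> `|x - y| <= d -> `|profile i x t - profile i y t| <= e.
Proof.
move=> e0; have [d d0 H] := kf_inv e0; have K1 : 0 < K + 1 by rewrite ltr_wpDl.
exists (d / (K + 1)); first by rewrite divr_gt0.
move=> i x y t x01 y01 xy; apply: (H i); try exact: profile_itv.
apply: le_trans (kprofile_lip i t x01 y01) _.
apply: (@le_trans _ _ ((K + 1) * `|x - y|)); first by rewrite ler_wpM2r// lerDl.
by rewrite mulrC -ler_pdivlMr.
Qed.

Lemma profile_time e : 0 < e -> exists2 d, 0 < d & forall i y s t,
  0 <= y <= 1 -> `|s - t| <= d -> `|profile i y s - profile i y t| <= e.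
Proof.
move=> e0; have [d d0 [N0 H]] := approx_modulus e0.
have d2 : 0 < d / 2 by rewrite divr_gt0.
have [N1 H1] := time_step_small d2.
exists (d / 2) => // i y s t /andP[y0 y1] st.
have SC : (fun n => approx_at n s i (idx n y) - approx_at n t i (idx n y)) @ Unat -->
   profile i y s - profile i y t by apply: cvgB; exact: profile_cvg.
apply: (Unat_norm_le SC).
apply: (@Unat_ge _ (maxn N0 N1)) => n; rewrite geq_max => /andP[n0 n1].
apply: H => //; first exact: idx_le.
apply: le_trans (step_index_dist n s t) _; have := H1 n n1; lra.
Qed.

Lemma profile_start i y : 0 <= y <= 1 -> profile i y 0 = U0 i y.
Proof.
move=> y01; have /andP[y0 y1] := y01.
apply: (kirchhoff_inj (rk := rk i)); rewrite ?profile_itv ?U0_itv//.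
apply: (cvg_unique _ (@kprofile_cvg i y 0)); first exact: Rhausdorff.
apply/cvgrPdist_le => e e0; have K1 : 0 < K + 1 by rewrite ltr_wpDl.
have e1 : 0 < e / (K + 1) by rewrite divr_gt0.
have [N1 _ N1P] := @near_infty_natSinv_lt R (PosNum e1).
apply: (@Unat_ge _ N1) => n /N1P /= /ltW h.
have E : approx_at n 0 i (idx n y) = U0 i ((idx n y)%:R / N n).
  rewrite /approx_at mul0r truncn0 /approx /sol/= /start clamp_id//.
  by apply: node_itv; exact: idx_le.
rewrite E; apply: le_trans (U0_lip i y01 (node_itv (idx_le n y0 y1))) _.
have /andP[i0 i1] := idx_itv n y0.
have d1 : `|y - (idx n y)%:R / N n| <= e / (K + 1).
  by rewrite ger0_norm ?subr_ge0//; move: i1 h; rewrite /N; move: (_ / _) (_^-1) (_ / _) => a b c *; lra.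
apply: (@le_trans _ _ ((K + 1) * (e / (K + 1)))).
  by apply: ler_pM => //; rewrite lerDl.
by rewrite mulrC divfK// gt_eqF.
Qed.

(** The interface pressures stay in a bounded set, so they converge; the
first cell differs from the interface value by a flux divided by the number of
cells, which tends to 0. *)
Lemma profile_interface t : exists q, forall i, profile i 0 t = sat (rk i) q.
Proof.
pose qn n := interface_pressure rk (total kf (approx_at n t)).
have qB n : `|qn n| <= `|pmin rk| + `|pmax rk|.
  have [/andP[h1 h2] _] := interface_pressureP (total_itv kf_0 kf_incr (approx_range n (Num.truncn (t / time_step n)))).
  rewrite ler_norml; apply/andP; split.
    by apply: le_trans h1; have := ler_norm (- pmin rk); have := normr_ge0 (pmax rk); rewrite normrN; lra.
  by apply: le_trans h2 _; have := ler_norm (pmax rk); have := normr_ge0 (pmin rk); lra.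
have qc := ulim_cvg qB; exists (ulim qn) => i.
apply: (kirchhoff_inj (rk := rk i)); rewrite ?profile_itv ?sat_itv//.
have Pc : (fun n => Phi rk i (qn n)) @ Unat --> Phi rk i (ulim qn).
  exact: (cvg_comp _ _ qc (@Phi_continuous _ _ _ _)).
have Kc := @kprofile_cvg i 0 t.
apply/eqP; rewrite -subr_eq0 -normr_le0.
have K0c : (fun n => K * (N n)^-1) @ Unat --> K * 0.
  by apply: cvgM; [exact: cvg_cst|exact: inv_cvg0].
rewrite mulr0 in K0c.
have SC : (fun n => `|kf i (approx_at n t i (idx n (0 : R))) - Phi rk i (qn n)|) @ Unat -->
   `|kf i (profile i 0 t) - Phi rk i (ulim qn)|.
  exact: (cvg_norm (cvgB Kc Pc)).
apply: (Unat_le SC K0c).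
apply: (@filterE _ Unat) => n; rewrite /= idx0.
have := approx_flux n (Num.truncn (t / time_step n)) i 0%N.
move=> F; rewrite /flux/= normrM (gtr0_norm (N_gt0 n)) [leLHS]mulrC -ler_pdivlMr// in F.
Qed.

Section Test.
Context (C : R) (g g1 : 'I_2 -> R -> R).
Hypothesis tb : test_bound C g g1.

Let C0 : 0 <= C.
Proof.
apply: le_trans (normr_ge0 _) (tb_bound tb ord0 (x := 0) _).
by rewrite lexx ler0n.
Qed.

Definition sample n (i : 'I_2) (j : nat) : R := g i (j%:R / N n).

Let slope n i j : R := N n * (sample n i j.+1 - sample n i j).

Let node2 n j : (j <= n.+2)%N -> 0 <= j%:R / N n <= 2.
Proof.
move=> jn; rewrite divr_ge0//= ?(ltW (N_gt0 n))// ler_pdivrMr// -natrM ler_nat; lia.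
Qed.

Let node_diff n j : j.+1%:R / N n - j%:R / N n = (N n)^-1.
Proof. by rewrite -mulrBl -natrB// subSnn mul1r. Qed.

(** The difference quotients of g between two nodes are compared with g1 at
either node, which bounds the second differences without second derivatives. *)
Let slope_left n i j : (j <= n.+1)%N -> `|slope n i j - g1 i (j%:R / N n)| <= C / N n.
Proof.
move=> jn; have := tb_taylor tb i (node2 (leqW jn)) (node2 (jn : (j.+1 <= n.+2)%N)).
rewrite node_diff => h.
have -> : slope n i j - g1 i (j%:R / N n) = N n *
   (g i (j.+1%:R / N n) - g i (j%:R / N n) - g1 i (j%:R / N n) * (N n)^-1).
  by rewrite /slope /sample; field; rewrite gt_eqF.
rewrite normrM (gtr0_norm (N_gt0 n)) [leLHS]mulrC -ler_pdivlMr//.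
by apply: le_trans h _; rewrite expr2 mulrA.
Qed.

Let slope_right n i j : (j <= n.+1)%N -> `|slope n i j - g1 i (j.+1%:R / N n)| <= C / N n.
Proof.
move=> jn; have := tb_taylor tb i (node2 (jn : (j.+1 <= n.+2)%N)) (node2 (leqW jn)).
rewrite -(opprB (j.+1%:R / N n)) node_diff sqrrN => h.
have -> : slope n i j - g1 i (j.+1%:R / N n) = - (N n *
   (g i (j%:R / N n) - g i (j.+1%:R / N n) - g1 i (j.+1%:R / N n) * - (N n)^-1)).
  by rewrite /slope /sample; field; rewrite gt_eqF.
rewrite normrN normrM (gtr0_norm (N_gt0 n)) [leLHS]mulrC -ler_pdivlMr//.
by apply: le_trans h _; rewrite expr2 mulrA.
Qed.

Let slope_le n i j : (j <= n.+1)%N -> `|slope n i j| <= C.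
Proof.
move=> jn; have := tb_lip tb i (node2 (jn : (j.+1 <= n.+2)%N)) (node2 (leqW jn)).
rewrite node_diff => h; rewrite /slope /sample normrM (gtr0_norm (N_gt0 n)).
rewrite [leLHS]mulrC -ler_pdivlMr//; apply: le_trans h _.
by rewrite ger0_norm// invr_ge0 ltW.
Qed.

Let slope_diff n i j : (j < n.+1)%N -> `|slope n i j.+1 - slope n i j| <= 2 * C / N n.
Proof.
move=> jn; have h1 := slope_left i jn; have h2 := slope_right i (ltnW jn).
rewrite (_ : _ - slope n i j = (slope n i j.+1 - g1 i (j.+1%:R / N n)) -
  (slope n i j - g1 i (j.+1%:R / N n))); last by ring.
rewrite (_ : 2 * C / N n = C / N n + C / N n); last by ring.
by apply: le_trans (ler_normB _ _) _; exact: lerD.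
Qed.

Let mass_at t : R := mass_of rk g (fun i y => profile i y t).

Let por_itv i : 0 < por i < 1. Proof. exact: porosity_itv. Qed.

Let in02 (x : R) : 0 <= x <= 1 -> 0 <= x <= 2.
Proof. by move=> /andP[-> h]/=; apply: le_trans h _; rewrite ler1n. Qed.

Let profile_measurable i t : measurable_fun (Omega R i) (fun x => profile i (sgn R i * x) t).
Proof.
apply: (@side_measurable R i (fun y => profile i y t)) => e e0.
have [d d0 H] := profile_space e0; by exists d => // x y x1 y1; exact: H.
Qed.

Let lip_measurable i (h : R -> R) : (forall x y, 0 <= x <= 2 -> 0 <= y <= 2 ->
  `|h x - h y| <= C * `|x - y|) -> measurable_fun (Omega R i) (fun x => h (sgn R i * x)).
Proof.
move=> hL; apply: side_measurable => e e0; have C1 : 0 < C + 1 by rewrite ltr_wpDl.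
exists (e / (C + 1)); first by rewrite divr_gt0.
move=> x y /in02 x2 /in02 y2 xy; apply: le_trans (hL _ _ x2 y2) _.
apply: (@le_trans _ _ ((C + 1) * `|x - y|)); first by rewrite ler_wpM2r// lerDl.
by rewrite mulrC -ler_pdivlMr.
Qed.

(** The mass is a Stieltjes sum with respect to v n j = j / N. *)
Lemma mass_cvg t :
  (fun n => mass por n.+1 (sample n) (approx_at n t)) @ Unat --> mass_at t.
Proof.
pose c i n j := por i * approx_at n t i j * sample n i j.
have ar n i j := approx_range n (Num.truncn (t / time_step n)) i j.
have cB i n j : (j <= n.+1)%N -> `|c i n j| <= C + 1.
  move=> jn; have /andP[p0 p1] := por_itv i; have /andP[a0 a1] := ar n i j.
  rewrite /c !normrM (gtr0_norm p0) (ger0_norm a0).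
  have h := tb_bound tb i (node2 (leqW jn)).
  have pa : por i * approx_at n t i j <= 1 by rewrite mulr_ile1// ltW.
  apply: (@le_trans _ _ (1 * C)); last by rewrite mul1r lerDl.
  by apply: ler_pM => //; rewrite mulr_ge0// ltW.
have sidei i : (leb R).-integrable (Omega R i) (EFin \o (fun x =>
    por i * profile i (sgn R i * x) t * g i (sgn R i * x))) /\
  (fun n => \sum_(j < n.+1) (j.+1%:R / N n - j%:R / N n) * c i n j) @ Unat -->
  \int[leb R]_(x in Omega R i) (por i * profile i (sgn R i * x) t * g i (sgn R i * x)).
  have /andP[p0 p1] := por_itv i.
  apply: (@stieltjes_side R i (fun n j => j%:R / N n) (c i) 1 (C + 1) id
     (fun y => por i * profile i y t * g i y)).
  - by move=> n j jn; rewrite node_diff ger0_norm ?mul1r// invr_ge0 ltW.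
  - move=> n j jn; have /andP[h0 h1] := node_itv jn.
    by rewrite ger0_norm//; apply: le_trans h1 _; rewrite lerDr.
  - exact: cB.
  - move=> e e0; have e2 : 0 < e / (2 * (C + 1)) by rewrite divr_gt0// mulr_gt0// ltr_wpDl.
    have [d d0 H] := kf_inv e2.
    pose r := Num.min (d / (K + 1)) (e / (2 * (C + 1))).
    exists r; first by rewrite /r lt_min e2 divr_gt0// ltr_wpDl.
    exists 0%N => n j k _ jk kn; rewrite /r le_min => /andP[hd he].
    have jn := leq_trans jk kn.
    have u1 : `|approx_at n t i k - approx_at n t i j| <= e / (2 * (C + 1)).
      apply: (H i); try exact: ar.
      apply: le_trans (approx_space _ i jk kn) _; rewrite -mulrA.
      apply: (@le_trans _ _ ((K + 1) * ((k - j)%:R / N n))).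
        by rewrite ler_wpM2r ?lerDl// divr_ge0// ltW.
      by rewrite mulrC -ler_pdivlMr ?ltr_wpDl.
    have g2 : `|sample n i k - sample n i j| <= C * (e / (2 * (C + 1))).
      apply: le_trans (tb_lip tb i (node2 (leqW kn)) (node2 (leqW jn))) _.
      by rewrite ler_wpM2l// -mulrBl -natrB// ger0_norm// divr_ge0// ltW.
    have g3 := tb_bound tb i (node2 (leqW jn)).
    have /andP[a0 a1] := ar n i k.
    rewrite /c (_ : _ - _ = por i * (approx_at n t i k * (sample n i k - sample n i j) +
       (approx_at n t i k - approx_at n t i j) * sample n i j)); last by ring.
    rewrite normrM (gtr0_norm p0).
    have X1 : `|approx_at n t i k * (sample n i k - sample n i j)| <= C * (e / (2 * (C + 1))).
      rewrite normrM (ger0_norm a0); apply: le_trans g2.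
      by rewrite ler_piMl.
    have X2 : `|(approx_at n t i k - approx_at n t i j) * sample n i j| <= e / (2 * (C + 1)) * C.
      by rewrite normrM; exact: ler_pM.
    apply: (@le_trans _ _ (1 * (C * (e / (2 * (C + 1))) + e / (2 * (C + 1)) * C))).
      apply: ler_pM => //; first exact: ltW; first exact: ltW.
      by apply: le_trans (ler_normD _ _) _; exact: lerD.
    rewrite mul1r (_ : _ + _ = e * (C / (C + 1))); last by field; rewrite gt_eqF// ltr_wpDl.
    by rewrite ler_piMr ?(ltW e0)// ler_pdivrMr ?ltr_wpDl// mul1r lerDl.
  - by move=> y /andP[y0 _]; apply: idx_cvg; exact: ltW.
  - move=> y /andP[/ltW y0 /ltW y1]; apply: cvgM.
      by apply: cvgM; [exact: cvg_cst|exact: profile_cvg].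
    apply: (@Unat_inv_cvg _ _ _ C) => n.
    have y01 : 0 <= y <= 1 by rewrite y0.
    apply: le_trans (tb_lip tb i (in02 (node_itv (idx_le n y0 y1))) (in02 y01)) _.
    rewrite ler_wpM2l//; have /andP[h1 h2] := idx_itv n y0.
    rewrite ler0_norm ?subr_le0// opprB lerBlDl; exact: ltW.
  - apply: measurable_funM; last by apply: lip_measurable; exact: (tb_lip tb).
    by apply: measurable_funM => //; exact: profile_measurable.
  - apply: aeW => x _ d dV; have : is_derive (sgn R i * x) (1 : R) (@id R) 1 by exact: is_derive_id.
    by move=> di; rewrite -(@derive_val _ _ _ _ _ _ _ dV) (@derive_val _ _ _ _ _ _ _ di) mulr1.
rewrite /mass_at /mass_of; have -> : (fun n => mass por n.+1 (sample n) (approx_at n t)) =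
  (fun n => \sum_(i < 2) (\sum_(j < n.+1) (j.+1%:R / N n - j%:R / N n) * c i n j +
     c i n n.+1 / N n)).
  apply/funext => n; rewrite /mass; apply: eq_bigr => i _; rewrite big_ord_recr/=.
  congr (_ + _); apply: eq_bigr => j _; rewrite node_diff mulrC.
  by rewrite /c.
have lim i : (fun n => \sum_(j < n.+1) (j.+1%:R / N n - j%:R / N n) * c i n j +
     c i n n.+1 / N n) @ Unat -->
   \int[leb R]_(x in Omega R i) (por i * profile i (sgn R i * x) t * g i (sgn R i * x)).
  rewrite -[X in _ --> X]addr0; apply: cvgD; first by have [] := sidei i.
  apply: (@Unat_inv_cvg _ _ _ (C + 1)) => n; rewrite subr0 normrM.
  rewrite [X in _ * X]ger0_norm ?invr_ge0 ?(ltW (N_gt0 n))// ler_wpM2r ?invr_ge0 ?(ltW (N_gt0 n))//.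
  exact: cB.
rewrite (sum_I2 _ ord0); under eq_fun do rewrite (sum_I2 _ ord0).
by apply: cvgD; exact: lim.
Qed.

(** A Stieltjes sum of difference quotients of g with respect to the
Kirchhoff values. *)
Lemma dual_cvg (D : 'I_2 -> R -> R) t : (forall i, space_derivative (rk i) i (fun y => profile i y t) (D i)) ->
  (fun n => dualflux kf n.+1 (sample n) (approx_at n t)) @ Unat -->
  \sum_(i < 2) \int[leb R]_(x in Omega R i) (D i x * (sgn R i * g1 i (sgn R i * x))).
Proof.
move=> HD.
have ar n i j := approx_range n (Num.truncn (t / time_step n)) i j.
have sidei i : (fun n => \sum_(j < n.+1)
    (kf i (approx_at n t i j.+1) - kf i (approx_at n t i j)) * slope n i j) @ Unat -->
   \int[leb R]_(x in Omega R i) (D i x * (sgn R i * g1 i (sgn R i * x))).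
  have [mD aD] := HD i.
  have k1 : 0 <= kf i 1 by apply: le_trans (kf_bound i (ar 0%N i 0%N)).
  apply: (@proj2 ((leb R).-integrable (Omega R i)
    (EFin \o (fun x => D i x * (sgn R i * g1 i (sgn R i * x)))))).
  apply: (@stieltjes_side R i (fun n j => kf i (approx_at n t i j)) (fun n j => slope n i j)
    K (kf i 1 + C) (fun y => kf i (profile i y t)) (g1 i)
    (fun x => D i x * (sgn R i * g1 i (sgn R i * x)))).
  - move=> n j jn; apply: le_trans (approx_space _ _ (leqnSn j) jn) _.
    by rewrite subSnn mulr1.
  - by move=> n j jn; apply: le_trans (kf_bound i (ar n i j)) _; rewrite lerDl.
  - by move=> n j jn; apply: le_trans (slope_le i jn) _; rewrite lerDr.
  - move=> e e0; have C3 : 0 < 3 * (C + 1) by rewrite mulr_gt0// ltr_wpDl.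
    have e3 : 0 < e / (3 * (C + 1)) by rewrite divr_gt0.
    exists (e / (3 * (C + 1))) => //.
    have [N1 _ N1P] := @near_infty_natSinv_lt R (PosNum e3).
    exists N1 => n j k /N1P/= /ltW h jk kn hd; have jn := leq_trans jk kn.
    have h1 := slope_left i kn; have h2 := slope_left i jn.
    have h3 := tb_lip1 tb i (in02 (node_itv kn)) (in02 (node_itv jn)).
    rewrite -mulrBl -natrB// [X in C * X]ger0_norm ?divr_ge0 ?(ltW (N_gt0 n))// in h3.
    have CN : C / N n <= C * (e / (3 * (C + 1))) by rewrite ler_wpM2l.
    have Cd : C * ((k - j)%:R / N n) <= C * (e / (3 * (C + 1))) by rewrite ler_wpM2l.
    have E : 3 * (C * (e / (3 * (C + 1)))) <= e.
      rewrite (_ : _ * _ = e * (C / (C + 1))); last by field; rewrite gt_eqF// ltr_wpDl.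
      by rewrite ler_piMr ?(ltW e0)// ler_pdivrMr ?ltr_wpDl// mul1r lerDl.
    apply: le_trans E.
    rewrite (_ : slope n i k - slope n i j = (slope n i k - g1 i (k%:R / N n)) -
      (slope n i j - g1 i (j%:R / N n)) + (g1 i (k%:R / N n) - g1 i (j%:R / N n))); last by ring.
    apply: le_trans (ler_normD _ _) _.
    have B1 := ler_normB (slope n i k - g1 i (k%:R / N n)) (slope n i j - g1 i (j%:R / N n)).
    move: h1 h2 h3 CN Cd B1; move: (C * (e / _)) (C / N n) (C * ((k - j)%:R / N n)).
    move: (slope n i k - g1 i (k%:R / N n)) (slope n i j - g1 i (j%:R / N n)) (g1 i (k%:R / N n) - g1 i (j%:R / N n)).
    move=> x y z a b b'; move: (`|x - y|) (`|x|) (`|y|) (`|z|) => *; lra.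
  - by move=> y _; exact: kprofile_cvg.
  - move=> y /andP[/ltW y0 /ltW y1]; apply: (@Unat_inv_cvg _ _ _ (2 * C)) => n.
    have y01 : 0 <= y <= 1 by rewrite y0.
    have h1 := slope_left i (idx_le n y0 y1).
    have h2 := tb_lip1 tb i (in02 (node_itv (idx_le n y0 y1))) (in02 y01).
    have h3 : C * `|(idx n y)%:R / N n - y| <= C / N n.
      rewrite ler_wpM2l//; have /andP[h3 h4] := idx_itv n y0.
      rewrite ler0_norm ?subr_le0// opprB lerBlDl; exact: ltW.
    rewrite (_ : slope n i (idx n y) - g1 i y = (slope n i (idx n y) - g1 i ((idx n y)%:R / N n)) +
      (g1 i ((idx n y)%:R / N n) - g1 i y)); last by ring.
    apply: le_trans (ler_normD _ _) _.
    rewrite (_ : 2 * C / _ = C / N n + C / N n); last by rewrite /N; ring.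
    by apply: lerD => //; exact: le_trans h3.
  - apply: measurable_funM => //; apply: measurable_funM => //.
    by apply: lip_measurable; exact: (tb_lip1 tb).
  - apply: ae_mono aD _ => x aDx Ox d dV.
    rewrite (aDx Ox _ (is_derive_sgn dV)) mulrACA [sgn R i * sgn R i]sgn_sqr.
    by rewrite mul1r mulrC.
have -> : (fun n => dualflux kf n.+1 (sample n) (approx_at n t)) =
  (fun n => \sum_(i < 2) \sum_(j < n.+1)
    (kf i (approx_at n t i j.+1) - kf i (approx_at n t i j)) * slope n i j).
  by [].
rewrite (sum_I2 _ ord0); under eq_fun do rewrite (sum_I2 _ ord0).
by apply: cvgD; exact: sidei.
Qed.

Let dual_le n m : `|dualflux kf n.+1 (sample n) (approx n m)| <= 2 * K * C.
Proof.
apply: (@dualflux_le _ kf n.+1 (sample n) (ltn0Sn _)) => i j jn.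
  by apply: le_trans (approx_space _ _ (leqnSn j) jn) _; rewrite subSnn mulr1.
exact/slope_le/ltnW.
Qed.

Let sample0 n i : sample n i 0%N = sample n ord0 0%N.
Proof. by rewrite /sample mul0r; exact: (tb_interface tb). Qed.

Let por0 i : 0 < por i.
Proof. by have /andP[] := por_itv i. Qed.

Lemma mass_time_lip s t : `|mass_at t - mass_at s| <= 2 * K * C * `|t - s|.
Proof.
wlog st : s t / s <= t => [h|].
  have [/h//|/ltW/h] := leP s t.
  by rewrite distrC => /le_trans; apply; rewrite distrC.
have Mt := @mass_cvg t; have Ms := @mass_cvg s.
have MC : (fun n => `|mass por n.+1 (sample n) (approx_at n t) -
    mass por n.+1 (sample n) (approx_at n s)|) @ Unat --> `|mass_at t - mass_at s|.
  exact: (cvg_norm (cvgB Mt Ms)).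
have RC : (fun n => 2 * K * C * (`|t - s| + time_step n)) @ Unat --> 2 * K * C * (`|t - s| + 0).
  apply: cvgM; first exact: cvg_cst.
  by apply: cvgD; [exact: cvg_cst|exact: time_step_cvg].
rewrite addr0 in RC; apply: (Unat_le MC RC); apply: (@filterE _ Unat) => n /=.
pose a := Num.truncn (s / time_step n); pose b := Num.truncn (t / time_step n).
have ab : (a <= b)%N by apply: le_truncn; rewrite ler_wpM2r// invr_ge0 ltW.
have := @mass_increment _ por kf (ktrace rk) n.+1 (sample n) (ltn0Sn _) por0 (sample0 n)
  (time_step n) (start n) a (b - a) 0 (2 * K * C) (ltW (tau_gt0 n)).
rewrite subnK// mulr0 addr0 => /(_ (approx_flux0 n)) => H.
apply: le_trans (H _) _ => [m _|]; first by rewrite subr0; exact: dual_le.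
rewrite mulrC ler_wpM2l ?mulr_ge0//.
have := step_index_dist n t s; rewrite -/a -/b => /(le_trans _); apply.
by rewrite natrB// ler_wpM2l ?(ltW (tau_gt0 n))// ler_norm.
Qed.

(** The equation integrated over a short time interval, up to an error that
is small compared with its length. The dual flux may be evaluated at any
intermediate time b because it is equicontinuous in time. *)
Lemma weak_evolution e : 0 < e -> exists2 d, 0 < d & forall s t b (D : 'I_2 -> R -> R),
  0 <= s -> s <= b -> b <= t -> t - s <= d ->
  (forall i, space_derivative (rk i) i (fun y => profile i y b) (D i)) ->
  `|mass_at t - mass_at s + (t - s) *
     \sum_(i < 2) \int[leb R]_(x in Omega R i) (D i x * (sgn R i * g1 i (sgn R i * x)))|
  <= (t - s) * e.
Proof.
move=> e0; have W0 : 0 < 8 * C * L + 1 by rewrite ltr_wpDl// !mulr_ge0.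
have e1 : 0 < e / (8 * C * L + 1) by rewrite divr_gt0.
have [d d0 [N0 H]] := approx_modulus e1.
have d2 : 0 < d / 2 by rewrite divr_gt0.
have [N1 H1] := time_step_small d2.
exists (d / 2) => // s t b D s0 sb bt std HD.
have st := le_trans sb bt; have t0 := le_trans s0 st.
have Mt := @mass_cvg t; have Ms := @mass_cvg s.
have DC : (fun n => time_step n * ((Num.truncn (t / time_step n))%:R -
    (Num.truncn (s / time_step n))%:R)) @ Unat --> t - s.
  under eq_fun do rewrite mulrBr.
  by apply: cvgB; exact: step_index_cvg.
have LC : (fun n => `|mass por n.+1 (sample n) (approx_at n t) -
    mass por n.+1 (sample n) (approx_at n s) +
    time_step n * ((Num.truncn (t / time_step n))%:R - (Num.truncn (s / time_step n))%:R) *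
    dualflux kf n.+1 (sample n) (approx_at n b)|) @ Unat -->
   `|mass_at t - mass_at s + (t - s) *
     \sum_(i < 2) \int[leb R]_(x in Omega R i) (D i x * (sgn R i * g1 i (sgn R i * x)))|.
  exact: (cvg_norm (cvgD (cvgB Mt Ms) (cvgM DC (dual_cvg HD)))).
have RC : (fun n => time_step n * ((Num.truncn (t / time_step n))%:R -
    (Num.truncn (s / time_step n))%:R) * e) @ Unat --> (t - s) * e.
  by apply: cvgM; [exact: DC|exact: cvg_cst].
apply: (Unat_le LC RC); apply: (@Unat_ge _ (maxn N0 N1)) => n; rewrite geq_max => /andP[n0 n1] /=.
pose i0 := Num.truncn (s / time_step n); pose i1 := Num.truncn (t / time_step n).
pose ib := Num.truncn (b / time_step n).
have tV : 0 <= (time_step n)^-1 by rewrite invr_ge0 ltW.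
have i0b : (i0 <= ib)%N by apply: le_truncn; rewrite ler_wpM2r.
have ib1 : (ib <= i1)%N by apply: le_truncn; rewrite ler_wpM2r.
have i01 := leq_trans i0b ib1.
have := @mass_increment _ por kf (ktrace rk) n.+1 (sample n) (ltn0Sn _) por0 (sample0 n)
  (time_step n) (start n) i0 (i1 - i0) (dualflux kf n.+1 (sample n) (approx_at n b)) e
  (ltW (tau_gt0 n)).
rewrite subnK// natrB// => /(_ (approx_flux0 n)); apply => m /andP[i0m mi1].
have hd : time_step n * `|m%:R - ib%:R| <= d.
  have := step_index_dist n t s; rewrite -/i0 -/i1 => h1.
  apply: (@le_trans _ _ (`|t - s| + time_step n)); last first.
    by rewrite ger0_norm ?subr_ge0//; have := H1 n n1; lra.
  apply: le_trans h1; rewrite ler_wpM2l ?(ltW (tau_gt0 n))//.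
  rewrite [leRHS]ger0_norm ?subr_ge0 ?ler_nat//.
  move: i0b ib1 i0m (ltnW mi1); rewrite -!(ler_nat R) => *.
  by rewrite ler_norml; apply/andP; split; lra.
apply: le_trans (@dualflux_diff _ kf n.+1 (sample n) (ltn0Sn _) _ _
  (L * (e / (8 * C * L + 1))) C (2 * C) _ _ _) _.
- move=> i j jn; apply: (@le_trans _ _ (L * `|approx n m i j - approx_at n b i j|)).
    by apply: kf_diff; exact: approx_range.
  by rewrite ler_wpM2l//; exact: H.
- by move=> i j jn; exact: slope_le.
- by move=> i j jn; exact: slope_diff.
rewrite [leLHS](_ : _ = e * (8 * C * L / (8 * C * L + 1))); last by field; rewrite gt_eqF.
by rewrite ler_piMr ?(ltW e0)// ler_pdivrMr// mul1r lerDl.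
Qed.

End Test.

End Limit.

(** * Measurability and integration in the plane *)

Section PlaneMeasure.
Context (R : realType).
Notation mu := (@lebesgue_measure R).

(** An open set of the plane is the union of the rational rectangles that it
contains. *)
Lemma open2_measurable (A : set (R * R)) : open A -> measurable A.
Proof.
move=> oA.
pose rect (q : (rat * rat) * (rat * rat)) : set (R * R) :=
  `]ratr q.1.1, ratr q.1.2[%classic `*` `]ratr q.2.1, ratr q.2.2[%classic.
have -> : A = \bigcup_q (if pselect (rect q `<=` A) then rect q else set0).
  apply/seteqP; split=> [[x y] Axy|p [q _]]; last by case: pselect => // H; exact: H.
  have [e /= e0 eA] := (nbhs_ballP _ _).1 (open_nbhs_nbhs (conj oA Axy)).
  have xe (z : R) : exists ab : rat * rat, ratr ab.1 < z < ratr ab.2 /\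
      (forall w, ratr ab.1 < w < ratr ab.2 -> ball z e w).
    have ze1 : z - e < z by rewrite ltrBlDr ltrDl.
    have ze2 : z < z + e by rewrite ltrDl.
    have [a] := rat_in_itvoo ze1; rewrite in_itv/= => /andP[a1 a2].
    have [b] := rat_in_itvoo ze2; rewrite in_itv/= => /andP[b1 b2].
    exists (a, b); split; first by rewrite /= a2.
    move=> w /= /andP[aw wb]; rewrite /ball/= ltr_norml.
    by apply/andP; split; lra.
  have [ab [xab abe]] := xe x; have [cd [ycd cde]] := xe y.
  have sub : rect (ab, cd) `<=` A.
    move=> -[a b] [/=]; rewrite !in_itv/= => ha hb.
    by apply: eA; split; [exact: abe|exact: cde].
  exists (ab, cd) => //; case: (pselect (rect (ab, cd) `<=` A)) => //= ?; split; rewrite /= in_itv.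
apply: countable_bigcupT_measurable; first exact: countableP.
by move=> q; case: (pselect (rect q `<=` A)) => ? //=; apply: measurableX; exact: measurable_itv.
Qed.

Lemma continuous2_measurable (f : R * R -> R) : continuous f ->
  measurable_fun setT f.
Proof.
move=> /continuousP cf; apply: (measurability _ (RGenOpens.measurableE R)) => //.
move=> _ [_ [a [b ->] <-]]; rewrite setTI; apply: open2_measurable.
by apply: cf; exact: interval_open.
Qed.

End PlaneMeasure.

Section BoundedFunctions.
Context d (T : measurableType d) (R : realType) (mu : {measure set T -> \bar R}).

Lemma bounded_integrable (A : set T) (f : T -> R) (M : R) : measurable A ->
  (mu A < +oo)%E -> measurable_fun A f -> (forall x, A x -> `|f x| <= M) ->
  mu.-integrable A (EFin \o f).
Proof.
move=> mA Afin mf fM; apply: measurable_bounded_integrable => //.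
exists M; split; first exact: num_real.
by move=> M' MM' x Ax; apply: le_trans (fM _ Ax) (ltW MM').
Qed.

Lemma bounded_Rintegral (A : set T) (f : T -> R) (M : R) : measurable A ->
  (mu A < +oo)%E -> measurable_fun A f -> (forall x, A x -> `|f x| <= M) ->
  `|\int[mu]_(x in A) f x| <= M * fine (mu A).
Proof.
move=> mA Afin mf fM.
have fi : mu.-integrable A (EFin \o f) by exact: bounded_integrable fM.
apply: le_trans (le_normr_Rintegral mA fi) _; rewrite -Rintegral_cst//.
apply: le_Rintegral => //.
  apply: (@bounded_integrable _ _ M) => //; first exact: measurableT_comp.
  by move=> x Ax; rewrite normr_id; exact: fM.
by apply: (@bounded_integrable _ _ `|M|).
Qed.

Lemma bounded_Lfun2 (A : set T) (f : T -> R) (M : R) : measurable A ->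
  (mu A < +oo)%E -> measurable_fun A f -> (forall x, A x -> `|f x| <= M) ->
  f \_ A \in Lfun mu 2%:E.
Proof.
move=> mA Afin mf fM; have mfA : measurable_fun setT (f \_ A).
  exact/(measurable_restrictT _ mA).1.
rewrite inE/=; apply/andP; split; rewrite inE//=.
rewrite /finite_norm unlock poweR_lty//.
have fi : mu.-integrable A (EFin \o (fun x => `|f x| `^ 2)).
  apply: (@bounded_integrable _ _ (M `^ 2)) => //.
    apply: (measurableT_comp (@measurable_powR R 2)); exact: measurableT_comp.
  by move=> x Ax; rewrite ger0_norm ?powR_ge0// ge0_ler_powR ?nnegrE ?(le_trans (normr_ge0 _) (fM _ Ax))// fM.
have := integrable_lty mA fi; rewrite integral_mkcond.
congr (_ < _)%E; apply: eq_integral => x _ /=.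
rewrite /= !patchE; case: ifP => _//=.
by rewrite normr0 powR0.
Qed.

Lemma bounded_Lfunoo (A : set T) (f : T -> R) (M : R) : measurable A ->
  measurable_fun A f -> (forall x, A x -> `|f x| <= M) ->
  f \_ A \in Lfun mu +oo%E.
Proof.
move=> mA mf fM; have mfA : measurable_fun setT (f \_ A).
  exact/(measurable_restrictT _ mA).1.
rewrite inE/=; apply/andP; split; rewrite inE//=.
rewrite /finite_norm unlock; case: ifP => // _.
apply: (@le_lt_trans _ _ `|M|%:E); last exact: ltry.
apply/ess_supP; apply: aeW => x /=; rewrite lee_fin patchE.
case: ifP => [xA|_]; last by rewrite normr0.
by apply: le_trans (ler_norm _); apply: fM; exact: set_mem.
Qed.

Lemma Lfunoo_measurable (A : set T) (f : T -> R) (p : \bar R) : measurable A ->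
  f \_ A \in Lfun mu p -> measurable_fun A f.
Proof.
move=> mA; rewrite inE/= => /andP[]; rewrite inE/= => mf _.
exact/(measurable_restrictT _ mA).2.
Qed.

Lemma Lfunoo_bound (A : set T) (f : T -> R) : measurable A ->
  f \_ A \in Lfun mu +oo%E ->
  exists K : R, {ae mu, forall x, A x -> `|f x| <= K}.
Proof.
move=> mA; rewrite inE/= => /andP[_]; rewrite inE/= /finite_norm unlock.
have [muT|/negP muT] := boolP (0 < mu [set: T])%E; last first.
  move=> _; exists 0; exists setT; split=> //; apply/eqP.
  by move: (measure_ge0 mu setT); rewrite le_eqVlt => /orP[/eqP <-//|].
move=> h; set s := ess_sup _ _ in h.
have sp : (s <= (fine s)%:E)%E.
  have s0 : (0 <= s)%E by apply: ess_sup_gee => //; apply: aeW => x; exact: abse_ge0.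
  by rewrite fineK// ge0_fin_numE.
exists (fine s); have /ess_supP := sp.
move=> sae; apply: (ae_mono sae) => x /=; rewrite lee_fin patchE => h1 Ax.
by move: h1; rewrite mem_set.
Qed.

End BoundedFunctions.

Section FubiniMeasurable.
Context (R : realType).

Lemma finite_rectangle (A B : set R) : measurable A -> measurable B ->
  (leb R A < +oo)%E -> (leb R B < +oo)%E -> ((leb2 R) (A `*` B) < +oo)%E.
Proof.
move=> mA mB Af Bf; rewrite product_measure1E//.
by apply: lte_mul_pinfty => //; rewrite ge0_fin_numE.
Qed.

Lemma measurable_partial_integral (A B : set R) (f : R * R -> R) (M : R) :
  measurable A -> measurable B -> (leb R A < +oo)%E -> (leb R B < +oo)%E ->
  measurable_fun (A `*` B) f -> (forall p, (A `*` B) p -> `|f p| <= M) ->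
  measurable_fun B (fun t => \int[leb R]_(x in A) f (x, t)).
Proof.
move=> mA mB Af Bf mf fM; have mAB : measurable (A `*` B) by exact: measurableX.
have fi : (leb2 R).-integrable (A `*` B) (EFin \o f).
  by apply: (@bounded_integrable _ _ _ (leb2 R) (A `*` B) f M) => //; exact: finite_rectangle.
have fi' := (@integrable_mkcond _ _ R (leb2 R) (A `*` B) (EFin \o f) mAB).1 fi.
have := measurable_fubini_G fi' => mG.
apply: (@eq_measurable_fun _ _ _ _ _ (fine \o fubini_G (leb R) ((EFin \o f) \_ (A `*` B)))).
  move=> t; rewrite inE => Bt; rewrite /= /fubini_G /Rintegral [in RHS]integral_mkcond.
  congr fine; apply: eq_integral => x _; rewrite !patchE.
  have [Ax|Ax] := pselect (A x); first by rewrite !mem_set.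
  by rewrite !memNset//; case.
apply: measurable_funTS; apply: measurableT_comp => //; exact: fine_measurable.
Qed.

End FubiniMeasurable.

Section Boundary.
Context (R : realType) (V : normedModType R).

(** Outside the compact K the function vanishes on A, hence also at those
limit points of A that do not belong to A. *)
Lemma test_function_boundary (A : set V) (f : V -> R) p : test_function A f ->
  closure A p -> ~ A p -> f p = 0.
Proof.
move=> [fs [K [cK KA fK]]] Ap nAp.
have [fc _] := fs [::]; rewrite /= in fc.
have cl : closed K by apply: compact_closed => //; exact: norm_hausdorff.
apply/eqP; rewrite -normr_le0; apply/ler_addgt0Pr => e e0; rewrite add0r.
have nK : nbhs p (~` K).
  apply: open_nbhs_nbhs; split; first exact: closed_openC.
  by move=> Kp; apply: nAp; exact: KA.
have fe : \forall q \near p, `|f p - f q| <= e.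
  by have /cvgrPdist_le := fc p; apply.
have [q [Aq [nKq fq]]] := Ap _ (filterI nK fe).
by move: fq; rewrite (fK q (conj Aq nKq)) subr0.
Qed.

End Boundary.

(** * Mean value estimates for smooth functions of the plane *)

Section MeanValue.
Context (R : realType).

Lemma mean_value_bound (f f' : R -> R) (x y C : R) :
  (forall z : R, is_derive z 1 f (f' z)) ->
  (forall z, Num.min x y <= z <= Num.max x y -> `|f' z| <= C) ->
  `|f y - f x| <= C * `|y - x|.
Proof.
move=> fD; wlog xy : x y / x <= y => [h|].
  case/orP: (le_total x y) => [/h//|/h {}h f'C].
  by rewrite (distrC (f y)) (distrC y); apply: h => z zxy; apply: f'C; rewrite minC maxC.
rewrite (min_idPl xy) (max_idPr xy) => f'C.
have [|c cxy ->] := @MVT_segment R f f' x y xy (fun z _ => fD z).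
  apply: continuous_subspaceT => z; apply: differentiable_continuous.
  by apply/derivable1_diffP; have ? := fD z; exact: ex_derive.
by rewrite normrM ler_wpM2r//; apply: f'C; rewrite in_itv in cxy.
Qed.

(** The mean value estimate for f z - f' x * z. *)
Lemma taylor_bound (f f' f'' : R -> R) (x y C : R) : 0 <= C ->
  (forall z : R, is_derive z 1 f (f' z)) ->
  (forall z : R, is_derive z 1 f' (f'' z)) ->
  (forall z, Num.min x y <= z <= Num.max x y -> `|f'' z| <= C) ->
  `|f y - f x - f' x * (y - x)| <= C * (y - x) ^+ 2.
Proof.
move=> C0 fD f'D f''C.
have -> : f y - f x - f' x * (y - x) =
  (f y - f' x * y) - (f x - f' x * x) by ring.
have h := @mean_value_bound (fun z => f z - f' x * z) (fun z => f' z - f' x) x y (C * `|y - x|).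
rewrite -real_normK ?num_real// expr2 mulrA; apply: h => z.
  apply: is_deriveB; rewrite -[X in is_derive _ _ _ X](mulr1 (f' x)).
  by apply: is_deriveZ; exact: is_derive_id.
move=> /andP[z1 z2]; have zx : `|z - x| <= `|y - x|.
  move: z1 z2; have [xy|/ltW yx] := leP x y.
    by move=> z1 z2; rewrite !ger0_norm ?subr_ge0//; lra.
  by move=> z1 z2; rewrite !ler0_norm ?subr_le0//; lra.
apply: (@le_trans _ _ (C * `|z - x|)); last exact: ler_wpM2l.
apply: (@mean_value_bound f' f'') => // w /andP[w1 w2]; apply: f''C.
apply/andP; split.
  by apply: le_trans w1; rewrite le_min z1 ge_min lexx.
by apply: le_trans w2 _; rewrite ge_max z2 le_max lexx.
Qed.

End MeanValue.

Section PlaneCalculus.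
Context (R : realType).
Implicit Types h : R * R -> R.

Lemma smooth_derive h v : smooth h -> smooth ('D_v h).
Proof.
move=> sh vs; have := sh (rcons vs v).
by rewrite foldr_rcons.
Qed.

Lemma smooth_continuous h : smooth h -> continuous h.
Proof. by move=> /(_ [::])[]. Qed.

Lemma smooth_derive1 h (x t : R) : smooth h ->
  is_derive x (1 : R) (fun z => h (z, t)) ('D_(1 : R, 0 : R) h (x, t)).
Proof.
move=> /(_ [::])[_] /(_ (x, t) (1, 0)) /= dh.
have E : (fun k : R => k^-1 *: (((fun z => h (z, t)) \o shift x) (k *: (1 : R)) - h (x, t))) =
  (fun k : R => k^-1 *: ((h \o shift (x, t)) (k *: (1 : R, 0 : R)) - h (x, t))).
  apply/funext => k; congr (_ *: (_ - _)) => /=; congr h; rewrite /shift/=.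
  by apply/pair_equal_spec; split=> //=; rewrite scaler0 add0r.
apply: DeriveDef; first by rewrite /derivable E.
by rewrite /derive E.
Qed.

Lemma smooth_derive2 h (x t : R) : smooth h ->
  is_derive t (1 : R) (fun z => h (x, z)) ('D_(0 : R, 1 : R) h (x, t)).
Proof.
move=> /(_ [::])[_] /(_ (x, t) (0, 1)) /= dh.
have E : (fun k : R => k^-1 *: (((fun z => h (x, z)) \o shift t) (k *: (1 : R)) - h (x, t))) =
  (fun k : R => k^-1 *: ((h \o shift (x, t)) (k *: (0 : R, 1 : R)) - h (x, t))).
  apply/funext => k; congr (_ *: (_ - _)) => /=; congr h; rewrite /shift/=.
  by apply/pair_equal_spec; split=> //=; rewrite scaler0 add0r.
apply: DeriveDef; first by rewrite /derivable E.
by rewrite /derive E.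
Qed.

Lemma compact_bound (V : topologicalType) (f : V -> R) (A : set V) :
  compact A -> continuous f -> exists2 C : R, 0 <= C & forall x, A x -> `|f x| <= C.
Proof.
move=> cA fc; have : compact (f @` A).
  by apply: continuous_compact => //; exact: continuous_subspaceT.
move=> /compact_bounded[M [_ HM]]; exists (`|M| + 1); first by rewrite addr_ge0.
move=> x Ax; apply: (HM (`|M| + 1)); first by rewrite ltr_pwDr// ler_norm.
by exists x.
Qed.

Lemma box_bound h (a b c d : R) : continuous h -> exists2 C : R, 0 <= C &
  forall x t, a <= x <= b -> c <= t <= d -> `|h (x, t)| <= C.
Proof.
move=> hc; have cK := compact_setX (@segment_compact R a b) (@segment_compact R c d).
have [C C0 HC] := compact_bound cK hc.
by exists C => // x t xab tcd; apply: HC; split; rewrite /= in_itv.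
Qed.

(** All that the limit needs to know about a test function. The
interval [-2, 2] matches the interval [0, 2] of test_bound on both sides. *)
Definition plane_bounds (T C : R) h : Prop := forall x y t s,
  -2 <= x <= 2 -> -2 <= y <= 2 -> 0 <= t <= T -> 0 <= s <= T ->
  [/\ `|h (x, t)| <= C, `|'D_(1 : R, 0 : R) h (x, t)| <= C &
      `|'D_(0 : R, 1 : R) h (x, t)| <= C] /\
  [/\ `|h (x, t) - h (y, t)| <= C * `|x - y|,
      `|'D_(1 : R, 0 : R) h (x, t) - 'D_(1 : R, 0 : R) h (y, t)| <= C * `|x - y|,
      `|h (y, t) - h (x, t) - 'D_(1 : R, 0 : R) h (x, t) * (y - x)| <= C * (y - x) ^+ 2,
      `|h (x, s) - h (x, t)| <= C * `|s - t| &
      `|h (x, s) - h (x, t) - 'D_(0 : R, 1 : R) h (x, t) * (s - t)| <= C * (s - t) ^+ 2].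

Lemma smooth_box h (T : R) : smooth h -> exists2 C : R, 0 <= C & plane_bounds T C h.
Proof.
move=> sh; have sx := smooth_derive (1, 0) sh; have st := smooth_derive (0, 1) sh.
have sxx := smooth_derive (1, 0) sx; have stt := smooth_derive (0, 1) st.
have [C0 C00 H0] := @box_bound h (-2) 2 0 T (smooth_continuous sh).
have [C1 C10 H1] := @box_bound _ (-2) 2 0 T (smooth_continuous sx).
have [C2 C20 H2] := @box_bound _ (-2) 2 0 T (smooth_continuous st).
have [C3 C30 H3] := @box_bound _ (-2) 2 0 T (smooth_continuous sxx).
have [C4 C40 H4] := @box_bound _ (-2) 2 0 T (smooth_continuous stt).
exists (C0 + C1 + C2 + C3 + C4); first by rewrite !addr_ge0.
have btw (a b z A B : R) : A <= a <= B -> A <= b <= B ->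
    Num.min a b <= z <= Num.max a b -> A <= z <= B.
  move=> /andP[a1 a2] /andP[b1 b2] /andP[z1 z2]; apply/andP; split.
    by apply: le_trans z1; rewrite le_min a1.
  by apply: le_trans z2 _; rewrite ge_max a2.
move=> x y t s xb yb tb sb; split; split.
- by apply: le_trans (H0 _ _ xb tb) _; lra.
- by apply: le_trans (H1 _ _ xb tb) _; lra.
- by apply: le_trans (H2 _ _ xb tb) _; lra.
- apply: (@mean_value_bound _ (fun z => h (z, t)) (fun z => 'D_(1 : R, 0 : R) h (z, t))).
    by move=> z; exact: (smooth_derive1 z t sh).
  by move=> z /(btw _ _ _ _ _ yb xb) zb; apply: le_trans (H1 _ _ zb tb) _; lra.
- apply: (@mean_value_bound _ (fun z => 'D_(1 : R, 0 : R) h (z, t))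
    (fun z => 'D_(1 : R, 0 : R) ('D_(1 : R, 0 : R) h) (z, t))).
    by move=> z; exact: (smooth_derive1 z t sx).
  by move=> z /(btw _ _ _ _ _ yb xb) zb; apply: le_trans (H3 _ _ zb tb) _; lra.
- apply: (@taylor_bound _ (fun z => h (z, t)) (fun z => 'D_(1 : R, 0 : R) h (z, t))
    (fun z => 'D_(1 : R, 0 : R) ('D_(1 : R, 0 : R) h) (z, t))).
  + by rewrite !addr_ge0.
  + by move=> z; exact: (smooth_derive1 z t sh).
  + by move=> z; exact: (smooth_derive1 z t sx).
  + by move=> z /(btw _ _ _ _ _ xb yb) zb; apply: le_trans (H3 _ _ zb tb) _; lra.
- apply: (@mean_value_bound _ (fun z => h (x, z)) (fun z => 'D_(0 : R, 1 : R) h (x, z))).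
    by move=> z; exact: (smooth_derive2 x z sh).
  by move=> z /(btw _ _ _ _ _ tb sb) zb; apply: le_trans (H2 _ _ xb zb) _; lra.
- apply: (@taylor_bound _ (fun z => h (x, z)) (fun z => 'D_(0 : R, 1 : R) h (x, z))
    (fun z => 'D_(0 : R, 1 : R) ('D_(0 : R, 1 : R) h) (x, z))).
  + by rewrite !addr_ge0.
  + by move=> z; exact: (smooth_derive2 x z sh).
  + by move=> z; exact: (smooth_derive2 x z st).
  + by move=> z /(btw _ _ _ _ _ tb sb) zb; apply: le_trans (H4 _ _ xb zb) _; lra.
Qed.

End PlaneCalculus.

(** * The solution and its space derivative *)

(** The meeting point of the discrete and the continuous parts of the proof. *)
Record scheme_limit (R : realType) (rk : 'I_2 -> rock R) (K : R) (U0 : 'I_2 -> R -> R)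
    (U : 'I_2 -> R -> R -> R) : Prop := SchemeLimit {
  sl_itv : forall i y t, 0 <= U i y t <= 1;
  sl_start : forall i y, 0 <= y <= 1 -> U i y 0 = U0 i y;
  sl_lip : forall i t x y, 0 <= x <= 1 -> 0 <= y <= 1 ->
    `|kirchhoff (rk i) (U i x t) - kirchhoff (rk i) (U i y t)| <= K * `|x - y|;
  sl_space : forall e, 0 < e -> exists2 d, 0 < d & forall i x y t,
    0 <= x <= 1 -> 0 <= y <= 1 -> `|x - y| <= d -> `|U i x t - U i y t| <= e;
  sl_time : forall e, 0 < e -> exists2 d, 0 < d & forall i y s t,
    0 <= y <= 1 -> `|s - t| <= d -> `|U i y s - U i y t| <= e;
  sl_interface : forall t, exists q, forall i, U i 0 t = sat (rk i) q;
  sl_mass_lip : forall C g g1 s t, test_bound C g g1 ->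
    `|mass_of rk g (fun i y => U i y t) - mass_of rk g (fun i y => U i y s)|
      <= 2 * K * C * `|t - s|;
  sl_evolution : forall C g g1 e, test_bound C g g1 -> 0 < e ->
    exists2 d, 0 < d & forall s t b (D : 'I_2 -> R -> R),
    0 <= s -> s <= b -> b <= t -> t - s <= d ->
    (forall i, space_derivative (rk i) i (fun y => U i y b) (D i)) ->
    `|mass_of rk g (fun i y => U i y t) - mass_of rk g (fun i y => U i y s) + (t - s) *
       \sum_(i < 2) \int[leb R]_(x in Omega R i) (D i x * (sgn R i * g1 i (sgn R i * x)))|
    <= (t - s) * e
}.

Lemma scheme_limit_exists (R : realType) (rk : 'I_2 -> rock R) (K : R) (U0 : 'I_2 -> R -> R) :
  (forall i y, 0 <= U0 i y <= 1) ->
  (forall i x y, 0 <= x <= 1 -> 0 <= y <= 1 ->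
    `|kirchhoff (rk i) (U0 i x) - kirchhoff (rk i) (U0 i y)| <= K * `|x - y|) ->
  (exists q, forall i, U0 i 0 = sat (rk i) q) ->
  exists U, scheme_limit rk K U0 U.
Proof.
move=> U01 U0K U0q.
have [L0 L00 H0] := kirchhoff_incr_lip (rk ord0).
have [L1 L10 H1] := kirchhoff_incr_lip (rk ord_max).
have L_ge0 : 0 <= L0 + L1 by rewrite addr_ge0.
have HL i s t : 0 <= s -> s <= t -> t <= 1 ->
    0 <= kirchhoff (rk i) t - kirchhoff (rk i) s <= (L0 + L1) * (t - s).
  move=> s0 st t1; have ts : 0 <= t - s by rewrite subr_ge0.
  elim/I2_cases: i; [have /andP[-> h] := H0 s t s0 st t1|have /andP[-> h] := H1 s t s0 st t1];
    by apply: le_trans h _; rewrite ler_wpM2r// ?lerDl ?lerDr.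
pose pm := Num.min (porosity (rk ord0)) (porosity (rk ord_max)).
have p0 : 0 < pm.
  by rewrite lt_min; have /andP[-> _] := porosity_itv (rk ord0); have /andP[-> _] := porosity_itv (rk ord_max).
have pP i : pm <= porosity (rk i).
  by elim/I2_cases: i; rewrite /pm ge_min lexx ?orbT.
exists (profile rk (L0 + L1) pm U0); split.
- by move=> i y t; exact: (profile_itv p0 pP L_ge0 HL U01).
- by move=> i y; exact: (profile_start p0 pP L_ge0 HL U01 U0K).
- by move=> i t x y; exact: (kprofile_lip p0 pP L_ge0 HL U01 U0K U0q).
- by move=> e; exact: (profile_space p0 pP L_ge0 HL U01 U0K U0q).
- by move=> e; exact: (profile_time p0 pP L_ge0 HL U01 U0K U0q).
- by move=> t; exact: (profile_interface p0 pP L_ge0 HL U01 U0K U0q).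
- by move=> C g g1 s t tb; exact: (mass_time_lip p0 pP L_ge0 HL U01 U0K U0q tb).
- by move=> C g g1 e tb; exact: (weak_evolution p0 pP L_ge0 HL U01 U0K U0q tb).
Qed.

Section IntervalFacts.
Context (R : realType).

Lemma closure_itv_left (a b : R) : a < b -> closure `]a, b[%classic a.
Proof.
move=> ab B [e /= e0 eB]; pose m := Num.min e (b - a).
have m0 : 0 < m by rewrite lt_min e0 subr_gt0.
have me : m <= e by rewrite ge_min lexx.
have mb : m <= b - a by rewrite ge_min lexx orbT.
exists (a + m / 2); split; first by rewrite /= in_itv/=; apply/andP; split; lra.
by apply: eB; rewrite /ball/= opprD addrA subrr sub0r normrN gtr0_norm ?divr_gt0//; lra.
Qed.

Lemma closure_itv_right (a b : R) : a < b -> closure `]a, b[%classic b.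
Proof.
move=> ab B [e /= e0 eB]; pose m := Num.min e (b - a).
have m0 : 0 < m by rewrite lt_min e0 subr_gt0.
have me : m <= e by rewrite ge_min lexx.
have mb : m <= b - a by rewrite ge_min lexx orbT.
exists (b - m / 2); split; first by rewrite /= in_itv/=; apply/andP; split; lra.
by apply: eB; rewrite /ball/= opprB addrC subrK gtr0_norm ?divr_gt0//; lra.
Qed.

End IntervalFacts.

Section Solution.
Context (R : realType) (rk : 'I_2 -> rock R) (K : R) (U0 : 'I_2 -> R -> R)
  (U : 'I_2 -> R -> R -> R).
Hypothesis H : scheme_limit rk K U0 U.
Notation mu := (@lebesgue_measure R).
Let por i := porosity (rk i).
Let kf i := kirchhoff (rk i).

(** The projection of the distance onto [0, 1] makes this continuous on the
whole plane and K-Lipschitz in space after the Kirchhoff transform, so that no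
domain has to be carried along. *)
Definition side (i : 'I_2) (p : R * R) : R := U i (clamp 0 1 (sgn R i * p.1)) p.2.

Definition solution (p : R * R) : R := if p.1 < 0 then side ord0 p else side ord_max p.

Definition kside i p := kf i (side i p).

Let K0 : 0 <= K.
Proof.
have z01 : 0 <= (0 : R) <= 1 by rewrite lexx ler01.
have o01 : 0 <= (1 : R) <= 1 by rewrite lexx ler01.
have := sl_lip H ord0 0 z01 o01; rewrite sub0r normrN1 mulr1.
exact: le_trans (normr_ge0 _).
Qed.

Let cl01 (x : R) : 0 <= clamp 0 1 x <= 1.
Proof. by apply: clamp_itv; exact: ler01. Qed.

Lemma side_itv i p : 0 <= side i p <= 1.
Proof. exact: sl_itv H _ _ _. Qed.

Lemma side_Omega i (x : R) t : Omega R i x -> side i (x, t) = U i (sgn R i * x) t.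
Proof.
rewrite /Omega/= in_itv/= sgn_omega => /andP[x0 x1].
by rewrite /side clamp_id// !ltW.
Qed.

Lemma solution_Omega i (x : R) t : Omega R i x -> solution (x, t) = side i (x, t).
Proof.
rewrite /Omega/= in_itv/= /solution/=; elim/I2_cases: i => /andP[h1 h2].
  by rewrite h2.
by rewrite ltNge ltW//; move: h1; rewrite /= subrr.
Qed.

Lemma solution_itv p : 0 <= solution p <= 1.
Proof. by rewrite /solution; case: ifP => _; exact: side_itv. Qed.

Lemma side_continuous i : continuous (side i).
Proof.
move=> [x t]; apply/cvgrPdist_le => e e0; have e2 : 0 < e / 2 by rewrite divr_gt0.
have [d1 d10 H1] := sl_space H e2; have [d2 d20 H2] := sl_time H e2.
have m0 : 0 < Num.min d1 d2 by rewrite lt_min d10.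
exists (ball x (Num.min d1 d2), ball t (Num.min d1 d2)); first by split; exact: nbhsx_ballx.
move=> [y s] [/= h1 h2]; rewrite /ball/= in h1 h2.
rewrite !lt_min in h1 h2; case/andP: h1 => h1 _; case/andP: h2 => _ h2.
rewrite /side/= -(subrKA (U i (clamp 0 1 (sgn R i * y)) t)).
apply: le_trans (ler_normD _ _) _; rewrite [leRHS](_ : e = e / 2 + e / 2); last by field.
apply: lerD; last by apply: H2 => //; exact: ltW.
apply: H1 => //; apply: le_trans (clamp_lip _ _ _) _; first exact: ler01.
by rewrite -mulrBr normrM sgn_norm mul1r ltW.
Qed.

Lemma kside_continuous i : continuous (kside i).
Proof.
by move=> p; exact: (cvg_comp _ _ (@side_continuous i p) (@kirchhoff_continuous _ (rk i) _)).
Qed.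

Lemma kside_lip i x y t : `|kside i (x, t) - kside i (y, t)| <= K * `|x - y|.
Proof.
apply: le_trans (sl_lip H i t (cl01 _) (cl01 _)) _.
rewrite ler_wpM2l//; apply: le_trans (clamp_lip _ _ _) _; first exact: ler01.
by rewrite -mulrBr normrM sgn_norm mul1r.
Qed.

Lemma kside_bound i p : `|kside i p| <= kf i 1.
Proof. by have /andP[h0 h1] := kirchhoff_itv (rk i) (side_itv i p); rewrite ger0_norm. Qed.

Definition quotient i n (p : R * R) : R :=
  n.+1%:R * (kside i (p.1 + n.+1%:R^-1, p.2) - kside i p).

Lemma quotient_bound i n p : `|quotient i n p| <= K.
Proof.
have n0 : 0 < n.+1%:R :> R by rewrite ltr0n.
case: p => x t; rewrite /quotient normrM (gtr0_norm n0) [leLHS]mulrC -ler_pdivlMr//.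
apply: le_trans (kside_lip _ _ _ _) _.
by rewrite /= (addrC x) addrK ger0_norm// invr_ge0 ltW.
Qed.

(** The upper limit of difference quotients is a measurable function of
(x, t) that equals the space derivative wherever the latter exists. Clamping
keeps it bounded elsewhere. *)
Definition dphi i (p : R * R) : R := clamp (- K) K (limn_sup (fun n => quotient i n p)).

Let KK : - K <= K. Proof. by have := K0; lra. Qed.

Lemma dphi_bound i p : `|dphi i p| <= K.
Proof. by rewrite ler_norml; exact: clamp_itv. Qed.

Lemma quotient_measurable i n : measurable_fun setT (quotient i n).
Proof.
have mk := continuous2_measurable (@kside_continuous i).
apply: measurable_funM; first exact: measurable_cst.
apply: measurable_funB; last exact: mk.
apply: (measurableT_comp mk); apply: measurable_fun_pair; last exact: measurable_snd.
by apply: measurable_funD; [exact: measurable_fst|exact: measurable_cst].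
Qed.

Lemma dphi_measurable i : measurable_fun setT (dphi i).
Proof.
apply: (measurableT_comp (f := clamp (- K) K)).
  by apply: continuous_measurable_fun; exact: clamp_continuous.
apply: measurable_fun_limn_sup => [p _|p _|n].
- exists K => _ [n _ <-]; exact: le_trans (ler_norm _) (quotient_bound i n p).
- exists (- K) => _ [n _ <-]; have := quotient_bound i n p; rewrite ler_norml => /andP[]//.
- exact: quotient_measurable.
Qed.

(** The quotients converge to the derivative, which lies in [-K, K]. *)
Lemma dphiE i (x t d : R) : is_derive x (1 : R) (fun z => kside i (z, t)) d ->
  dphi i (x, t) = d.
Proof.
move=> dk.
have qc : (fun n => quotient i n (x, t)) @ \oo --> d.
  have dc : h^-1 *: (((fun z => kside i (z, t)) \o shift x) (h *: (1 : R)) - kside i (x, t))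
      @[h --> 0^'] --> d.
    have ex : derivable (fun z => kside i (z, t)) x (1 : R) by exact: ex_derive.
    by rewrite -(@derive_val _ _ _ _ _ _ _ dk); exact: ex.
  have ic : (fun n => n.+1%:R^-1 : R) @ \oo --> (0 : R)^'.
    move=> A [e /= e0 eA].
    have [N1 _ N1P] := @near_infty_natSinv_lt R (PosNum e0).
    exists N1 => // n /N1P /= h; apply: eA; last by rewrite invr_eq0 pnatr_eq0.
    by rewrite /ball/= sub0r normrN ger0_norm.
  have := cvg_comp _ _ ic dc; apply: cvg_trans; apply: near_eq_cvg.
  near=> n; rewrite /= /quotient/= /shift/= invrK /GRing.scale/= mulr1.
  by rewrite (addrC x).
rewrite /dphi (cvg_limn_inf_sup qc).2 clamp_id// -ler_norml.
have nc : (fun n => `|quotient i n (x, t)|) @ \oo --> `|d| by exact: (cvg_norm qc).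
have kc : (fun=> K) n @[n --> \oo] --> K by exact: cvg_cst.
by apply: (ler_cvg_to nc kc); apply: nearW => n; exact: quotient_bound.
Unshelve. all: by end_near. Qed.

Lemma dphi_space_derivative i t :
  space_derivative (rk i) i (fun y => U i y t) (fun x => dphi i (x, t)).
Proof.
split.
  by apply: measurable_funTS; exact: (measurable_fun_pair1 t (dphi_measurable i)).
apply: aeW => x Ox d dk; apply: dphiE; apply: near_eq_is_derive dk.
have oO : nbhs x (Omega R i) by apply: open_nbhs_nbhs; split=> //; exact: interval_open.
by near=> z; rewrite /kside side_Omega//; near: z.
Unshelve. all: by end_near. Qed.

Lemma solution_measurable : measurable_fun setT solution.
Proof.
apply: measurable_fun_ifT.
- by apply: measurable_fun_ltr; [exact: measurable_fst|exact: measurable_cst].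
- by apply: continuous2_measurable; exact: side_continuous.
- by apply: continuous2_measurable; exact: side_continuous.
Qed.

Lemma ksolution_measurable i : measurable_fun setT (kf i \o solution).
Proof.
apply: measurableT_comp; last exact: solution_measurable.
by apply: continuous_measurable_fun; exact: kirchhoff_continuous.
Qed.

Let mO i : measurable (Omega R i). Proof. exact: measurable_itv. Qed.

Lemma Omega_measure i : mu (Omega R i) = 1%E.
Proof.
by rewrite /Omega lebesgue_measure_itv/= lte_fin gtrBl ltr01 -EFinD opprB addrC subrK.
Qed.

Let Ofin i : (mu (Omega R i) < +oo)%E. Proof. by rewrite Omega_measure ltry. Qed.

Lemma Omega_integral_le i (f : R -> R) M : measurable_fun (Omega R i) f ->
  (forall x, Omega R i x -> `|f x| <= M) -> `|\int[mu]_(x in Omega R i) f x| <= M.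
Proof.
move=> mf fM.
have : `|\int[mu]_(x in Omega R i) f x| <= M * fine (mu (Omega R i)).
  by apply: bounded_Rintegral; [exact: mO|exact: Ofin|exact: mf|exact: fM].
by rewrite (congr1 fine (Omega_measure i)) mulr1.
Qed.

Let ltc i : i%:R - 1 < i%:R :> R. Proof. by rewrite gtrBl. Qed.

(** Kirchhoff value times test function is Lipschitz and vanishes at both
ends; its derivative has integral 0 by lipschitz_FTC. *)
Lemma kside_weak_derivative (i : 'I_2) t :
  weak_derivative (Omega R i) (fun x => kf i (solution (x, t))) (fun x => dphi i (x, t)).
Proof.
move=> zeta tz; set a : R := i%:R - 1; set b : R := i%:R.
have ab : a < b by exact: ltc.
have zs : smooth zeta by case: tz.
have zc : continuous zeta by case: (zs [::]).
have zD (x : R) : is_derive x 1 zeta (derive1 zeta x).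
  by rewrite derive1E; apply: DeriveDef => //; have [_] := zs [::]; exact.
have z'c : continuous (derive1 zeta).
  have -> : derive1 zeta = 'D_1 zeta by apply/funext => x; rewrite derive1E.
  by case: (zs [:: 1]).
have [Z0 Z00 Z0b] := compact_bound (@segment_compact R a b) zc.
have HZ0 x : a <= x <= b -> `|zeta x| <= Z0 by move=> xab; apply: Z0b; rewrite /= in_itv.
have [Z1 Z10 Z1b] := compact_bound (@segment_compact R a b) z'c.
have HZ1 x : a <= x <= b -> `|derive1 zeta x| <= Z1 by move=> xab; apply: Z1b; rewrite /= in_itv.
have za : zeta a = 0.
  apply: test_function_boundary tz _ _; last by rewrite /Omega/= in_itv/= ltxx.
  by apply: (closure_itv_left ab).
have zb : zeta b = 0.
  apply: test_function_boundary tz _ _; last by rewrite /Omega/= in_itv/= ltxx andbF.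
  by apply: (closure_itv_right ab).
pose G x := kside i (x, t) * zeta x.
have GL x y : a <= x <= b -> a <= y <= b -> `|G x - G y| <= (K * Z0 + kf i 1 * Z1) * `|x - y|.
  move=> xab yab; rewrite /G (_ : _ - _ = (kside i (x, t) - kside i (y, t)) * zeta x +
    kside i (y, t) * (zeta x - zeta y)); last by ring.
  apply: le_trans (ler_normD _ _) _; rewrite !normrM mulrDl; apply: lerD.
    rewrite mulrAC; apply: ler_pM => //; [exact: kside_lip|exact: HZ0].
  rewrite -mulrA; apply: ler_pM => //; first exact: kside_bound.
  apply: (@mean_value_bound _ zeta (derive1 zeta)) => // z /andP[z1 z2].
  apply: HZ1; move: xab yab => /andP[x1 x2] /andP[y1 y2]; apply/andP; split.
    by apply: le_trans z1; rewrite le_min x1 y1.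
  by apply: le_trans z2 _; rewrite ge_max x2 y2.
have kL x y : a <= x <= b -> a <= y <= b -> `|kside i (x, t) - kside i (y, t)| <= K * `|x - y|.
  by move=> _ _; exact: kside_lip.
have [dk _] := lipschitz_FTC ab kL.
have [_ FTC] := lipschitz_FTC ab GL.
have mk : measurable_fun (Omega R i) (fun x => kside i (x, t)).
  apply: measurable_funTS.
  exact: (measurable_fun_pair1 t (continuous2_measurable (@kside_continuous i))).
have md : measurable_fun (Omega R i) (fun x => dphi i (x, t)).
  by apply: measurable_funTS; exact: (measurable_fun_pair1 t (dphi_measurable i)).
have mz (f : R -> R) : continuous f -> measurable_fun (Omega R i) f.
  by move=> fc; apply: measurable_funTS; exact: continuous_measurable_fun.
have m1 : measurable_fun (Omega R i) (fun x => kside i (x, t) * derive1 zeta x).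
  by apply: measurable_funM => //; exact: mz.
have m2 : measurable_fun (Omega R i) (fun x => dphi i (x, t) * zeta x).
  by apply: measurable_funM => //; exact: mz.
have inO x : Omega R i x -> a <= x <= b.
  by rewrite /Omega/= in_itv/= => /andP[h1 h2]; rewrite !ltW.
have i1 : mu.-integrable (Omega R i) (EFin \o (fun x => kside i (x, t) * derive1 zeta x)).
  apply: (@bounded_integrable _ _ _ _ _ _ (kf i 1 * Z1)); [exact: mO|exact: Ofin|exact: m1|].
  move=> x /inO xab; rewrite normrM; apply: ler_pM => //; [exact: kside_bound|exact: HZ1].
have i2 : mu.-integrable (Omega R i) (EFin \o (fun x => dphi i (x, t) * zeta x)).
  apply: (@bounded_integrable _ _ _ _ _ _ (K * Z0)); [exact: mO|exact: Ofin|exact: m2|].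
  move=> x /inO xab; rewrite normrM; apply: ler_pM => //; [exact: dphi_bound|exact: HZ0].
have [||_] := FTC (fun x => kside i (x, t) * derive1 zeta x + dphi i (x, t) * zeta x).
- exact: measurable_funD.
- apply: ae_mono dk _ => x dx xab _.
  have dkx : is_derive x (1 : R) (fun z => kside i (z, t)) (derive1 (fun z => kside i (z, t)) x).
    by rewrite derive1E; apply: DeriveDef => //; exact: dx.
  have dG := is_deriveM dkx (zD x).
  rewrite (dphiE dkx) [RHS]derive1E; apply/esym.
  rewrite (@derive_val _ _ _ _ _ _ _ dG) /GRing.scale/=.
  by rewrite [X in _ + X]mulrC.
rewrite /G za zb !mulr0 subrr => I0.
have : \int[mu]_(x in Omega R i) (kside i (x, t) * derive1 zeta x + dphi i (x, t) * zeta x) =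
    \int[mu]_(x in Omega R i) (kside i (x, t) * derive1 zeta x) +
    \int[mu]_(x in Omega R i) (dphi i (x, t) * zeta x).
  by apply: RintegralD; [exact: mO|exact: i1|exact: i2].
rewrite I0 => /esym /eqP.
rewrite addr_eq0 => /eqP <-; apply: eq_Rintegral => x; rewrite inE => Ox.
by rewrite (solution_Omega _ Ox).
Qed.

End Solution.

(** * The weak formulation in space and time *)

Section WeakFormulation.
Context (R : realType) (rk : 'I_2 -> rock R) (K : R) (U0 : 'I_2 -> R -> R)
  (U : 'I_2 -> R -> R -> R) (T C : R) (psi : R * R -> R).
Hypothesis H : scheme_limit rk K U0 U.
Hypothesis T_gt0 : 0 < T.
Hypothesis psi_test : test_function ([set` `[-1, 1 : R]] `*` [set` `[0, T[]) psi.
Hypothesis C0 : 0 <= C.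
Hypothesis psiC : plane_bounds T C psi.
Notation mu := (@lebesgue_measure R).
Let por i := porosity (rk i).
Let psi_x := 'D_(1 : R, 0 : R) psi.
Let psi_t := 'D_(0 : R, 1 : R) psi.

Let psi_smooth : smooth psi. Proof. by case: psi_test. Qed.
Let psi_c : continuous psi. Proof. exact: smooth_continuous. Qed.
Let psi_xc : continuous psi_x. Proof. exact/smooth_continuous/smooth_derive. Qed.
Let psi_tc : continuous psi_t. Proof. exact/smooth_continuous/smooth_derive. Qed.

Let por_itv i : 0 < por i < 1. Proof. exact: porosity_itv. Qed.
Let mO i : measurable (Omega R i). Proof. exact: measurable_itv. Qed.
Let Ofin i : (mu (Omega R i) < +oo)%E. Proof. by rewrite Omega_measure ltry. Qed.

Let O2 i (x : R) : Omega R i x -> -2 <= x <= 2.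
Proof.
rewrite /Omega/= in_itv/=; elim/I2_cases: i => /= /andP[h1 h2]; apply/andP; split; lra.
Qed.

Let sgn2 i (x : R) : 0 <= x <= 2 -> -2 <= sgn R i * x <= 2.
Proof.
by elim/I2_cases: i; rewrite /sgn/= => /andP[h1 h2]; apply/andP; split; lra.
Qed.

(** The section of psi at time t, unfolded to both sides of the interface,
as a test function for the limit of the scheme. *)
Lemma section_test_bound t : 0 <= t <= T ->
  test_bound C (fun i y => psi (sgn R i * y, t)) (fun i y => sgn R i * psi_x (sgn R i * y, t)).
Proof.
move=> tT; split.
- by move=> i; rewrite !mulr0.
- by move=> i x /(sgn2 i) x2; have [[]] := psiC x2 x2 tT tT.
- move=> i x /(sgn2 i) x2; rewrite normrM sgn_norm mul1r.
  by have [[]] := psiC x2 x2 tT tT.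
- move=> i x y /(sgn2 i) x2 /(sgn2 i) y2; have [_ [h _ _ _ _]] := psiC x2 y2 tT tT.
  by apply: le_trans h _; rewrite -mulrBr normrM sgn_norm mul1r.
- move=> i x y /(sgn2 i) x2 /(sgn2 i) y2; have [_ [_ h _ _ _]] := psiC x2 y2 tT tT.
  rewrite -mulrBr normrM sgn_norm mul1r.
  by apply: le_trans h _; rewrite -mulrBr normrM sgn_norm mul1r.
- move=> i x y /(sgn2 i) x2 /(sgn2 i) y2; have [_ [_ _ h _ _]] := psiC x2 y2 tT tT.
  have E : sgn R i * psi_x (sgn R i * x, t) * (y - x) =
     psi_x (sgn R i * x, t) * (sgn R i * y - sgn R i * x) by ring.
  rewrite E; apply: le_trans h _.
  by rewrite -mulrBr exprMn expr2 sgn_sqr mul1r.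
Qed.

(** The mass of the profile at time s tested with psi at time t. The two
times are kept apart because s and t are varied by different means: the scheme
for s, Taylor's formula for t. *)
Definition paired_mass s t : R := \sum_(i < 2) \int[mu]_(x in Omega R i)
  (por i * U i (sgn R i * x) s * psi (x, t)).

Definition paired_rate s t : R := \sum_(i < 2) \int[mu]_(x in Omega R i)
  (por i * U i (sgn R i * x) s * psi_t (x, t)).

Definition storage_term t : R := \sum_(i < 2) \int[mu]_(x in Omega R i)
  (por i * solution U (x, t) * psi_t (x, t)).

Definition flux_term t : R := \sum_(i < 2) \int[mu]_(x in Omega R i)
  (dphi rk K U i (x, t) * psi_x (x, t)).

Lemma mass_ofE s t :
  mass_of rk (fun i y => psi (sgn R i * y, t)) (fun i y => U i y s) = paired_mass s t.
Proof.
apply: eq_bigr => i _; apply: eq_Rintegral => x _.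
by rewrite mulrA sgn_sqr mul1r.
Qed.

Lemma flux_termE t : \sum_(i < 2) \int[mu]_(x in Omega R i)
   (dphi rk K U i (x, t) * (sgn R i * (sgn R i * psi_x (sgn R i * (sgn R i * x), t)))) =
  flux_term t.
Proof.
apply: eq_bigr => i _; apply: eq_Rintegral => x _.
by rewrite !(mulrA (sgn R i)) !sgn_sqr !mul1r.
Qed.

Lemma storage_termE t : storage_term t = paired_rate t t.
Proof.
apply: eq_bigr => i _; apply: eq_Rintegral => x; rewrite inE => Ox.
by rewrite (solution_Omega _ _ Ox) side_Omega.
Qed.

Let mUx i s : measurable_fun (Omega R i) (fun x => U i (sgn R i * x) s).
Proof.
apply: (@eq_measurable_fun _ _ _ _ _ (fun x => side U i (x, s))).
  by move=> x; rewrite inE => Ox; rewrite side_Omega.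
apply: measurable_funTS.
exact: (measurable_fun_pair1 s (continuous2_measurable (@side_continuous _ _ _ _ _ H i))).
Qed.

Let mf2 i (f : R * R -> R) t : continuous f -> measurable_fun (Omega R i) (fun x => f (x, t)).
Proof.
move=> fc; apply: measurable_funTS.
exact: (measurable_fun_pair1 t (continuous2_measurable fc)).
Qed.

Let weight i s (f : R -> R) M : (forall x, Omega R i x -> `|f x| <= M) ->
  forall x, Omega R i x -> `|por i * U i (sgn R i * x) s * f x| <= M.
Proof.
move=> fM x Ox; have /andP[p0 p1] := por_itv i.
have /andP[u0 u1] := sl_itv H i (sgn R i * x) s.
have M0 : 0 <= M := le_trans (normr_ge0 _) (fM x Ox).
rewrite !normrM (gtr0_norm p0) (ger0_norm u0) -[leRHS]mul1r; apply: ler_pM => //.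
- by rewrite mulr_ge0// ltW.
- by rewrite mulr_ile1// ltW.
- exact: fM.
Qed.

Let mweight i s (f : R -> R) : measurable_fun (Omega R i) f ->
  measurable_fun (Omega R i) (fun x => por i * U i (sgn R i * x) s * f x).
Proof. by move=> mf; apply: measurable_funM => //; apply: measurable_funM. Qed.

Let psi_le i t : 0 <= t <= T -> forall x, Omega R i x -> `|psi (x, t)| <= C.
Proof. by move=> tT x /O2 x2; have [[]] := psiC x2 x2 tT tT. Qed.

Let psi_t_le i t : 0 <= t <= T -> forall x, Omega R i x -> `|psi_t (x, t)| <= C.
Proof. by move=> tT x /O2 x2; have [[]] := psiC x2 x2 tT tT. Qed.

Let psi_x_le i t : 0 <= t <= T -> forall x, Omega R i x -> `|psi_x (x, t)| <= C.
Proof. by move=> tT x /O2 x2; have [[]] := psiC x2 x2 tT tT. Qed.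

Let bint i (f : R -> R) M : measurable_fun (Omega R i) f ->
  (forall x, Omega R i x -> `|f x| <= M) -> mu.-integrable (Omega R i) (EFin \o f).
Proof.
move=> mf fM; apply: (@bounded_integrable _ _ _ _ _ _ M);
  [exact: mO|exact: Ofin|exact: mf|exact: fM].
Qed.

Let Rint_lin i (f g h : R -> R) c M :
  measurable_fun (Omega R i) f -> measurable_fun (Omega R i) g -> measurable_fun (Omega R i) h ->
  (forall x, Omega R i x -> `|f x| <= M) -> (forall x, Omega R i x -> `|g x| <= M) ->
  (forall x, Omega R i x -> `|h x| <= M) ->
  \int[mu]_(x in Omega R i) f x - \int[mu]_(x in Omega R i) g x -
   \int[mu]_(x in Omega R i) h x * c = \int[mu]_(x in Omega R i) (f x - g x - h x * c).
Proof.
move=> mf mg mh fM gM hM.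
have fi := bint mf fM; have gi := bint mg gM; have hi := bint mh hM.
have mhc : measurable_fun (Omega R i) (fun x => h x * c) by exact: measurable_funM.
have hcM x : Omega R i x -> `|h x * c| <= M * `|c|.
  by move=> Ox; rewrite normrM ler_wpM2r//; exact: hM.
have hci := bint mhc hcM.
have mfg : measurable_fun (Omega R i) (fun x => f x - g x) by exact: measurable_funB.
have fgM x : Omega R i x -> `|f x - g x| <= M + M.
  by move=> Ox; apply: le_trans (ler_normB _ _) _; apply: lerD; [exact: fM|exact: gM].
have fgi := bint mfg fgM.
rewrite RintegralB; [|exact: mO|exact: fgi|exact: hci].
rewrite RintegralB; [|exact: mO|exact: fi|exact: gi].
by rewrite RintegralZr; [|exact: mO|exact: hi].
Qed.

Let sum2_le (f : 'I_2 -> R) M : (forall i, `|f i| <= M) -> `|\sum_(i < 2) f i| <= 2 * M.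
Proof.
move=> fM; rewrite (sum_I2 _ ord0); apply: le_trans (ler_normD _ _) _.
by have := fM ord0; have := fM (rev_ord ord0); lra.
Qed.

Lemma paired_rate_le s t : 0 <= t <= T -> `|paired_rate s t| <= 2 * C.
Proof.
move=> tT; apply: sum2_le => i; apply: Omega_integral_le.
  by apply: mweight; exact: mf2.
by apply: weight; exact: psi_t_le.
Qed.

Lemma flux_term_le t : 0 <= t <= T -> `|flux_term t| <= 2 * (K * C).
Proof.
move=> tT; apply: sum2_le => i; apply: Omega_integral_le.
  have md : measurable_fun (Omega R i) (fun x => dphi rk K U i (x, t)).
    by apply: measurable_funTS; exact: (measurable_fun_pair1 t (dphi_measurable H i)).
  exact: (measurable_funM md (@mf2 i _ t psi_xc)).
move=> x Ox; rewrite normrM; apply: ler_pM => //; first exact: (dphi_bound H).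
exact: (psi_x_le tT Ox).
Qed.

Lemma paired_mass_taylor s t t' : 0 <= t <= T -> 0 <= t' <= T ->
  `|paired_mass s t' - paired_mass s t - paired_rate s t * (t' - t)| <= 2 * (C * (t' - t) ^+ 2).
Proof.
move=> tT tT'; rewrite /paired_mass /paired_rate.
rewrite mulr_suml -!sumrB; apply: sum2_le => i.
rewrite (@Rint_lin i _ _ _ (t' - t) C); first last.
- by apply: weight; exact: psi_t_le.
- by apply: weight; exact: psi_le.
- by apply: weight; exact: psi_le.
- by apply: mweight; exact: mf2.
- by apply: mweight; exact: mf2.
- by apply: mweight; exact: mf2.
rewrite (_ : \int[mu]_(x in Omega R i) _ = \int[mu]_(x in Omega R i)
   (por i * U i (sgn R i * x) s * (psi (x, t') - psi (x, t) - psi_t (x, t) * (t' - t)))); last first.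
  by apply: eq_Rintegral => x _; ring.
apply: Omega_integral_le.
  apply: mweight; apply: measurable_funB; last first.
    by apply: measurable_funM => //; exact: mf2.
  by apply: measurable_funB; exact: mf2.
apply: weight => x /O2 x2; have [_ [_ _ _ _ h]] := psiC x2 x2 tT tT'.
exact: h.
Qed.

Lemma paired_rate_time e : 0 < e -> exists2 d, 0 < d & forall s s' t, 0 <= t <= T ->
  `|s - s'| <= d -> `|paired_rate s t - paired_rate s' t| <= 2 * (C * e).
Proof.
move=> e0; have [d d0 Hd] := sl_time H e0; exists d => // s s' t tT ss.
rewrite /paired_rate -sumrB; apply: sum2_le => i.
rewrite -[X in `|X|]subr0 -[X in `|_ - X|](mulr0 (\int[mu]_(x in Omega R i) 0)).
rewrite (@Rint_lin i _ _ _ 0 C); first last.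
- by move=> x _; rewrite normr0.
- by apply: weight; exact: psi_t_le.
- by apply: weight; exact: psi_t_le.
- exact: measurable_cst.
- by apply: mweight; exact: mf2.
- by apply: mweight; exact: mf2.
apply: Omega_integral_le.
  apply: measurable_funB; last by rewrite (_ : (fun x => 0 * 0) = (fun=> 0))//; apply/funext => x; rewrite mulr0.
  by apply: measurable_funB; apply: mweight; exact: mf2.
move=> x Ox; rewrite mulr0 subr0 -mulrBl -mulrBr -mulrA normrM.
have /andP[p0 p1] := por_itv i; rewrite (gtr0_norm p0) normrM.
have u1 : `|U i (sgn R i * x) s - U i (sgn R i * x) s'| <= e.
  apply: Hd => //; move: Ox; rewrite /Omega/= in_itv/= sgn_omega => /andP[h1 h2].
  by rewrite !ltW.
have u2 := psi_t_le tT Ox.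
rewrite mulrC (mulrC C); apply: (@le_trans _ _ (e * C * 1)); last by rewrite mulr1.
by apply: ler_pM => //; [exact: ltW|exact: ler_pM|exact: ltW].
Qed.

Let m t := paired_mass t t.

Lemma paired_mass_lip s t : 0 <= s <= T -> 0 <= t <= T ->
  `|m s - m t| <= (2 * K * C + (2 * C + 2 * C * T)) * `|s - t|.
Proof.
move=> sT tT.
have h1 := sl_mass_lip H t s (section_test_bound sT); rewrite !mass_ofE in h1.
have h2 := paired_mass_taylor t tT sT; have h3 := paired_rate_le t tT.
have h4 : 2 * (C * (s - t) ^+ 2) <= 2 * C * T * `|s - t|.
  rewrite -[(s - t) ^+ 2]real_normK ?num_real// expr2 !mulrA ler_wpM2r// ler_wpM2l ?mulr_ge0//.
  by rewrite ler_norml; move: sT tT => /andP[? ?] /andP[? ?]; apply/andP; split; lra.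
have h5 : `|paired_rate t t * (s - t)| <= 2 * C * `|s - t| by rewrite normrM ler_wpM2r.
rewrite (_ : m s - m t = (paired_mass s s - paired_mass t s) +
  ((paired_mass t s - paired_mass t t - paired_rate t t * (s - t)) + paired_rate t t * (s - t))).
  apply: le_trans (ler_normD _ _) _; rewrite mulrDl; apply: lerD => //.
  apply: le_trans (ler_normD _ _) _; rewrite mulrDl addrC; apply: lerD => //.
  exact: le_trans h4.
by rewrite /m; ring.
Qed.

(** The profile is moved from t to t + h by sl_evolution, the test function
by Taylor's formula at the profile of time t + h, which is close to that of
time t. *)
Lemma paired_mass_derive (t : R) : 0 < t < T ->
  is_derive t (1 : R) m (storage_term t - flux_term t).
Proof.
move=> /andP[t0 tT]; have tT' : 0 <= t <= T by rewrite !ltW.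
rewrite -[X in is_derive _ _ _ X]mulr1.
have di : is_derive t (1 : R) (@id R) 1 by exact: is_derive_id.
apply: (is_derive_approx di) => e e0.
have C1 : 0 < C + 1 by rewrite ltr_wpDl.
have e4 : 0 < e / (8 * (C + 1)) by rewrite divr_gt0// mulr_gt0.
have e2 : 0 < e / 4 by rewrite divr_gt0.
have [d1 d10 Hd1] := paired_rate_time e4.
have [d2 d20 Hd2] := sl_evolution H (section_test_bound tT') e2.
have Ce : 2 * (C * (e / (8 * (C + 1)))) <= e / 4.
  rewrite [leLHS](_ : _ = e / 4 * (C / (C + 1))); last by field; rewrite gt_eqF.
  by rewrite ler_piMr ?(ltW e2)// ler_pdivrMr// mul1r lerDl.
near=> h.
have hd1 : `|h| <= d1 by near: h; exact: near0_le.
have hd2 : `|h| <= d2 by near: h; exact: near0_le.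
have hd3 : `|h| <= e / (8 * (C + 1)).
  by near: h; exact: near0_le.
have hd4 : `|h| <= t by near: h; exact: near0_le.
have hd5 : `|h| <= T - t.
  by near: h; apply: near0_le; rewrite subr_gt0.
have /andP[hl hr] : - `|h| <= h <= `|h| by rewrite -ler_norml.
have htT : 0 <= h + t <= T.
  rewrite -lerBlDr sub0r -lerBrDr (le_trans hr hd5) andbT.
  by apply: le_trans hl; rewrite lerN2.
have a1 := paired_mass_taylor (h + t) tT' htT; rewrite addrK in a1.
have a2 : `|paired_rate (h + t) t - paired_rate t t| <= e / 4.
  by apply: le_trans Ce; apply: Hd1 => //; rewrite addrK.
have a3 : `|paired_mass (h + t) t - paired_mass t t + flux_term t * h| <= e / 4 * `|h|.
  have [h0|h0] := leP 0 h.
    have := Hd2 t (h + t) t (fun i x => dphi rk K U i (x, t)) (ltW t0) (lexx t) _ _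
      (fun i => dphi_space_derivative H i t).
    rewrite addrK !mass_ofE flux_termE (ger0_norm h0) (mulrC (flux_term t)) (mulrC (e / 4)).
    by apply; [rewrite lerDr|rewrite -(ger0_norm h0)].
  have := Hd2 (h + t) t t (fun i x => dphi rk K U i (x, t)) _ _ (lexx t) _
    (fun i => dphi_space_derivative H i t).
  rewrite (_ : t - (h + t) = - h); last by ring.
  rewrite !mass_ofE flux_termE (ltr0_norm h0) (mulrC (e / 4)) => a3.
  have E : - (paired_mass (h + t) t - paired_mass t t + flux_term t * h) =
     paired_mass t t - paired_mass (h + t) t + - h * flux_term t by ring.
  by rewrite -normrN E; apply: a3; [case/andP: htT|rewrite gerDr ltW|rewrite -(ltr0_norm h0)].
have a4 : 2 * (C * h ^+ 2) <= e / 4 * `|h|.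
  rewrite -[h ^+ 2]real_normK ?num_real// expr2 !mulrA ler_wpM2r//.
  by apply: le_trans Ce; rewrite mulrA ler_wpM2l// mulr_ge0.
rewrite /= addrK storage_termE.
(* variations of the test function, of the profile in the rate, of the profile in the mass *)
rewrite (_ : _ - _ = (paired_mass (h + t) (h + t) - paired_mass (h + t) t - paired_rate (h + t) t * h) +
  (paired_rate (h + t) t - paired_rate t t) * h +
  (paired_mass (h + t) t - paired_mass t t + flux_term t * h)); last by rewrite /m; ring.
apply: le_trans (ler_normD _ _) _.
have a5 := ler_normD (paired_mass (h + t) (h + t) - paired_mass (h + t) t - paired_rate (h + t) t * h)
  ((paired_rate (h + t) t - paired_rate t t) * h).
have a6 : `|(paired_rate (h + t) t - paired_rate t t) * h| <= e / 4 * `|h|.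
  by rewrite normrM ler_wpM2r.
have a7 : e * `|h| = e / 4 * `|h| + e / 4 * `|h| + e / 4 * `|h| + e / 4 * `|h| by field.
have a8 : 0 <= e / 4 * `|h| by rewrite mulr_ge0// ltW.
move: a1 a3 a4 a5 a6 a7 a8; move: (e / 4 * `|h|) (e * `|h|) (2 * (C * _)) (`|_ + _ + _|) (`|_|) => *.
lra.
Unshelve. all: by end_near. Qed.

Let mT : measurable (`]0, T[%classic : set R). Proof. exact: measurable_itv. Qed.
Let Tfin : (mu `]0%R, T[%classic < +oo)%E.
Proof. by rewrite lebesgue_measure_itv/= lte_fin T_gt0 -EFinD ltry. Qed.

Let mterm (f : 'I_2 -> R * R -> R) M : (forall i, measurable_fun setT (f i)) ->
  (forall i p, Qset T i p -> `|f i p| <= M) ->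
  measurable_fun `]0, T[ (fun t => \sum_(i < 2) \int[mu]_(x in Omega R i) f i (x, t)).
Proof.
move=> mf fM; have mi i : measurable_fun `]0, T[ (fun t => \int[mu]_(x in Omega R i) f i (x, t)).
  apply: (@measurable_partial_integral _ _ _ _ M); [exact: mO|exact: mT|exact: Ofin|exact: Tfin| |].
    by apply: measurable_funTS; exact: mf.
  exact: fM.
rewrite (_ : (fun t => _) = (fun t => \int[mu]_(x in Omega R ord0) f ord0 (x, t) +
   \int[mu]_(x in Omega R (rev_ord ord0)) f (rev_ord ord0) (x, t))).
  exact: (measurable_funD (mi _) (mi _)).
by apply/funext => t; rewrite (sum_I2 _ ord0).
Qed.

Let storage_measurable : measurable_fun `]0, T[ storage_term.
Proof.
apply: (@mterm (fun i p => por i * solution U p * psi_t p) C) => [i|i [x t] [Ox]].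
  exact: (measurable_funM (measurable_funM (measurable_cst _) (solution_measurable H))
    (continuous2_measurable psi_tc)).
rewrite /= in_itv/= => /andP[t0 tT].
have tT' : 0 <= t <= T by rewrite !ltW.
rewrite (solution_Omega _ _ Ox) side_Omega//.
exact: (@weight i t (fun x => psi_t (x, t)) C (@psi_t_le i t tT') x Ox).
Qed.

Let flux_measurable : measurable_fun `]0, T[ flux_term.
Proof.
apply: (@mterm (fun i p => dphi rk K U i p * psi_x p) (K * C)) => [i|i [x t] [Ox]].
  exact: (measurable_funM (dphi_measurable H i) (continuous2_measurable psi_xc)).
rewrite /= in_itv/= => /andP[t0 tT].
have tT' : 0 <= t <= T by rewrite !ltW.
by rewrite normrM; apply: ler_pM => //; [exact: (dphi_bound H)|exact: (psi_x_le tT' Ox)].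
Qed.

(** The support of psi is compact in [-1, 1] x [0, T), so psi vanishes near
the final time, hence also at it. *)
Lemma test_final_time (x : R) : -1 < x < 1 -> psi (x, T) = 0.
Proof.
move=> /andP[x1 x2]; apply: test_function_boundary psi_test _ _; last first.
  by case=> _ /=; rewrite in_itv/= ltxx andbF.
move=> B [[B1 B2] /= [nB1 nB2] B12].
have [t [tT Bt]] := closure_itv_right T_gt0 nB2.
exists (x, t); split; last by apply: B12; split=> //=; exact: nbhs_singleton.
move: tT; rewrite /= in_itv/= => /andP[t0 tT].
by split; rewrite /= in_itv/= ltW//= ltW.
Qed.

(** The function t |-> paired_mass t t is Lipschitz on [0, T], its derivative
is the storage term minus the flux term, and it vanishes at T. *)
Lemma weak_identity :
  \int[mu]_(t in `]0, T[) storage_term t - \int[mu]_(t in `]0, T[) flux_term t =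
  - paired_mass 0 0.
Proof.
have [_ FTC] := lipschitz_FTC T_gt0 paired_mass_lip.
have [||_] := FTC (fun t => storage_term t - flux_term t).
- exact: (measurable_funB storage_measurable flux_measurable).
- apply: aeW => t t0T _; have dm := paired_mass_derive t0T.
  by rewrite derive1E (@derive_val _ _ _ _ _ _ _ dm).
have mT0 : m T = 0.
  rewrite /m /paired_mass big1// => i _.
  have -> : \int[mu]_(x in Omega R i) (por i * U i (sgn R i * x) T * psi (x, T)) =
     \int[mu]_(x in Omega R i) (0 : R).
    apply: eq_Rintegral => x; rewrite inE /Omega/= in_itv/= => xO.
    rewrite test_final_time ?mulr0//; move: xO.
    by elim/I2_cases: i => /= /andP[h1 h2]; apply/andP; split; lra.
  by rewrite Rintegral_cst; [rewrite mul0r|exact: mO].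
rewrite mT0 sub0r => <-.
have inT (t : R) : `]0, T[%classic t -> 0 <= t <= T.
  by rewrite /= in_itv/= => /andP[h1 h2]; rewrite !ltW.
rewrite RintegralB//.
- apply: (@bounded_integrable _ _ _ _ _ _ (2 * C));
    [exact: mT|exact: Tfin|exact: storage_measurable|].
  by move=> t /inT tT; rewrite storage_termE; exact: paired_rate_le.
- apply: (@bounded_integrable _ _ _ _ _ _ (2 * (K * C)));
    [exact: mT|exact: Tfin|exact: flux_measurable|].
  by move=> t /inT tT; exact: flux_term_le.
Qed.

End WeakFormulation.

(** * Initial data and conclusion *)

Section SolutionSpaces.
Context (R : realType) (rk : 'I_2 -> rock R) (K : R) (U0 : 'I_2 -> R -> R)
  (U : 'I_2 -> R -> R -> R) (T : R).
Hypothesis H : scheme_limit rk K U0 U.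
Hypothesis T_gt0 : 0 < T.

Let mO i : measurable (Omega R i). Proof. exact: measurable_itv. Qed.
Let Ofin i : (leb R (Omega R i) < +oo)%E. Proof. by rewrite Omega_measure ltry. Qed.
Let mT : measurable (`]0, T[%classic : set R). Proof. exact: measurable_itv. Qed.
Let Tfin : (leb R `]0%R, T[%classic < +oo)%E.
Proof. by rewrite lebesgue_measure_itv/= lte_fin T_gt0 -EFinD ltry. Qed.
Let mQ i : measurable (Qset T i). Proof. exact: measurableX. Qed.
Let Qfin i : (leb2 R (Qset T i) < +oo)%E. Proof. exact: finite_rectangle. Qed.

(** The continuous representative is the solution itself, and the two traces
are the saturations of the two media under one pressure. *)
Lemma solution_traces t : traces_connected rk (fun x => solution U (x, t)).
Proof.
exists (fun i => U i 0 t); split=> [i|].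
  split; first by rewrite in_itv/= (sl_itv H).
  exists (fun x => kside rk U i (x, t)); split.
  - apply: continuous_subspaceT => x.
    have h := @kside_continuous _ _ _ _ _ H i (x, t).
    apply: (cvg_comp _ _ _ h) => B [[B1 B2] /= [nB1 nB2] B12].
    apply: filterS nB1 => z B1z; apply: B12; split=> //=; exact: nbhs_singleton nB2.
  - by apply: aeW => x Ox; rewrite /= (solution_Omega _ _ Ox).
  - by rewrite /kside /side/= mulr0 clamp_id// lexx ler01.
have [q Hq] := sl_interface H t; exists q; split; rewrite Hq; exact: sat_pi.
Qed.

Lemma dphi_Lfunoo i : dphi rk K U i \_ (Qset T i) \in Lfun (leb2 R) +oo%E.
Proof.
apply: (@bounded_Lfunoo _ _ _ (leb2 R) (Qset T i) _ K); first exact: mQ.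
  by apply: measurable_funTS; exact: (dphi_measurable H i).
by move=> p _; exact: (dphi_bound H).
Qed.

Let kbound i p : `|kirchhoff (rk i) (solution U p)| <= kirchhoff (rk i) 1.
Proof. by have /andP[h0 h1] := kirchhoff_itv (rk i) (solution_itv H p); rewrite ger0_norm. Qed.

Lemma solution_L2H1 i : L2H1 T i (kirchhoff (rk i) \o solution U) (dphi rk K U i).
Proof.
have mk := ksolution_measurable H i; have md := dphi_measurable H i.
split.
- apply: (@bounded_Lfun2 _ _ _ (leb2 R) (Qset T i) _ (kirchhoff (rk i) 1)).
  + exact: mQ.
  + exact: Qfin.
  + by apply: measurable_funTS; exact: mk.
  + by move=> p _; exact: kbound.
- apply: (@bounded_Lfun2 _ _ _ (leb2 R) (Qset T i) _ K).
  + exact: mQ.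
  + exact: Qfin.
  + by apply: measurable_funTS; exact: md.
  + by move=> p _; exact: (dphi_bound H).
- apply: aeW => t _; split.
  + apply: (@bounded_Lfun2 _ _ _ (leb R) (Omega R i) _ (kirchhoff (rk i) 1)).
    * exact: mO.
    * exact: Ofin.
    * by apply: measurable_funTS; exact: (measurable_fun_pair1 t mk).
    * by move=> x _; exact: kbound.
  + apply: (@bounded_Lfun2 _ _ _ (leb R) (Omega R i) _ K).
    * exact: mO.
    * exact: Ofin.
    * by apply: measurable_funTS; exact: (measurable_fun_pair1 t md).
    * by move=> x _; exact: (dphi_bound H).
  + exact: (kside_weak_derivative H).
Qed.

End SolutionSpaces.

Section InitialData.
Context (R : realType).

Lemma Omega_sub i (x : R) : Omega R i x -> -1 < x < 1.
Proof.
rewrite /Omega/= in_itv/=; elim/I2_cases: i => /= /andP[h1 h2]; apply/andP; split; lra.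
Qed.

Lemma kirchhoff_onto (rk : rock R) c : 0 <= c <= kirchhoff rk 1 ->
  exists2 s, 0 <= s <= 1 & kirchhoff rk s = c.
Proof.
move=> c1; have k01 := kirchhoff0 rk.
have kl : kirchhoff rk 0 <= kirchhoff rk 1.
  by rewrite kirchhoff0; have /andP[] := @kirchhoff_itv _ rk 1 (introT andP (conj ler01 (lexx 1))).
have [|s s01 E] := @IVT R (kirchhoff rk) 0 1 c ler01
  (continuous_subspaceT (@kirchhoff_continuous _ rk)).
  by rewrite (min_idPl kl) (max_idPr kl) kirchhoff0.
by exists s => //; rewrite in_itv in s01.
Qed.

(** Bounded weak derivatives make the Kirchhoff transform of the initial
data Lipschitz (weak_lipschitz), and its continuous representative has the
prescribed trace at the interface. The profile is the inverse image of this
representative under the Kirchhoff transform. *)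
Lemma initial_profile (rk : 'I_2 -> rock R) (u0 : R -> R) :
  u0 \_ `]-1, 1[ \in Lfun (leb R) +oo%E ->
  {ae leb R, forall x, x \in `]-1, 1[ -> 0 <= u0 x <= 1} ->
  (forall i, exists g : R -> R, sobolev +oo%E (Omega R i) (kirchhoff (rk i) \o u0) g) ->
  traces_connected rk u0 ->
  exists K, exists U0 : 'I_2 -> R -> R, [/\ forall i y, 0 <= U0 i y <= 1,
    forall i x y, 0 <= x <= 1 -> 0 <= y <= 1 ->
      `|kirchhoff (rk i) (U0 i x) - kirchhoff (rk i) (U0 i y)| <= K * `|x - y|,
    exists q, forall i, U0 i 0 = sat (rk i) q &
    forall i, {ae leb R, forall x, Omega R i x -> u0 x = U0 i (sgn R i * x)}].
Proof.
move=> u0oo u01 u0W [s [str [q [q0 q1]]]].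
have mO i : measurable (Omega R i) by exact: measurable_itv.
have sub i (x : R) : Omega R i x -> x \in `]-1, 1[ by move=> /Omega_sub; rewrite in_itv.
have data i : exists gK : (R -> R) * R, [/\
    {ae leb R, forall x, Omega R i x -> kirchhoff (rk i) (u0 x) = gK.1 x},
    gK.1 0 = kirchhoff (rk i) (s i) &
    forall a b, i%:R - 1 <= a <= i%:R -> i%:R - 1 <= b <= i%:R ->
      `|gK.1 a - gK.1 b| <= gK.2 * `|a - b|].
  have [_ [g [gc gE g0]]] := str i; have [w [voo woo vw]] := u0W i.
  have [K wK] := @Lfunoo_bound _ _ _ (leb R) (Omega R i) w (mO i) woo.
  have mv := @Lfunoo_measurable _ _ _ (leb R) (Omega R i) _ _ (mO i) voo.
  have mw := @Lfunoo_measurable _ _ _ (leb R) (Omega R i) _ _ (mO i) woo.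
  have ltc : i%:R - 1 < i%:R :> R by rewrite gtrBl.
  exists (g, K); split=> //= a b.
  apply: (@weak_lipschitz R (i%:R - 1) i%:R K (kirchhoff (rk i) \o u0) w g ltc mv mw) => //.
have [gK gKP] := choice data.
(* gK takes its values in the range of the Kirchhoff transform a.e. only *)
pose G i y := clamp 0 (kirchhoff (rk i) 1) ((gK i).1 (sgn R i * y)).
have k1 i : 0 <= kirchhoff (rk i) 1.
  by have /andP[] := @kirchhoff_itv _ (rk i) 1 (introT andP (conj ler01 (lexx 1))).
have ex (iy : 'I_2 * R) : exists v, 0 <= v <= 1 /\ kirchhoff (rk iy.1) v = G iy.1 iy.2.
  have [v v01 E] := @kirchhoff_onto (rk iy.1) (G iy.1 iy.2) (clamp_itv _ (k1 _)).
  by exists v.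
have [V VP] := choice ex.
exists (`|(gK ord0).2| + `|(gK ord_max).2|), (fun i y => V (i, y)); split.
- by move=> i y; have [] := VP (i, y).
- move=> i x y x1 y1; have [_ ->] := VP (i, x); have [_ ->] := VP (i, y).
  apply: le_trans (clamp_lip _ _ (k1 i)) _.
  have [_ _ gL] := gKP i.
  apply: le_trans (gL _ _ _ _) _; rewrite ?sgn_closed ?mulrA ?sgn_sqr ?mul1r//.
  rewrite -mulrBr normrM sgn_norm mul1r ler_wpM2r//.
  by apply: le_trans (ler_norm _) _; elim/I2_cases: i {gL}; rewrite ?lerDl ?lerDr.
- exists q => i; have [V01 VE] := VP (i, 0); rewrite /= in V01 VE.
  have [si _] := str i; rewrite in_itv/= in si; have [_ g0 _] := gKP i.
  rewrite /G mulr0 g0 clamp_id ?kirchhoff_itv// in VE.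
  rewrite (kirchhoff_inj V01 si VE); apply: sat_uniq => //.
  by elim/I2_cases: i {V01 VE si g0}; [exact: q0|rewrite (_ : ord_max = 1)//; exact/val_inj].
- move=> i; have [gE _ _] := gKP i.
  apply: (ae_mono2 gE u01) => x gx ux Ox.
  have u0x := ux (sub _ _ Ox); have [V01 VE] := VP (i, sgn R i * x); rewrite /= in V01 VE.
  apply: (@kirchhoff_inj _ (rk i) _ _ u0x V01); rewrite VE /G mulrA sgn_sqr mul1r -(gx Ox) clamp_id//.
  exact: kirchhoff_itv.
Qed.

End InitialData.

Theorem theorem4p1 (R : realType) (T : R) (rk : 'I_2 -> rock R) (u0 : R -> R)
  (T_gt0 : 0 < T)
  (u0_Linfty : u0 \_ `]-1, 1[ \in Lfun (leb R) +oo%E)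
  (u0_itv : {ae leb R, forall x, x \in `]-1, 1[ -> 0 <= u0 x <= 1})
  (u0_W1infty : forall i, exists g : R -> R,
    sobolev +oo%E (Omega R i) (kirchhoff (rk i) \o u0) g)
  (u0_traces : traces_connected rk u0) :
  exists u : R * R -> R,
    weak_solution rk T u0 u /\
    forall i, exists g : R * R -> R,
      L2H1 T i (kirchhoff (rk i) \o u) g /\
      g \_ (Qset T i) \in Lfun (leb2 R) +oo%E.
Proof.
have [K [U0 [U01 U0K U0q U0E]]] := initial_profile u0_Linfty u0_itv u0_W1infty u0_traces.
have [U H] := scheme_limit_exists U01 U0K U0q.
have mO i : measurable (Omega R i) by exact: measurable_itv.
exists (solution U); split; last first.
  move=> i; exists (dphi rk K U i); split; first exact: (solution_L2H1 H T_gt0).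
  exact: dphi_Lfunoo H _.
split.
- apply: (@bounded_Lfunoo _ _ _ (leb2 R) _ _ 1).
  + by apply: measurableX; exact: measurable_itv.
  + by apply: measurable_funTS; exact: (solution_measurable H).
  + by move=> p _; have /andP[h0 h1] := solution_itv H p; rewrite ger0_norm.
- by apply: aeW => p _ _; exact: (solution_itv H).
- by apply: aeW => t _; exact: (solution_traces H).
exists (dphi rk K U); split=> [i|psi tp]; first exact: (solution_L2H1 H T_gt0).
have sp : smooth psi by case: tp.
have [C C0 HC] := @smooth_box R psi T sp.
have id := weak_identity H T_gt0 tp C0 HC.
have -> : \sum_(i < 2) \int[leb R]_(x in Omega R i) (porosity (rk i) * u0 x * psi (x, 0)) =
   paired_mass rk U psi 0 0.
  apply: eq_bigr => i _.
  have mpsi : measurable_fun (Omega R i) (fun x => psi (x, 0)).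
    apply: measurable_funTS.
    exact: (measurable_fun_pair1 (0 : R) (continuous2_measurable (smooth_continuous sp))).
  have mU : measurable_fun (Omega R i) (fun x => U i (sgn R i * x) 0).
    apply: (@eq_measurable_fun _ _ _ _ _ (fun x => side U i (x, 0))).
      by move=> x; rewrite inE => Ox; rewrite side_Omega.
    apply: measurable_funTS.
    exact: (measurable_fun_pair1 (0 : R) (continuous2_measurable (@side_continuous _ _ _ _ _ H i))).
  have mu0 : measurable_fun (Omega R i) u0.
    have m1 : measurable (`]-1, 1[%classic : set R) by exact: measurable_itv.
    apply: (measurable_funS m1 _ (@Lfunoo_measurable _ _ _ (leb R) _ _ _ m1 u0_Linfty)) => x.
    by move=> /Omega_sub; rewrite /= in_itv.
  apply: ae_eq_Rintegral.
  - exact: mO.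
  - exact: (measurable_funM (measurable_funM (measurable_cst _) mu0) mpsi).
  - exact: (measurable_funM (measurable_funM (measurable_cst _) mU) mpsi).
  - apply: (ae_mono (U0E i)) => x h Ox; rewrite (h Ox) (sl_start H)//.
    by move: Ox; rewrite /Omega/= in_itv/= sgn_omega => /andP[h1 h2]; rewrite !ltW.
by apply/eqP; rewrite addrAC addr_eq0; apply/eqP; exact: id.
Qed.
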